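(* For every class $\mathcal C$ of semiring aggregate queries such that $\mathrm{pghw}(\mathcal C)$ is bounded (i.e. there is $k$ with $\mathrm{pghw}(\gamma)\le k$ for all $\gamma\in\mathcal C$), $\mathcal C$ admits a constant delay enumeration after a polynomial pre-processing.
   Context: Databases. A relational schema is a finite set of relation names, each with an arity. An atom is $R(\bar t)$ with $\bar t$ a tuple of variables and constants of length $\mathrm{arity}(R)$; a fact is an atom with only constants; a database $D$ is a finite set of facts, of size $|D|=\sum_{R(\bar c)\in D}\mathrm{arity}(R)$. $\mathrm{vars}(\cdot)$ denotes the set of variables occurring in an object. A $K$-annotated database is a pair $(D,\nu)$ with $D$ a database and $\nu:D\to K$. Aggregate queries. A $K$-aggregate query is $\gamma=\pi_{X_n}^{\oplus_n}\cdots\pi_{X_1}^{\oplus_1}{\Join^{\otimes}}q$ with $q$ a finite set of atoms, $X_n\subsetneq\cdots\subsetneq X_1\subsetneq\mathrm{vars}(q)$, and $\oplus_i,\otimes$ commutative monoid operations on $K$. Semantics: for $q=\{\alpha_1,\dots,\alpha_\ell\}$, ${\Join^\otimes}q\langle D,\nu\rangle$ is the set of pairs $(h,\nu(h(\alpha_1))\otimes\cdots\otimes\nu(h(\alpha_\ell)))$ where $h$ ranges over the homomorphisms $q\to D$ fixing constants; and $(\pi_Y^\oplus\gamma')\langle D,\nu\rangle$ is the set of pairs $(f,n)$, $f:Y\to\mathrm{Const}$, such that $S_f=\{(f',n')\in\gamma'\langle D,\nu\rangle : f'|_Y=f\}$ is non-empty and $n$ is the $\oplus$-sum (with multiplicities)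 of all $n'$ over $(f',n')\in S_f$. $\gamma$ is a semiring ($K$-)aggregate query if $(K,\oplus_i,\otimes)$ is a commutative semiring for every $i$. A commutative semiring $(K,\oplus,\otimes)$: $(K,\oplus)$ and $(K,\otimes)$ are commutative monoids, $\otimes$ distributes over $\oplus$, and $a\otimes 0_\oplus=0_\oplus$ for all $a$. Tree decompositions. The underlying hypergraph of $\gamma$ has vertices $\mathrm{vars}(q)$ and hyperedges $\{\mathrm{vars}(\alpha):\alpha\in q\}$. A (generalized hyper-)tree decomposition of a hypergraph $G$ is $(T,\mathbf b,\mathbf a)$ with $T$ a tree, $\mathbf b:V(T)\to2^{V(G)}$, $\mathbf a:V(T)\to2^{E(G)}$ such that (a) every $e\in E(G)$ is contained in some $\mathbf b(v)$; (b) for each $x\in V(G)$, $\{t: x\in\mathbf b(t)\}$ is connected in $T$; (c) $\mathbf b(v)\subseteq\bigcup\mathbf a(v)$ for all $v$. Its width is $\max_v|\mathbf a(v)|$. A witness subtree for $X$ is a connected subtree $T'$ with $\bigcup_{v\in V(T')}\mathbf b(v)=X$ (empty tree if $X=\emptyset$). The decomposition is project-connex for $\gamma$ if there are witness subtrees $T_i$ for $X_i$ ($i=1,\dots,n$) with $V(T_{i+1})\subseteq V(T_i)$ for $i<n$. $\mathrm{pghw}(\gamma)$ is the minimum width of a project-connex tree decomposition of $\gamma$. Complexity. The model is the RAM with unit-cost arithmetic and unit-cost semiring operations, memory initialised to $\bot$, and $d$-ary arrays (for every fixed $d$) indexed by constants with constant-time access. A class $\mathcal C$ admits constant delay enumeration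 after a polynomial pre-processing if there is an algorithm which, given $\gamma\in\mathcal C$ (a promise on the input) and an annotated database $(D,\nu)$, first performs a pre-processing in time $O(|D|^c)$ for some $c$ in data complexity (i.e. for fixed $\gamma$), building a data structure, and then enumerates all answers in $\gamma\langle D,\nu\rangle$ one by one without repetition, with time between consecutive answers independent of the size of the database. *)

(* Defs.v *)
From Stdlib Require List.
From mathcomp Require Import all_boot finmap.

Set Implicit Arguments.
Unset Strict Implicit.
Unset Printing Implicit Defensive.

(** * Databases

    Relation names are numbered: a schema is the list of the arities of its
    relation names.  Finite sets that are part of the input of an algorithm are
    duplicate-free lists, the order being the one in which they are stored. *)

Definition schema := seq nat.

Definition term (Const : Type) := (nat + Const)%type. (* variable or constant *)
Definition atom (Const : Type) := (nat * seq (term Const))%type.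
Definition fact (Const : Type) := (nat * seq Const)%type.

Definition fits (T : Type) (sg : schema) (a : nat * seq T) : bool :=
  onth sg a.1 == Some (size a.2).

Definition database_over (Const : eqType) (sg : schema) (D : seq (fact Const)) :=
  uniq D && all (fits sg) D.

Definition db_size (Const : Type) (D : seq (fact Const)) : nat :=
  \sum_(phi <- D) size phi.2.

Definition atom_vars (Const : Type) (al : atom Const) : {fset nat} :=
  [fset x in pmap (fun t => if t is inl x then Some x else None) al.2]%fset.

(** * Aggregate queries *)

Record cmonoid (K : Type) := CMonoid {
  munit : K;
  mop :> Monoid.com_law munit
}.

(* [projections] lists the pairs (X_i, op_i) in the order i = 1, ..., n in which
   they are applied. *)
Record query (Const : eqType) := Query {
  qschema : schema;
  body : seq (atom Const);
  carrier : Type;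
  times : cmonoid carrier;
  projections : seq ({fset nat} * cmonoid carrier)
}.

Section Queries.
Variable Const : eqType.
Implicit Types g : query Const.

Definition query_vars g : {fset nat} :=
  (\bigcup_(al <- body g) atom_vars al)%fset.

Definition proj_sets g : seq {fset nat} := [seq p.1 | p <- projections g].

Definition free_vars g : {fset nat} := last (query_vars g) (proj_sets g).

Definition well_formed g : bool :=
  [&& uniq (body g), all (fits (qschema g)) (body g)
    & path (fun X Y => (Y `<` X)%fset) (query_vars g) (proj_sets g)].

Definition is_semiring (K : Type) (plus times : cmonoid K) : Prop :=
  right_distributive times plus /\ right_zero (munit plus) times.

Definition semiring_query g : Prop :=
  well_formed g /\
  forall p, List.In p (projections g) -> is_semiring p.2 (times g).

(** ** Semantics *)

Definition assignment := {fmap nat -> Const}.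

Definition image_term (h : assignment) (t : term Const) : option Const :=
  match t with inl x => h.[? x]%fmap | inr c => Some c end.

Definition maps_to (h : assignment) (al : atom Const) (phi : fact Const) : bool :=
  (al.1 == phi.1) && (map (image_term h) al.2 == map Some phi.2).

(* The list [s] below is the list of the images of the atoms of the body. *)
Definition join_answer g (D : seq (fact Const)) (nu : fact Const -> carrier g)
    (h : assignment) (n : carrier g) : Prop :=
  domf h = query_vars g /\
  exists s : seq (fact Const),
    [/\ all2 (maps_to h) (body g) s, {subset s <= D}
      & n = \big[times g/munit (times g)]_(phi <- s) nu phi].

(* The list [s] below enumerates the set S_f. *)
Definition project (K : Type) (Y : {fset nat}) (plus : cmonoid K)
    (A : assignment -> K -> Prop) (f : assignment) (n : K) : Prop :=
  domf f = Y /\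
  exists s : seq (assignment * K),
    [/\ s <> [::], List.NoDup s,
        forall p, List.In p s <-> A p.1 p.2 /\ p.1.[& Y]%fmap = f
      & n = \big[plus/munit plus]_(p <- s) p.2].

Definition answer g (D : seq (fact Const)) (nu : fact Const -> carrier g) :
    assignment -> carrier g -> Prop :=
  foldl (fun A p => project p.1 p.2 A) (join_answer D nu) (projections g).

(** * Tree decompositions *)

Definition hyperedges g : {fset {fset nat}} :=
  [fset E in map (@atom_vars Const) (body g)]%fset.

Definition connected_in (T : finType) (e : rel T) (S : {set T}) : bool :=
  [forall u in S, forall v in S,
     connect [rel x y | [&& e x y, x \in S & y \in S]] u v].

Definition is_tree (T : finType) (e : rel T) : Prop :=
  [/\ symmetric e, irreflexive e, 0 < #|T|, connected_in e [set: T]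
    & forall p : seq T, 2 < size p -> ~ ucycle e p].

Record tree_decomposition g := TreeDecomposition {
  node : finType;
  edge : rel node;
  bag : node -> {fset nat};
  guard : node -> {fset {fset nat}};
  edge_tree : is_tree edge;
  bag_vars : forall v, (bag v `<=` query_vars g)%fset;
  guard_edges : forall v, (guard v `<=` hyperedges g)%fset;
  edge_covered : forall E, E \in hyperedges g -> exists v, (E `<=` bag v)%fset;
  var_connected : forall x, x \in query_vars g ->
    connected_in edge [set v | x \in bag v];
  bag_guarded : forall v, (bag v `<=` \bigcup_(E <- guard v) E)%fset
}.

Definition width g (d : tree_decomposition g) : nat :=
  \max_(v : node d) #|` guard v|.

(* A subtree is given by its set of vertices; the empty one is connected. *)
Definition witness_subtree g (d : tree_decomposition g) (X : {fset nat})
    (S : {set node d}) : bool :=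
  connected_in (@edge g d) S && ((\bigcup_(v in S) bag v)%fset == X).

Definition project_connex g (d : tree_decomposition g) : Prop :=
  exists W : seq {set node d},
    all2 (@witness_subtree g d) (proj_sets g) W /\
    sorted (fun S S' : {set node d} => S' \subset S) W.

Definition is_pghw g (w : nat) : Prop :=
  (exists2 d : tree_decomposition g, project_connex d & width d = w) /\
  (forall d : tree_decomposition g, project_connex d -> w <= width d).

Definition pghw_at_most g (k : nat) : Prop := exists2 w, is_pghw g w & w <= k.

End Queries.

(** * Random access machines

    The memory consists of arrays, named by numbers and indexed by tuples of
    numbers and constants; registers are the 0-ary arrays.  Programs do not
    depend on the annotation domain: semiring elements are opaque, and the
    operations of the given query are accessed through their index.  Arithmetic
    is restricted to addition and truncated subtraction. *)

Definition key (Const : Type) := (nat + Const)%type.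

Inductive value (Const K : Type) :=
| Bot
| Num of nat
| Cst of Const
| Ann of K.
Arguments Bot {Const K}.
Arguments Num {Const K} _.
Arguments Cst {Const K} _.
Arguments Ann {Const K} _.

Definition memory (Const K : Type) := nat -> seq (key Const) -> value Const K.

Definition reg := nat.

Inductive test :=
| TEq of reg & reg    (* equality of numbers, of constants, or both Bot *)
| TLt of reg & reg
| TNum of reg.        (* the register holds a number *)

Inductive instr :=
| IConst of reg & nat
| ILoad of reg & nat & seq reg          (* r := a[r1, ..., rd] *)
| IStore of nat & seq reg & reg         (* a[r1, ..., rd] := r *)
| IAdd of reg & reg & reg
| ISub of reg & reg & reg
| IUnit of reg                          (* neutral element of the product *)
| ITimes of reg & reg & reg
| IZero of reg & reg                    (* r := neutral element of plus_i *)
| IPlus of reg & reg & reg & reg        (* r := r1 plus_i r2 *)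
| IJump of nat
| IJumpIf of test & nat
| IEmit
| IHalt.
(* In [IZero r i] and [IPlus r i r1 r2], the register [i] holds the 0-based
   position of the operation in the list of projections. *)

Definition program := seq instr.

Section Machine.
Variables (Const : eqType) (g : query Const).
Local Notation K := (carrier g).
Local Notation value := (value Const K).
Local Notation memory := (memory Const K).

Definition key_of (v : value) : option (key Const) :=
  match v with Num n => Some (inl n) | Cst c => Some (inr c) | _ => None end.

Definition get (m : memory) (r : reg) : value := m r [::].

Definition update (m : memory) (a : nat) (i : seq (key Const)) (v : value) : memory :=
  fun a' i' => if (a' == a) && (i' == i) then v else m a' i'.

Definition set_reg (m : memory) (r : reg) (v : value) : memory := update m r [::] v.

(* The index tuple held by a list of registers, if it consists of numbers and
   constants only. *)
Definition index_of (m : memory) (rs : seq reg) : option (seq (key Const)) :=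
  foldr (fun r o => if key_of (get m r) is Some k then omap (cons k) o else None)
    (Some [::]) rs.

Definition holds (m : memory) (t : test) : bool :=
  match t with
  | TEq r s =>
      match get m r, get m s with
      | Num a, Num b => a == b
      | Cst a, Cst b => a == b
      | Bot, Bot => true
      | _, _ => false
      end
  | TLt r s =>
      match get m r, get m s with Num a, Num b => a < b | _, _ => false end
  | TNum r => if get m r is Num _ then true else false
  end.

Definition arith (f : nat -> nat -> nat) (u v : value) : value :=
  match u, v with Num a, Num b => Num (f a b) | _, _ => Bot end.

Definition semi (o : K -> K -> K) (u v : value) : value :=
  match u, v with Ann a, Ann b => Ann (o a b) | _, _ => Bot end.

Definition plus_at (v : value) : option (cmonoid K) :=
  if v is Num i then onth [seq p.2 | p <- projections g] i else None.

Definition config := (nat * memory)%type.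

Definition current (P : program) (c : config) : instr := nth IHalt P c.1.

Definition step (P : program) (c : config) : config :=
  let: (pc, m) := c in
  match current P c with
  | IConst r n => (pc.+1, set_reg m r (Num n))
  | ILoad r a rs =>
      (pc.+1, set_reg m r (if index_of m rs is Some i then m a i else Bot))
  | IStore a rs r =>
      (pc.+1, if index_of m rs is Some i then update m a i (get m r) else m)
  | IAdd r r1 r2 => (pc.+1, set_reg m r (arith addn (get m r1) (get m r2)))
  | ISub r r1 r2 => (pc.+1, set_reg m r (arith subn (get m r1) (get m r2)))
  | IUnit r => (pc.+1, set_reg m r (Ann (munit (times g))))
  | ITimes r r1 r2 => (pc.+1, set_reg m r (semi (times g) (get m r1) (get m r2)))
  | IZero r i =>
      (pc.+1, set_reg m r (if plus_at (get m i) is Some p then Ann (munit p) else Bot))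
  | IPlus r i r1 r2 =>
      (pc.+1, set_reg m r (if plus_at (get m i) is Some p
                       then semi p (get m r1) (get m r2) else Bot))
  | IJump l => (l, m)
  | IJumpIf t l => (if holds m t then l else pc.+1, m)
  | IEmit => (pc.+1, m)
  | IHalt => c
  end.

Definition emitting (P : program) (c : config) : bool :=
  if current P c is IEmit then true else false.

Definition halted (P : program) (c : config) : bool :=
  if current P c is IHalt then true else false.

(* Input layout; all the indices start at 0.
     0[]      number of relation names      1[r]     arity of relation r
     2[]      number of atoms               3[j]     relation name of atom j
                                            4[j,p]   p-th term of atom j, a number
                                                     for a variable
     5[]      number of projections         6[i]     cardinality of X_(i+1)
                                            7[i,p]   p-th variable of X_(i+1)
     8[]      number of facts               9[j]     relation name of fact j
                                            10[j,p]  p-th constant of fact j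
                                            11[j]    annotation of fact j *)
Definition input_memory (D : seq (fact Const)) (nu : fact Const -> K) : memory :=
  fun a i =>
  match a, i with
  | 0, [::] => Num (size (qschema g))
  | 1, [:: inl r] => oapp Num Bot (onth (qschema g) r)
  | 2, [::] => Num (size (body g))
  | 3, [:: inl j] => oapp (fun al => Num al.1) Bot (onth (body g) j)
  | 4, [:: inl j; inl p] =>
      oapp (fun t : term Const => match t with inl x => Num x | inr c => Cst c end)
        Bot (obind (fun al : atom Const => onth al.2 p) (onth (body g) j))
  | 5, [::] => Num (size (proj_sets g))
  | 6, [:: inl j] =>
      oapp (fun X : {fset nat} => Num (size (enum_fset X))) Bot
        (onth (proj_sets g) j)
  | 7, [:: inl j; inl p] =>
      oapp Num Bot
        (obind (fun X : {fset nat} => onth (enum_fset X) p) (onth (proj_sets g) j))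
  | 8, [::] => Num (size D)
  | 9, [:: inl j] => oapp (fun phi => Num phi.1) Bot (onth D j)
  | 10, [:: inl j; inl p] =>
      oapp Cst Bot (obind (fun phi : fact Const => onth phi.2 p) (onth D j))
  | 11, [:: inl j] => oapp (fun phi => Ann (nu phi)) Bot (onth D j)
  | _, _ => Bot
  end.

(* The answer output by [IEmit] is stored in array 12: the value of the free
   variable x in 12[x], the annotation in 12[]. *)
Definition shows (c : config) (a : assignment Const * K) : Prop :=
  [/\ domf a.1 = free_vars g,
      forall x, x \in free_vars g -> c.2 12 [:: inl x] = oapp Cst Bot a.1.[? x]%fmap
    & c.2 12 [::] = Ann a.2].

Definition run (P : program) (D : seq (fact Const)) (nu : fact Const -> K)
    (t : nat) : config :=
  iter t (step P) (0, input_memory D nu).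

(* The program ends its pre-processing at time [t0 <= pre], outputs the answers
   at the times [ts] and halts at time [tend]; any two consecutive times are at
   distance at most [delay]. *)
Definition enumerates (P : program) (D : seq (fact Const)) (nu : fact Const -> K)
    (pre delay : nat) : Prop :=
  exists (t0 : nat) (ts : seq nat) (tend : nat) (out : seq (assignment Const * K)),
    [/\ t0 <= pre,
        path (fun t t' => t <= t' <= t + delay) t0 (rcons ts tend),
        sorted ltn ts /\ (forall t, emitting P (run P D nu t) = (t \in ts)),
        halted P (run P D nu tend)
      & [/\ List.Forall2 (fun t a => shows (run P D nu t) a) ts out,
            List.NoDup out
          & forall f n, List.In (f, n) out <-> answer D nu f n]].

End Machine.

(* One program works for the whole class, with one exponent [c]; the
   multiplicative constant [B] and the delay may depend on the query, but not on
   the annotated database. *)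
Definition constant_delay_after_poly_preprocessing (Const : eqType)
    (C : query Const -> Prop) : Prop :=
  exists (P : program) (c : nat), forall g, C g ->
    exists B delay : nat,
      forall (D : seq (fact Const)) (nu : fact Const -> carrier g),
        database_over (qschema g) D ->
        enumerates P D nu (B * (db_size D ^ c).+1) delay.

(* Main.v *)
From HB Require Import structures.
From Stdlib Require List.
From Stdlib Require Permutation.
Require Import Defs.
From mathcomp Require Import all_boot finmap zify.
Import Defs.
Set Implicit Arguments.
Unset Strict Implicit.
Unset Printing Implicit Defensive.

(** A project-connex tree decomposition of width at most [k] yields an order of
    elimination of the variables, the free variables last, such that eliminating a
    variable involves a table whose variables are covered by [k] atoms.  The table
    then has at most [|D| ^ k] rows, each given by a choice of [k] facts.  As the
    product distributes over the sums, the weight of a row is the product of the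
    annotations of the atoms and of the messages of the child tables, where a
    message is the sum of the weights of the matching rows of the child.  A row
    with a missing message is dropped.  For the tables of the free variables a
    message only says that a matching row exists, so that the partial choices of
    matching rows, made from the root downwards, have no dead ends: they are
    enumerated as by an odometer, from precomputed first and next matching rows, and
    the number of steps between two choices depends only on the number of variables.

    A single program has to serve all the queries of the class.  It tries all codes
    of pairs (order, tables) until one is valid for the given query.  This search
    does not read the database, so its time depends on the query only.  The program
    is compiled from a language of bounded loops, whose running times are bounded
    by the values of the loop bounds. *)

(** * A loop language and its compilation *)

(** The tree decomposition serves only to show that the search for a plan succeeds. The whole data
    phase is proved correct from [valid_plan], a finite list of local conditions that the program
    tests by itself. The program therefore needs the bound [k] but never sees a decomposition. The
    exponent is read off the nesting of the loops over facts and rows, which is the same for all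
    queries; the query only affects the bounds of the other loops, hence the constant.

    The obstacle on the algebraic side is that an assignment annotated by zero is still an answer,
    so that absence cannot be expressed inside the semiring. Annotations are completed by [None],
    stored as [Bot], and the program tests only whether an annotation is present.

    The semantics and the tables are not compared directly: both are compared with [partial_value],
    an exhaustive sum over all constants of the database. *)

Inductive expr :=
| ENum of nat
| ELoad of nat & seq expr
| EAdd of expr & expr
| ESub of expr & expr
| EUnit
| ETimes of expr & expr
| EPlus of expr & expr & expr.

Inductive bexp :=
| BEq of expr & expr
| BLt of expr & expr
| BNum of expr
| BNot of bexp
| BAnd of bexp & bexp.

(* [For i b c] runs [c] for the values [0, 1, ...] of the register [i] below the
   value that the register [b] has on entry. *)
Inductive cmd :=
| Skip
| Store of nat & seq expr & expr
| Seq of cmd & cmd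
| If of bexp & cmd & cmd
| For of nat & nat & cmd.

Section ExprInd.
Variable P : expr -> Prop.
Hypothesis HNum : forall n, P (ENum n).
Hypothesis HLoad : forall a es, (foldr (fun e p => P e /\ p) True es) -> P (ELoad a es).
Hypothesis HAdd : forall e1 e2, P e1 -> P e2 -> P (EAdd e1 e2).
Hypothesis HSub : forall e1 e2, P e1 -> P e2 -> P (ESub e1 e2).
Hypothesis HUnit : P EUnit.
Hypothesis HTimes : forall e1 e2, P e1 -> P e2 -> P (ETimes e1 e2).
Hypothesis HPlus : forall e0 e1 e2, P e0 -> P e1 -> P e2 -> P (EPlus e0 e1 e2).

(** The principle generated for [expr] has no induction hypotheses for the arguments of [ELoad],
    which sit inside a list. *)
Fixpoint expr_nested_ind (e : expr) : P e :=
  match e with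
  | ENum n => HNum n
  | ELoad a es => HLoad a ((fix go es : foldr (fun e p => P e /\ p) True es :=
      match es with
      | [::] => I
      | e :: es => conj (expr_nested_ind e) (go es)
      end) es)
  | EAdd e1 e2 => HAdd (expr_nested_ind e1) (expr_nested_ind e2)
  | ESub e1 e2 => HSub (expr_nested_ind e1) (expr_nested_ind e2)
  | EUnit => HUnit
  | ETimes e1 e2 => HTimes (expr_nested_ind e1) (expr_nested_ind e2)
  | EPlus e0 e1 e2 =>
      HPlus (expr_nested_ind e0) (expr_nested_ind e1) (expr_nested_ind e2)
  end.
End ExprInd.

(* The arrays from [tmp] on hold intermediate results of compiled code. *)
Definition tmp := 128.

Fixpoint expr_uses (e : expr) : seq nat :=
  match e with
  | ENum _ | EUnit => [::]
  | ELoad a es => a :: flatten (map expr_uses es)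
  | EAdd e1 e2 | ESub e1 e2 | ETimes e1 e2 => expr_uses e1 ++ expr_uses e2
  | EPlus e0 e1 e2 => expr_uses e0 ++ expr_uses e1 ++ expr_uses e2
  end.

Fixpoint bexp_uses (b : bexp) : seq nat :=
  match b with
  | BEq e1 e2 | BLt e1 e2 => expr_uses e1 ++ expr_uses e2
  | BNum e => expr_uses e
  | BNot b => bexp_uses b
  | BAnd b1 b2 => bexp_uses b1 ++ bexp_uses b2
  end.

Fixpoint writes (c : cmd) : seq nat :=
  match c with
  | Skip => [::]
  | Store a _ _ => [:: a]
  | Seq c1 c2 => writes c1 ++ writes c2
  | If _ c1 c2 => writes c1 ++ writes c2
  | For i _ c => i :: writes c
  end.

Fixpoint uses (c : cmd) : seq nat :=
  match c with
  | Skip => [::]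
  | Store a es e => a :: flatten (map expr_uses es) ++ expr_uses e
  | Seq c1 c2 => uses c1 ++ uses c2
  | If b c1 c2 => bexp_uses b ++ uses c1 ++ uses c2
  | For i b c => [:: i, b & uses c]
  end.

(** Compiled loops compare counter and bound anew in each round, while [den] fixes the number of
    rounds on entry. The two agree if the body writes neither register. *)
Fixpoint wf_cmd (c : cmd) : bool :=
  match c with
  | Skip | Store _ _ _ => true
  | Seq c1 c2 | If _ c1 c2 => wf_cmd c1 && wf_cmd c2
  | For i b c => [&& i != b, i \notin writes c, b \notin writes c & wf_cmd c]
  end.

(** The registers from [tmp] on serve as a stack of height [d]: the value is left at [tmp + d], and
    what lies below survives. The local [go] is [comp_exprs], inlined because the recursion is
    nested. *)
Fixpoint comp_expr (d : nat) (e : expr) : seq instr :=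
  match e with
  | ENum n => [:: IConst (tmp + d) n]
  | ELoad a es =>
      (fix go d' es := if es is e :: es then comp_expr d' e ++ go d'.+1 es else [::])
        d es ++ [:: ILoad (tmp + d) a (map (addn tmp) (iota d (size es)))]
  | EAdd e1 e2 => comp_expr d e1 ++ comp_expr d.+1 e2
      ++ [:: IAdd (tmp + d) (tmp + d) (tmp + d.+1)]
  | ESub e1 e2 => comp_expr d e1 ++ comp_expr d.+1 e2
      ++ [:: ISub (tmp + d) (tmp + d) (tmp + d.+1)]
  | EUnit => [:: IUnit (tmp + d)]
  | ETimes e1 e2 => comp_expr d e1 ++ comp_expr d.+1 e2
      ++ [:: ITimes (tmp + d) (tmp + d) (tmp + d.+1)]
  | EPlus e0 e1 e2 => comp_expr d e0 ++ comp_expr d.+1 e1 ++ comp_expr d.+2 e2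
      ++ [:: IPlus (tmp + d) (tmp + d) (tmp + d.+1) (tmp + d.+2)]
  end.

Fixpoint comp_exprs (d : nat) (es : seq expr) : seq instr :=
  if es is e :: es then comp_expr d e ++ comp_exprs d.+1 es else [::].

(* Leaves 1 or 0 in the register [tmp + d]; [pc] is the address of the code. *)
Fixpoint comp_bexp (pc d : nat) (b : bexp) : seq instr :=
  let verdict c t := c ++
    [:: IJumpIf t (pc + size c + 3); IConst (tmp + d) 0; IJump (pc + size c + 4);
        IConst (tmp + d) 1] in
  match b with
  | BEq e1 e2 =>
      verdict (comp_expr d e1 ++ comp_expr d.+1 e2) (TEq (tmp + d) (tmp + d.+1))
  | BLt e1 e2 =>
      verdict (comp_expr d e1 ++ comp_expr d.+1 e2) (TLt (tmp + d) (tmp + d.+1))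
  | BNum e => verdict (comp_expr d e) (TNum (tmp + d))
  | BNot b => comp_bexp pc d b ++
      [:: IConst (tmp + d.+1) 1; ISub (tmp + d) (tmp + d.+1) (tmp + d)]
  | BAnd b1 b2 =>
      let c1 := comp_bexp pc d b1 in
      c1 ++ comp_bexp (pc + size c1) d.+1 b2 ++
      [:: IAdd (tmp + d) (tmp + d) (tmp + d.+1); IConst (tmp + d.+1) 1;
          ISub (tmp + d) (tmp + d) (tmp + d.+1)]
  end.

Fixpoint compile (pc : nat) (c : cmd) : seq instr :=
  match c with
  | Skip => [::]
  | Store a es e => comp_exprs 0 es ++ comp_expr (size es) e
      ++ [:: IStore a (map (addn tmp) (iota 0 (size es))) (tmp + size es)]
  | Seq c1 c2 => let p1 := compile pc c1 in p1 ++ compile (pc + size p1) c2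
  | If b c1 c2 =>
      let p := comp_bexp pc 0 b in
      let l2 := pc + size p + 2 in
      let p2 := compile l2 c2 in
      let l1 := l2 + size p2 + 1 in
      let p1 := compile l1 c1 in
      p ++ [:: IConst tmp.+1 1; IJumpIf (TEq tmp tmp.+1) l1] ++ p2
        ++ [:: IJump (l1 + size p1)] ++ p1
  | For i b c =>
      let p := compile (pc + 3) c in
      [:: IConst i 0; IJumpIf (TLt i b) (pc + 3); IJump (pc + size p + 6)] ++ p
        ++ [:: IConst tmp 1; IAdd i i tmp; IJump (pc + 1)]
  end.

(** * Denotational semantics and exact running times *)

Section Semantics.
Variables (Const : eqType) (g : query Const).
Local Notation K := (carrier g).
Local Notation value := (value Const K).
Local Notation memory := (memory Const K).
Implicit Types (m : memory) (e : expr) (b : bexp) (c : cmd).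

Definition keys (vs : seq value) : option (seq (key Const)) :=
  foldr (fun v o => if key_of v is Some k then omap (cons k) o else None)
    (Some [::]) vs.

Definition load m a (vs : seq value) : value :=
  if keys vs is Some ks then m a ks else Bot.

Fixpoint eval m e : value :=
  match e with
  | ENum n => Num n
  | ELoad a es => load m a (map (eval m) es)
  | EAdd e1 e2 => arith addn (eval m e1) (eval m e2)
  | ESub e1 e2 => arith subn (eval m e1) (eval m e2)
  | EUnit => Ann (munit (times g))
  | ETimes e1 e2 => semi (times g) (eval m e1) (eval m e2)
  | EPlus e0 e1 e2 =>
      if plus_at (eval m e0) is Some p then semi p (eval m e1) (eval m e2) else Bot
  end.

Definition veq (u v : value) : bool :=
  match u, v with
  | Num a, Num b => a == b
  | Cst a, Cst b => a == b
  | Bot, Bot => true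
  | _, _ => false
  end.

Definition vlt (u v : value) : bool :=
  match u, v with Num a, Num b => a < b | _, _ => false end.

Definition is_num (u : value) : bool := if u is Num _ then true else false.

Fixpoint beval m b : bool :=
  match b with
  | BEq e1 e2 => veq (eval m e1) (eval m e2)
  | BLt e1 e2 => vlt (eval m e1) (eval m e2)
  | BNum e => is_num (eval m e)
  | BNot b => ~~ beval m b
  | BAnd b1 b2 => beval m b1 && beval m b2
  end.

Definition num (v : value) : nat := if v is Num n then n else 0.

Fixpoint den c m : memory :=
  match c with
  | Skip => m
  | Store a es e =>
      if keys (map (eval m) es) is Some ks then update m a ks (eval m e) else m
  | Seq c1 c2 => den c2 (den c1 m)
  | If b c1 c2 => if beval m b then den c1 m else den c2 m
  | For i b c =>
      iteri (num (get m b)) (fun t m' => set_reg (den c m') i (Num t.+1))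
        (set_reg m i (Num 0))
  end.

(** Costs are exact, so that runs can be composed and output times determined. Once the operands are
    evaluated, a true verdict takes two steps and a false one three, because of its extra jump. *)
Fixpoint bcost m b : nat :=
  match b with
  | BEq e1 e2 => size (comp_expr 0 e1 ++ comp_expr 0 e2) + 3 - beval m b
  | BLt e1 e2 => size (comp_expr 0 e1 ++ comp_expr 0 e2) + 3 - beval m b
  | BNum e => size (comp_expr 0 e) + 3 - beval m b
  | BNot b => bcost m b + 2
  | BAnd b1 b2 => bcost m b1 + bcost m b2 + 3
  end.

Fixpoint cost c m : nat :=
  match c with
  | Skip => 0
  | Store a es e => size (comp_exprs 0 es ++ comp_expr 0 e) + 1
  | Seq c1 c2 => cost c1 m + cost c2 (den c1 m)
  | If b c1 c2 => bcost m b + 2 + if beval m b then cost c1 m else (cost c2 m).+1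
  | For i b c =>
      3 + \sum_(0 <= t < num (get m b))
        (cost c (iteri t (fun t m' => set_reg (den c m') i (Num t.+1))
                   (set_reg m i (Num 0))) + 4)
  end.

Definition agree (A : pred nat) m m' : Prop := forall a, A a -> m a =1 m' a.

Lemma update_neq m a i v a' : a' != a -> update m a i v a' = m a'.
Proof. by move=> /negbTE h; rewrite /update h. Qed.

Lemma den_frame c m a : a \notin writes c -> den c m a = m a.
Proof.
elim: c m => [|a' es e|c1 IH1 c2 IH2|b c1 IH1 c2 IH2|i b c IH] m //=.
- by rewrite inE => h; case: (keys _) => // ks; rewrite update_neq.
- by rewrite mem_cat negb_or => /andP[h1 h2]; rewrite IH2 // IH1.
- by rewrite mem_cat negb_or => /andP[h1 h2]; case: ifP => _; rewrite ?IH2 ?IH1.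
- rewrite inE negb_or => /andP[h1 h2].
  elim: (num _) => [|n IHn] /=; first by rewrite /set_reg update_neq.
  by rewrite /set_reg update_neq // IH.
Qed.

Lemma eval_agree (A : pred nat) m m' e :
  agree A m m' -> all A (expr_uses e) -> eval m e = eval m' e.
Proof.
move=> h; elim/expr_nested_ind: e => //=.
- move=> a es IH /andP[ha hes].
  have -> : map (eval m) es = map (eval m') es.
    elim: es IH hes => //= e es IHes [IHe IH]; rewrite all_cat => /andP[h1 h2].
    by rewrite IHe // IHes.
  by rewrite /load; case: (keys _) => // ks; rewrite h.
- by move=> e1 e2 IH1 IH2; rewrite all_cat => /andP[h1 h2]; rewrite IH1 // IH2.
- by move=> e1 e2 IH1 IH2; rewrite all_cat => /andP[h1 h2]; rewrite IH1 // IH2.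
- by move=> e1 e2 IH1 IH2; rewrite all_cat => /andP[h1 h2]; rewrite IH1 // IH2.
- move=> e0 e1 e2 IH0 IH1 IH2; rewrite !all_cat => /and3P[h0 h1 h2].
  by rewrite IH0 // IH1 // IH2.
Qed.

Lemma beval_agree (A : pred nat) m m' b :
  agree A m m' -> all A (bexp_uses b) ->
  beval m b = beval m' b /\ bcost m b = bcost m' b.
Proof.
move=> h; elim: b => [e1 e2|e1 e2|e|b IH|b1 IH1 b2 IH2] /=.
- by rewrite all_cat => /andP[h1 h2]; rewrite !(eval_agree h).
- by rewrite all_cat => /andP[h1 h2]; rewrite !(eval_agree h).
- by move=> h1; rewrite !(eval_agree h).
- by move=> /IH[-> ->].
- by rewrite all_cat => /andP[/IH1[-> ->] /IH2[-> ->]].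
Qed.

Lemma agree_update (A : pred nat) m m' a i v :
  agree A m m' -> agree A (update m a i v) (update m' a i v).
Proof. by move=> h a' Aa' i'; rewrite /update h. Qed.

(** A command sees only the arrays that it uses, in its effect as well as in its time. This is what
    later makes the search time independent of the database. *)
Lemma den_agree (A : pred nat) c m m' :
  agree A m m' -> all A (uses c) ->
  agree A (den c m) (den c m') /\ cost c m = cost c m'.
Proof.
elim: c m m' => [|a es e|c1 IH1 c2 IH2|b c1 IH1 c2 IH2|i b c IH] m m' h //=.
- rewrite all_cat => /and3P[ha hes he]; split=> //.
  have -> : map (eval m) es = map (eval m') es.
    elim: es hes => //= e' es IHes; rewrite all_cat => /andP[h1 h2].
    by rewrite IHes // (eval_agree h).
  case: (keys _) => // ks; rewrite (eval_agree h) //; exact: agree_update.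
- rewrite all_cat => /andP[h1 h2]; have [ha ->] := IH1 _ _ h h1.
  by have [hb ->] := IH2 _ _ ha h2.
- rewrite !all_cat => /and3P[hb h1 h2]; have [-> ->] := beval_agree h hb.
  have [? ->] := IH1 _ _ h h1; have [? ->] := IH2 _ _ h h2.
  by case: ifP.
- move=> /and3P[hi hb hc]; have -> : get m b = get m' b by rewrite /get h.
  set f := fun _ _ => _.
  have key n : agree A (iteri n f (set_reg m i (Num 0)))
                 (iteri n f (set_reg m' i (Num 0))).
    elim: n => [|n IHn] /=; first exact: agree_update.
    by apply: agree_update; case: (IH _ _ IHn hc).
  split=> //; congr (_ + _); apply: eq_bigr => t _.
  by have [_ ->] := IH _ _ (key t) hc.
Qed.

End Semantics.

(** * Correctness of the compiler *)

Section Reachability.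
Variables (Const : eqType) (g : query Const) (P : program).
Local Notation K := (carrier g).
Local Notation value := (value Const K).
Local Notation memory := (memory Const K).
Local Notation config := (config g).
Implicit Types (m M : memory) (e : expr) (b : bexp) (c : cmd) (p : seq instr).

(** Silence before the end point is part of the relation, since all the instants of output of a run
    have to be determined. *)
Definition reaches (s : config) (t : nat) (s' : config) : Prop :=
  iter t (step P) s = s' /\ forall u, u < t -> ~~ emitting P (iter u (step P) s).

Lemma reaches0 s : reaches s 0 s.
Proof. by []. Qed.

Lemma reaches_trans t t' s s' s'' :
  reaches s t s' -> reaches s' t' s'' -> reaches s (t + t') s''.
Proof.
move=> [h1 h2] [h3 h4]; split; first by rewrite addnC iterD h1.
move=> u ut; case: (ltnP u t) => hu; first exact: h2.
rewrite -(subnK hu) iterD h1; apply: h4; lia.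
Qed.

Definition code_at pc p : Prop :=
  forall i, i < size p -> nth IHalt P (pc + i) = nth IHalt p i.

Lemma code_at_cat pc p1 p2 :
  code_at pc (p1 ++ p2) <-> code_at pc p1 /\ code_at (pc + size p1) p2.
Proof.
split=> [h|[h1 h2] i].
  split=> i hi; first by rewrite h ?nth_cat ?hi // size_cat; lia.
  rewrite -addnA h ?size_cat ?ltn_add2l // nth_cat ltnNge leq_addr /=.
  by rewrite addKn.
rewrite size_cat nth_cat => hi'; case: ltnP => hi; first exact: h1.
by rewrite -{1}(subnKC hi) addnA h2 //; lia.
Qed.

Lemma code_at_cons pc i p :
  code_at pc (i :: p) <-> nth IHalt P pc = i /\ code_at pc.+1 p.
Proof.
rewrite -cat1s code_at_cat addn1; split=> -[h1 h2]; split=> //.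
  by rewrite -[pc]addn0 h1.
by case=> // _; rewrite addn0.
Qed.

Lemma reaches1 pc M i s :
  nth IHalt P pc = i -> (if i is IEmit then false else true) ->
  step P (pc, M) = s -> reaches (pc, M) 1 s.
Proof.
move=> hi he hs; split=> //= -[] // _.
by rewrite /emitting /current /= hi; case: i {hi} he.
Qed.

End Reachability.

Ltac step_by H := apply: (reaches1 H); [exact: isT | rewrite /= /current /= H].

Section Simulation.
Variables (Const : eqType) (g : query Const) (P : program).
Local Notation K := (carrier g).
Local Notation value := (value Const K).
Local Notation memory := (memory Const K).
Local Notation config := (config g).
Implicit Types (m M : memory) (e : expr) (b : bexp) (c : cmd) (p : seq instr).
Local Notation reaches := (@reaches Const g P).
Local Notation code_at := (code_at P).

Lemma comp_expr_load d a es :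
  comp_expr d (ELoad a es) =
  comp_exprs d es ++ [:: ILoad (tmp + d) a (map (addn tmp) (iota d (size es)))].
Proof. by []. Qed.

Lemma size_comp_expr d e : size (comp_expr d e) = size (comp_expr 0 e).
Proof.
have gen d' : size (comp_expr d e) = size (comp_expr d' e); last exact: gen.
elim/expr_nested_ind: e d d' => // [a es IH|e1 e2 IH1 IH2|e1 e2 IH1 IH2|e1 e2 IH1 IH2|e0 e1 e2 IH0 IH1 IH2] d d';
  try by rewrite /= !size_cat /= (IH1 d d') (IH2 d.+1 d'.+1).
- rewrite !comp_expr_load !size_cat /=; congr (_ + _).
  elim: es IH d d' => //= e es IHes [h1 h2] d d'.
  by rewrite !size_cat (h1 d d') (IHes h2 d.+1 d'.+1).
- by rewrite /= !size_cat /= (IH0 d d') (IH1 d.+1 d'.+1) (IH2 d.+2 d'.+2).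
Qed.

Lemma size_comp_exprs d es : size (comp_exprs d es) = size (comp_exprs 0 es).
Proof.
have gen d' : size (comp_exprs d es) = size (comp_exprs d' es); last exact: gen.
elim: es d d' => //= e es IH d d'.
by rewrite !size_cat (IH d.+1 d'.+1) (size_comp_expr d) (size_comp_expr d').
Qed.

Definition below (n : nat) : pred nat := fun a => a < n.

Lemma agree_trans (A : pred nat) m1 m2 m3 :
  agree A m1 m2 -> agree A m2 m3 -> agree A m1 m3.
Proof. by move=> h h' a Aa i; rewrite h // h'. Qed.

Lemma agree_below n n' m M : n <= n' -> agree (below n') m M -> agree (below n) m M.
Proof. by move=> le_n h a an; apply: h; apply: leq_trans le_n. Qed.

Lemma agree_set n r v M : n <= r -> agree (below n) M (set_reg M r v).
Proof. by move=> nr a an i; rewrite /set_reg update_neq // neq_ltn (leq_trans an). Qed.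
Arguments agree_set {n r v M} _.

Lemma get_set M r v : get (set_reg M r v) r = v.
Proof. by rewrite /get /set_reg /update !eqxx. Qed.

Lemma get_set_neq M r r' v : r' != r -> get (set_reg M r v) r' = get M r'.
Proof. by move=> h; rewrite /get /set_reg update_neq. Qed.

Lemma get_agree n m M r : agree (below n) m M -> r < n -> get M r = get m r.
Proof. by move=> h rn; rewrite /get (h r rn). Qed.

Lemma index_of_keys M rs : index_of M rs = keys (map (get M) rs).
Proof. by elim: rs => //= r rs ->. Qed.

(** Source memory [m] and machine memory [M] are compared below [tmp] only, as compiled code leaves
    intermediate results above. The last clause protects the operands that are already on the
    stack. *)
Definition comp_expr_spec e := forall pc d m M,
  agree (below tmp) m M -> code_at pc (comp_expr d e) ->
  all (below tmp) (expr_uses e) ->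
  exists2 M', reaches (pc, M) (size (comp_expr 0 e)) (pc + size (comp_expr d e), M')
    & get M' (tmp + d) = eval m e /\ agree (below (tmp + d)) M M'.

Lemma comp_exprsP es : foldr (fun e q => comp_expr_spec e /\ q) True es ->
  forall pc d m M, agree (below tmp) m M -> code_at pc (comp_exprs d es) ->
  all (below tmp) (flatten (map expr_uses es)) ->
  exists2 M', reaches (pc, M) (size (comp_exprs 0 es)) (pc + size (comp_exprs d es), M')
    & map (get M') (map (addn tmp) (iota d (size es))) = map (eval m) es
      /\ agree (below (tmp + d)) M M'.
Proof.
elim: es => [|e es IH] /=.
  by move=> _ pc d m M h _ _; exists M; rewrite ?addn0 //; apply: reaches0.
move=> [he /IH{}IH] pc d m M h /code_at_cat[c1 c2]; rewrite all_cat => /andP[u1 u2].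
have [M1 r1 [v1 a1]] := he _ _ _ _ h c1 u1.
have h1 : agree (below tmp) m M1.
  by apply: agree_trans h _; apply: agree_below a1; apply: leq_addr.
have [M2 r2 [v2 a2]] := IH _ _ _ _ h1 c2 u2.
exists M2.
  rewrite !size_cat [size (comp_exprs 1 _)]size_comp_exprs addnA.
  exact: reaches_trans r1 r2.
rewrite v2; split.
  by rewrite -v1; congr cons; apply: get_agree a2 _; lia.
apply: agree_trans a1 _; apply: agree_below a2; lia.
Qed.

Lemma comp_exprP e : comp_expr_spec e.
Proof.
(* One argument for the three binary operations: [o] is the instruction and [f] its effect on
   values. *)
have bin (o : nat -> nat -> nat -> instr) e1 e2 f :
    (forall pc M r r1 r2, nth IHalt P pc = o r r1 r2 ->
       step P (pc, M) = (pc.+1, set_reg M r (f (get M r1) (get M r2)))) ->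
    (forall r r1 r2, if o r r1 r2 is IEmit then false else true) ->
    comp_expr_spec e1 -> comp_expr_spec e2 ->
    forall pc d m M, agree (below tmp) m M ->
    code_at pc (comp_expr d e1 ++ comp_expr d.+1 e2 ++ [:: o (tmp + d) (tmp + d) (tmp + d.+1)]) ->
    all (below tmp) (expr_uses e1 ++ expr_uses e2) ->
    exists2 M', reaches (pc, M) (size (comp_expr 0 e1) + size (comp_expr 1 e2) + 1)
        (pc + (size (comp_expr d e1) + size (comp_expr d.+1 e2) + 1), M')
      & get M' (tmp + d) = f (eval m e1) (eval m e2) /\ agree (below (tmp + d)) M M'.
  move=> ho hemit IH1 IH2 pc d m M h /code_at_cat[c1 /code_at_cat[c2 /code_at_cons[c3 _]]].
  rewrite all_cat => /andP[u1 u2].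
  have [M1 r1 [v1 a1]] := IH1 _ _ _ _ h c1 u1.
  have h1 : agree (below tmp) m M1.
    by apply: agree_trans h _; apply: agree_below a1; apply: leq_addr.
  have [M2 r2 [v2 a2]] := IH2 _ _ _ _ h1 c2 u2.
  have := ho _ M2 _ _ _ c3; set M3 := set_reg _ _ _ => hs.
  exists M3.
    rewrite [size (comp_expr 1 _)]size_comp_expr !addnA addn1.
    rewrite -[_.+1 in X in reaches _ X _]addn1.
    apply: reaches_trans (reaches_trans r1 r2) _.
    apply: (reaches1 c3) => //; rewrite hs; congr pair; lia.
  rewrite get_set v2 (get_agree a2) ?v1; last by lia.
  split=> //; apply: agree_trans a1 _.
  have a3 : agree (below (tmp + d)) M2 M3 by exact: agree_set.
  apply: agree_trans a3. 
  apply: agree_below a2; lia.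
elim/expr_nested_ind: e => [n|a es IH|e1 e2 IH1 IH2|e1 e2 IH1 IH2||e1 e2 IH1 IH2|e0 e1 e2 IH0 IH1 IH2].
- move=> pc d m M h /code_at_cons[c _] _.
  exists (set_reg M (tmp + d) (Num n)).
    by rewrite addn1; apply: (reaches1 c); rewrite //= /current /= c.
  by rewrite get_set; split=> //; apply: agree_set.
- move=> pc d m M h; rewrite !comp_expr_load => /code_at_cat[c1 /code_at_cons[c2 _]].
  move=> /andP[ua ues].
  have [M1 r1 [v1 a1]] := comp_exprsP IH h c1 ues.
  exists (set_reg M1 (tmp + d) (load m a (map (eval m) es))).
    rewrite !size_cat addnA.
    apply: reaches_trans r1 _; rewrite addn1; apply: (reaches1 c2) => //=.
    rewrite /current /= c2 index_of_keys v1 /load; case: (keys _) => // ks.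
    rewrite -a1 -?h //; first by rewrite /below; exact: leq_trans ua (leq_addr _ _).
  rewrite get_set; split=> //; apply: agree_trans a1 _; exact: agree_set.
- move=> pc d m M h c u; rewrite /= !size_cat !addnA.
  have := bin IAdd e1 e2 (arith addn) _ _ IH1 IH2 pc d m M h c u.
  rewrite !addnA; apply=> // pc' M' r r1 r2; by rewrite /= /current /= => ->.
- move=> pc d m M h c u; rewrite /= !size_cat !addnA.
  have := bin ISub e1 e2 (arith subn) _ _ IH1 IH2 pc d m M h c u.
  rewrite !addnA; apply=> // pc' M' r r1 r2; by rewrite /= /current /= => ->.
- move=> pc d m M h /code_at_cons[c _] _.
  exists (set_reg M (tmp + d) (Ann (munit (times g)))).
    by rewrite addn1; apply: (reaches1 c); rewrite //= /current /= c.
  by rewrite get_set; split=> //; apply: agree_set.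
- move=> pc d m M h c u; rewrite /= !size_cat !addnA.
  have := bin ITimes e1 e2 (semi (times g)) _ _ IH1 IH2 pc d m M h c u.
  rewrite !addnA; apply=> // pc' M' r r1 r2; by rewrite /= /current /= => ->.
- move=> pc d m M h /= /code_at_cat[c0 /code_at_cat[c1 /code_at_cat[c2 /code_at_cons[c3 _]]]].
  rewrite !all_cat => /and3P[u0 u1 u2].
  have [M0 r0 [v0 a0]] := IH0 _ _ _ _ h c0 u0.
  have h0 : agree (below tmp) m M0.
    by apply: agree_trans h _; apply: agree_below a0; apply: leq_addr.
  have [M1 r1 [v1 a1]] := IH1 _ _ _ _ h0 c1 u1.
  have h1 : agree (below tmp) m M1.
    by apply: agree_trans h0 _; apply: agree_below a1; apply: leq_addr.
  have [M2 r2 [v2 a2]] := IH2 _ _ _ _ h1 c2 u2.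
  exists (set_reg M2 (tmp + d) (if plus_at (eval m e0) is Some p
            then semi p (eval m e1) (eval m e2) else Bot)).
    rewrite !size_cat [size (comp_expr 1 _)]size_comp_expr.
    rewrite [size (comp_expr 2 _)]size_comp_expr !addnA addn1.
    rewrite -[_.+1 in X in reaches _ X _]addn1.
    apply: reaches_trans (reaches_trans (reaches_trans r0 r1) r2) _.
    apply: (reaches1 c3) => //=; rewrite /current /= c3 v2.
    rewrite (get_agree a2) ?v1; last by lia.
    rewrite (get_agree a2); last by lia.
    rewrite (get_agree a1) ?v0; last by lia.
    by rewrite v1 addn1.
  rewrite get_set; split=> //.
  apply: agree_trans a0 _; set v := (v in set_reg _ _ v).
  have a3 : agree (below (tmp + d)) M2 (set_reg M2 (tmp + d) v) by exact: agree_set.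
  apply: agree_trans a3; apply: agree_trans (agree_below _ a1) (agree_below _ a2); lia.
Qed.

Lemma allP_comp_expr es : foldr (fun e q => comp_expr_spec e /\ q) True es.
Proof. by elim: es => //= e es IH; split=> //; apply: comp_exprP. Qed.

Lemma verdictP pc d p t M M1 n (v : bool) :
  code_at pc (p ++ [:: IJumpIf t (pc + size p + 3); IConst (tmp + d) 0;
                       IJump (pc + size p + 4); IConst (tmp + d) 1]) ->
  reaches (pc, M) n (pc + size p, M1) -> holds M1 t = v ->
  agree (below (tmp + d)) M M1 ->
  exists2 M', reaches (pc, M) (n + 3 - v) (pc + (size p + 4), M')
    & get M' (tmp + d) = Num v /\ agree (below (tmp + d)) M M'.
Proof.
move=> /code_at_cat[_ /code_at_cons[c1 /code_at_cons[c2 /code_at_cons[c3 /code_at_cons[c4 _]]]]].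
move=> r hv a.
have a' w : agree (below (tmp + d)) M (set_reg M1 (tmp + d) w).
  by apply: agree_trans a (agree_set _).
exists (set_reg M1 (tmp + d) (Num v)); last by rewrite get_set; split.
case: v hv => hv.
  have -> : n + 3 - true = n + 1 + 1 by lia.
  apply: (reaches_trans (reaches_trans r _)).
    by step_by c1; rewrite hv.
  rewrite -[(pc + size p).+3]addn3 in c4.
  step_by c4; congr pair; lia.
have -> : n + 3 - false = n + 1 + 1 + 1 by lia.
apply: (reaches_trans (reaches_trans (reaches_trans r _) _)).
- by step_by c1; rewrite hv.
- by step_by c2.
- step_by c3; congr pair; lia.
Qed.

Lemma comp_bexpP b pc d m M :
  agree (below tmp) m M -> code_at pc (comp_bexp pc d b) ->
  all (below tmp) (bexp_uses b) ->
  exists2 M', reaches (pc, M) (bcost m b) (pc + size (comp_bexp pc d b), M')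
    & get M' (tmp + d) = Num (beval m b) /\ agree (below (tmp + d)) M M'.
Proof.
have two e1 e2 t : (forall M1 r1 r2, holds M1 (t r1 r2) =
      (if t 0 0 is TEq _ _ then @veq Const g else @vlt Const g) (get M1 r1) (get M1 r2)) ->
    forall pc d m M, agree (below tmp) m M ->
    code_at pc ((comp_expr d e1 ++ comp_expr d.+1 e2) ++
      [:: IJumpIf (t (tmp + d) (tmp + d.+1)) (pc + size (comp_expr d e1 ++ comp_expr d.+1 e2) + 3);
        IConst (tmp + d) 0; IJump (pc + size (comp_expr d e1 ++ comp_expr d.+1 e2) + 4);
        IConst (tmp + d) 1]) ->
    all (below tmp) (expr_uses e1 ++ expr_uses e2) ->
    let v := (if t 0 0 is TEq _ _ then @veq Const g else @vlt Const g) (eval m e1) (eval m e2) in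
    exists2 M', reaches (pc, M) (size (comp_expr 0 e1 ++ comp_expr 0 e2) + 3 - v)
       (pc + (size (comp_expr d e1 ++ comp_expr d.+1 e2) + 4), M')
      & get M' (tmp + d) = Num v /\ agree (below (tmp + d)) M M'.
  move=> ht {pc d m M} pc d m M h c; rewrite all_cat => /andP[u1 u2] v.
  have /code_at_cat[/code_at_cat[c1 c2] _] := c.
  have [M1 r1 [v1 a1]] := comp_exprP h c1 u1.
  have h1 : agree (below tmp) m M1.
    by apply: agree_trans h _; apply: agree_below a1; apply: leq_addr.
  have [M2 r2 [v2 a2]] := comp_exprP h1 c2 u2.
  have r := reaches_trans r1 r2; rewrite -addnA -!size_cat in r.
  apply: (verdictP c r).
    by rewrite ht v2 (get_agree a2) ?v1 //; lia.
  by apply: agree_trans a1 _; apply: agree_below a2; lia.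
elim: b pc d m M => [e1 e2|e1 e2|e|b IH|b1 IH1 b2 IH2] pc d m M h.
- by move=> c u /=; rewrite [size ((_ ++ _) ++ _)]size_cat; exact: (two e1 e2 TEq).
- by move=> c u /=; rewrite [size ((_ ++ _) ++ _)]size_cat; exact: (two e1 e2 TLt).
- move=> c u; have /code_at_cat[c1 _] := c.
  have [M1 r1 [v1 a1]] := comp_exprP h c1 u.
  rewrite /= [size (_ ++ _)]size_cat; apply: (verdictP c r1) => //=.
  by rewrite v1.
- move=> /= /code_at_cat[c1 /code_at_cons[c2 /code_at_cons[c3 _]]] u.
  have [M1 r1 [v1 a1]] := IH _ _ _ _ h c1 u.
  exists (set_reg (set_reg M1 (tmp + d.+1) (Num 1)) (tmp + d) (Num (~~ beval m b))).
    rewrite size_cat (_ : _ + 2 = bcost m b + 1 + 1); last by lia.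
    apply: (reaches_trans (reaches_trans r1 _)).
      by step_by c2.
    step_by c3; rewrite get_set.
    rewrite get_set_neq ?v1 /=; last by rewrite eqn_add2l; lia.
     congr (_, set_reg _ _ (Num _)); first by lia.
    by case: (beval m b).
  rewrite get_set; split=> //; apply: agree_trans a1 _.
  apply: (agree_trans (@agree_set _ (tmp + d.+1) (Num 1) M1 _)); first by lia.
  exact: agree_set.
- move=> /= /code_at_cat[c1 /code_at_cat[c2 /code_at_cons[c3 /code_at_cons[c4 /code_at_cons[c5 _]]]]].
  rewrite all_cat => /andP[u1 u2].
  have [M1 r1 [v1 a1]] := IH1 _ _ _ _ h c1 u1.
  have h1 : agree (below tmp) m M1.
    by apply: agree_trans h _; apply: agree_below a1; apply: leq_addr.
  have [M2 r2 [v2 a2]] := IH2 _ _ _ _ h1 c2 u2.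
  pose s := Num (beval m b1 + beval m b2) : value.
  pose M3 := set_reg M2 (tmp + d) s; pose M4 := set_reg M3 (tmp + d.+1) (Num 1).
  have a3 : agree (below (tmp + d)) M M3.
    apply: agree_trans (agree_trans a1 (agree_below _ a2)) (agree_set _) => //; lia.
  have a4 : agree (below (tmp + d)) M M4.
    apply: agree_trans a3 (agree_set _); lia.
  exists (set_reg M4 (tmp + d) (Num (beval m b1 && beval m b2))); last first.
    by rewrite get_set; split=> //; apply: agree_trans a4 (agree_set _).
  rewrite !size_cat (_ : _ + 3 = bcost m b1 + bcost m b2 + 1 + 1 + 1); last by lia.
  apply: (reaches_trans (reaches_trans (reaches_trans (reaches_trans r1 r2) _) _)).
  + step_by c3; rewrite v2 (get_agree a2) ?v1; last by lia.
    by rewrite /= -/s -/M3.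
  + by step_by c4; rewrite -/M4.
  + step_by c5; rewrite get_set.
    rewrite get_set_neq ?get_set /=; last by rewrite eqn_add2l; lia.
     congr (_, set_reg _ _ (Num _)); first by lia.
    by case: (beval m b1); case: (beval m b2).
Qed.

Lemma compileP c pc m M :
  wf_cmd c -> all (below tmp) (uses c) ->
  agree (below tmp) m M -> code_at pc (compile pc c) ->
  exists2 M', reaches (pc, M) (cost c m) (pc + size (compile pc c), M')
    & agree (below tmp) (den c m) M'.
Proof.
elim: c pc m M => [|a es e|c1 IH1 c2 IH2|b c1 IH1 c2 IH2|i b c IH] pc m M wf.
- by move=> _ h _; exists M => //=; rewrite addn0; apply: reaches0.
- move=> /= /andP[ua]; rewrite all_cat => /andP[u1 u2] h.
  move=> /code_at_cat[c1 /code_at_cat[c2 /code_at_cons[c3 _]]].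
  have [M1 r1 [v1 a1]] := comp_exprsP (allP_comp_expr es) h c1 u1.
  have h1 : agree (below tmp) m M1 by apply: agree_trans h _; rewrite addn0 in a1.
  have [M2 r2 [v2 a2]] := comp_exprP h1 c2 u2.
  have h2 : agree (below tmp) m M2.
    by apply: agree_trans h1 _; apply: agree_below a2; lia.
  have v1' : map (get M2) (map (addn tmp) (iota 0 (size es))) = map (eval m) es.
    rewrite -v1 -!map_comp; apply/eq_in_map => x; rewrite mem_iota => hx /=.
    by apply: get_agree a2 _; lia.
  exists (if keys (map (eval m) es) is Some ks then update M2 a ks (eval m e) else M2).
    rewrite !size_cat (size_comp_expr (size es)) !addnA; apply: reaches_trans (reaches_trans r1 _) _.
      exact: r2.
    step_by c3; rewrite index_of_keys v1' v2 addn1.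
    by rewrite (size_comp_expr (size es)).
  by case: (keys _) => // ks; apply: agree_update.
- move=> /=; rewrite all_cat => /andP[u1 u2] h /code_at_cat[k1 k2].
  have /andP[w1 w2] := wf.
  have [M1 r1 h1] := IH1 _ _ _ w1 u1 h k1.
  have [M2 r2 h2] := IH2 _ _ _ w2 u2 h1 k2.
  by exists M2 => //; rewrite size_cat addnA; apply: reaches_trans r1 r2.
- move=> /=; rewrite !all_cat => /and3P[u0 u1 u2] h.
  have /andP[w1 w2] := wf.
  set p := comp_bexp pc 0 b; set l2 := pc + size p + 2.
  set p2 := compile l2 c2; set l1 := l2 + size p2 + 1; set p1 := compile l1 c1.
  move=> /code_at_cat[k0 /code_at_cons[k1 /code_at_cons[k2 /code_at_cat[k3 /code_at_cons[k4 k5]]]]].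
  rewrite -/p in k0 k1 k2 k3 k4 k5.
  have e2 : (pc + size p).+2 = l2 by rewrite /l2; lia.
  have e1 : (l2 + size p2).+1 = l1 by rewrite /l1; lia.
  rewrite e2 in k3 k4 k5; rewrite -/p2 e1 in k5; rewrite -/p2 in k4.
  have [M1 r1 [v1 a1]] := comp_bexpP h k0 u0; rewrite -/p in r1; rewrite addn0 in v1 a1.
  pose M2 := set_reg M1 tmp.+1 (Num 1).
  have h2 : agree (below tmp) m M2.
    by apply: agree_trans h (agree_trans a1 (agree_set _)).
  have r2 : reaches (pc, M) (bcost m b + 1) ((pc + size p).+1, M2).
    by apply: reaches_trans r1 _; step_by k1.
  have hM2 : holds M2 (TEq tmp tmp.+1) = beval m b.
    by rewrite /holds get_set get_set_neq ?v1; [case: (beval m b) | lia].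
  have r3 : reaches (pc, M) (bcost m b + 2) (if beval m b then l1 else l2, M2).
    rewrite (_ : _ + 2 = bcost m b + 1 + 1); last by lia.
    apply: reaches_trans r2 _; apply: (reaches1 k2) => //.
    by rewrite /step /current /= k2 hM2 -e2.
  case: ifP r3 => hb r3.
    have [M3 r4 h4] := IH1 _ _ _ w1 u1 h2 k5.
    exists M3 => //; rewrite (_ : pc + _ = l1 + size p1).
      exact: reaches_trans r3 r4.
    rewrite !size_cat /= !size_cat /= /l1 /l2; lia.
  have [M3 r4 h4] := IH2 _ _ _ w2 u2 h2 k3.
  exists M3 => //; rewrite addnS -addn1; apply: reaches_trans (reaches_trans r3 r4) _.
  step_by k4; congr pair.
  rewrite !size_cat /= !size_cat /= /l1 /l2; lia.
- move=> /= /and3P[ui ub uc] h.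
  have /and4P[ib iw bw wc] := wf.
  set p := compile (pc + 3) c.
  move=> /code_at_cons[k0 /code_at_cons[k1 /code_at_cons[k2 /code_at_cat[k3]]]].
  move=> /code_at_cons[k4 /code_at_cons[k5 /code_at_cons[k6 _]]].
  set f := (fun (t : nat) m' => set_reg (den c m') i (Num t.+1)).
  set m0 := set_reg m i _; set n := num _.
  have e3 : pc.+3 = pc + 3 by lia.
  rewrite e3 in k3 k4 k5 k6.
  have geti t : get (iteri t f m0) i = Num t.
    by case: t => [|t] /=; rewrite /f ?get_set //; exact: get_set.
  have getb t : get (iteri t f m0) b = get m b.
    elim: t => [|t IHt] /=; first by rewrite /get /m0 /set_reg update_neq // eq_sym.
    rewrite /f /get /set_reg update_neq 1?eq_sym //.
    by rewrite den_frame.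
  (* The situation at the loop test after [t] rounds. Besides the body, a round takes four steps:
     test, loading 1, increment, jump back. *)
  have loop t : t <= n -> exists2 M', reaches (pc, M)
      (1 + \sum_(0 <= u < t) (cost c (iteri u f m0) + 4)) (pc + 1, M')
      & agree (below tmp) (iteri t f m0) M'.
    elim: t => [_|t IHt tn].
      exists (set_reg M i (Num 0)).
        rewrite big_geq // addn0; apply: (reaches1 k0) => //=.
        by rewrite /current /= k0 addn1.
      exact: agree_update.
    have [M1 r1 h1] := IHt (ltnW tn).
    have r2 : reaches (pc + 1, M1) 1 (pc + 3, M1).
      rewrite -[pc.+1]addn1 in k1; apply: (reaches1 k1) => //.
      rewrite /step /current k1 /= (get_agree h1) ?geti //.
      rewrite (get_agree h1) ?getb //.
      move: tn; rewrite /n /get; case: (m b [::]) => //= n' ->; by rewrite addn3.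
    have [M2 r3 h2] := IH _ _ _ wc uc h1 k3.
    have hi2 : get M2 i = Num t.
      by rewrite (get_agree h2) // /get den_frame //; exact: geti.
    exists (set_reg (set_reg M2 tmp (Num 1)) i (Num t.+1)); last first.
      by apply: agree_update; apply: agree_trans h2 (agree_set _).
    rewrite big_nat_recr //= addnA.
    rewrite (_ : _ + (_ + 4) = 1 + \sum_(0 <= u < t) (cost c (iteri u f m0) + 4)
       + 1 + cost c (iteri t f m0) + 1 + 1 + 1); last by lia.
    apply: (reaches_trans (reaches_trans (reaches_trans (reaches_trans (reaches_trans r1 r2) r3) _) _)).
    + by step_by k4.
    + step_by k5; rewrite get_set.
      by rewrite get_set_neq ?hi2 /= ?addn1 //; move: ui; rewrite /below; lia.
    + by step_by k6.
  have [M1 r1 h1] := loop n (leqnn n).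
  exists M1 => //.
  rewrite (_ : 3 + _ = 1 + \sum_(0 <= u < n) (cost c (iteri u f m0) + 4) + 1 + 1); last by lia.
  apply: (reaches_trans (reaches_trans r1 (_ : reaches _ 1 (pc.+2, M1)))).
    rewrite -[pc.+1]addn1 in k1; apply: (reaches1 k1) => //.
    rewrite /step /current k1 /= (get_agree h1) ?geti //.
    rewrite (get_agree h1) ?getb //.
    have -> : match get m b with Num b0 => n < b0 | _ => false end = false.
      by rewrite /n; case: (get m b) => //= n'; rewrite ltnn.
    by rewrite addn1.
  step_by k2; congr pair.
  by rewrite size_cat /=; lia.
Qed.
End Simulation.

(** * The enumeration program assembled from four commands *)

Section Assembly.
Variables (pre body data adv : cmd) (found done : reg).

(* [pre], then [body] until [found] holds a number, then [data], then an output
   followed by [adv] until [done] holds a number. *)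
Definition assemble : program :=
  let p0 := compile 0 pre in
  let l1 := size p0 in
  let p1 := compile l1 body in
  let l2 := l1 + size p1 + 2 in
  let p2 := compile l2 data in
  let l3 := l2 + size p2 in
  let p3 := compile (l3 + 2) adv in
  p0 ++ p1 ++ [:: IJumpIf (TNum found) l2; IJump l1] ++ p2
    ++ [:: IJumpIf (TNum done) (l3 + 2 + size p3 + 1); IEmit] ++ p3
    ++ [:: IJump l3; IHalt].

Variables (Const : eqType) (g : query Const).
Variables (D : seq (fact Const)) (nu : fact Const -> carrier g).
Local Notation memory := (memory Const (carrier g)).

Lemma reaches_jump P pc (M : memory) r l :
  nth IHalt P pc = IJumpIf (TNum r) l ->
  reaches P (pc, M) 1 (if is_num (get M r) then l else pc.+1, M).
Proof. move=> h; apply: (reaches1 h) => //; rewrite /step /current h /holds; by case: (get M r). Qed.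

Let m0 := @input_memory Const g D nu.
Let ms n := iter n (den body) (den pre m0).
Variable n0 : nat.
Let es i := iter i (den adv) (den data (ms n0.+1)).

(** Reduces the run of the machine to denotations and costs of the four commands. A round of the
    search adds at most two jumps. From one output to the next, the output instruction itself, the
    jump back and the exit test are added to [adv], whence [delay + 3]. *)
Lemma assemble_enumerates (out : seq (assignment Const * carrier g)) (delay : nat) :
  all wf_cmd [:: pre; body; data; adv] ->
  all (below tmp) (uses pre ++ uses body ++ uses data ++ uses adv) ->
  found < tmp -> done < tmp ->
  (forall n, n < n0 -> ~~ is_num (get (ms n.+1) found)) ->
  is_num (get (ms n0.+1) found) ->
  (forall i, i < size out -> ~~ is_num (get (es i) done)) ->
  is_num (get (es (size out)) done) ->
  (forall i a, onth out i = Some a -> shows (0, es i) a) ->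
  (forall i, i < size out -> cost adv (es i) <= delay) ->
  List.NoDup out ->
  (forall f n, List.In (f, n) out <-> answer D nu f n) ->
  enumerates assemble D nu
    (cost pre m0 + \sum_(0 <= n < n0.+1) (cost body (ms n) + 2) + cost data (ms n0.+1))
    (delay + 3).
Proof.
move=> /= /and5P[w0 w1 w2 w3 _]; rewrite !all_cat => /and4P[u0 u1 u2 u3] hf hd.
move=> hn hn0 hi hN hshow hcost hnd hans.
set P := assemble.
set p0 := compile 0 pre; set l1 := size p0; set p1 := compile l1 body.
set l2 := l1 + size p1 + 2; set p2 := compile l2 data; set l3 := l2 + size p2.
set p3 := compile (l3 + 2) adv.
have : code_at P 0 P by move=> i _; rewrite add0n.
rewrite {2}/P /assemble -/p0 -/l1 -/p1 -/l2 -/p2 -/l3 -/p3.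
move=> /code_at_cat[k0]; rewrite add0n -/l1 => /code_at_cat[k1].
move=> /code_at_cons[j1 /code_at_cons[j2]].
rewrite -[(l1 + size p1).+2]addn2 -/l2.
move=> /code_at_cat[k2]; rewrite -/l3 => /code_at_cons[j3 /code_at_cons[j4]].
rewrite -[l3.+2]addn2.
move=> /code_at_cat[k3 /code_at_cons[j5 /code_at_cons[j6 _]]].
pose runs c pc pc' := forall m M, agree (below tmp) m M ->
  exists2 M', reaches P (pc, M) (cost c m) (pc', M') & agree (below tmp) (@den Const g c m) M'.
have C0 : runs pre 0 l1 by move=> m M a; exact: (compileP w0 u0 a k0).
have C1 : runs body l1 (l1 + size p1) by move=> m M a; exact: (compileP w1 u1 a k1).
have C2 : runs data l2 l3 by move=> m M a; exact: (compileP w2 u2 a k2).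
have C3 : runs adv (l3 + 2) (l3 + 2 + size p3).
  by move=> m M a; exact: (compileP w3 u3 a k3).
move: C0 C1 j1 j2 C2 j3 j4 C3 j5 j6; rewrite /runs {runs k0 k1 k2 k3}.
clearbody p3 l3 p2 l2 p1 l1 p0 P => C0 C1 j1 j2 C2 j3 j4 C3 j5 j6.
have [M0 r0 a0] := C0 _ _ (fun a _ i => erefl (m0 a i)).
have loop1 n : n <= n0 -> exists2 M, reaches P (0, m0)
    (cost pre m0 + \sum_(0 <= u < n) (cost body (ms u) + 2)) (l1, M) & agree (below tmp) (ms n) M.
  elim: n => [_|n IH lt_n]; first by exists M0; rewrite // big_geq // addn0.
  have [M1 r1 a1] := IH (ltnW lt_n).
  have [M2 r2 a2] := C1 _ _ a1.
  exists M2; last by [].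
  have r3 := reaches_jump M2 j1.
  rewrite (get_agree a2) // (negbTE (hn _ lt_n)) in r3.
  have r4 : reaches P ((l1 + size p1).+1, M2) 1 (l1, M2) by step_by j2.
  have := reaches_trans (reaches_trans (reaches_trans r1 r2) r3) r4.
  by rewrite big_nat_recr //= -!addnA.
have [M1 r1 a1] := loop1 _ (leqnn n0).
have [M2 r2 a2] := C1 _ _ a1.
have r3 := reaches_jump M2 j1; rewrite (get_agree a2) // hn0 in r3.
have [M3 r4 a3] := C2 _ _ a2.
have {r1 r2 r3 r4} := reaches_trans (reaches_trans (reaches_trans r1 r2) r3) r4.
set t0 := (X in reaches _ _ X _) => -[start quiet].
have t0_le : t0 <= cost pre m0 + \sum_(0 <= n < n0.+1) (cost body (ms n) + 2)
    + cost data (ms n0.+1) by rewrite /t0 big_nat_recr //= !addnA leq_add2r leq_add2l.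
clearbody t0.
(* [T i] is the time at which the exit test is reached for the [i]-th time, counted from 0; the
   output, if any, comes one step later. *)
pose T i := t0 + \sum_(0 <= u < i) (cost adv (es u) + 3).
have TS i : T i.+1 = T i + (cost adv (es i) + 3) by rewrite /T big_nat_recr //= addnA.
have T0 : T 0 = t0 by rewrite /T big_geq // addn0.
clearbody T.
have T_homo i j : i <= j -> T i <= T j.
  move=> /subnKC <-; elim: (j - i) => [|k IH]; first by rewrite addn0.
  by rewrite addnS TS; apply: leq_trans IH (leq_addr _ _).
pose ts i := mkseq (fun j => (T j).+1) i.
have loop2 i : i <= size out -> exists M, [/\ run P D nu (T i) = (l3, M),
    agree (below tmp) (es i) M,
    forall u, u < T i -> emitting P (run P D nu u) = (u \in ts i)
    & forall j, j < i -> exists2 Mj, run P D nu (T j).+1 = (l3.+1, Mj)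
        & agree (below tmp) (es j) Mj].
  elim: i => [_|i IH lt_i].
    exists M3; rewrite T0; split=> //.
    by move=> u ut; rewrite in_nil; apply/negbTE/quiet.
  have [M [rM aM eM jM]] := IH (ltnW lt_i).
  have [s1 q1] := reaches_jump M j3.
  rewrite (get_agree aM) // (negbTE (hi _ lt_i)) in s1.
  have s2 : run P D nu (T i).+1 = (l3.+1, M) by rewrite /run iterS -/(run P D nu _) rM.
  have s3 : run P D nu (T i).+2 = (l3 + 2, M).
    by rewrite /run iterS -/(run P D nu _) s2 /= /current /= j4 addn2.
  have [M' r5 aM'] := C3 _ _ aM.
  have [s4 q4] : reaches P (l3 + 2, M) (cost adv (es i) + 1) (l3, M').
    by apply: reaches_trans r5 _; step_by j5.
  exists M'; split=> //.
  - rewrite TS (_ : T i + _ = cost adv (es i) + 1 + (T i).+2); last by (clear; lia).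
    by rewrite /run iterD -/(run P D nu _) s3.
  - move=> u; rewrite TS => ut; rewrite /ts mkseqS mem_rcons inE.
    case: (ltngtP u (T i)) => hu.
    + rewrite (eM _ hu); have -> // : (u == (T i).+1) = false by apply/negbTE; rewrite neq_ltn ltnS (ltnW hu).
    + case: (ltngtP u (T i).+1) => hu'; first by rewrite ltnS leqNgt hu in hu'.
      * rewrite /=; have -> : u = (u - (T i).+2) + (T i).+2 by rewrite subnK.
        rewrite /run iterD -/(run P D nu _) s3 (negbTE (q4 _ _)); last by move: ut hu'; clear; lia.
        apply/esym/negbTE/mapP => -[j]; rewrite mem_iota => /andP[_ hj] ej.
        have := T_homo j i (ltnW hj); move: ej hu'; clear; lia.
      * by rewrite hu' s2 /emitting /current /= j4.
    + rewrite hu rM /emitting /current /= j3 eqn_leq ltnn andbF /=.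
      apply/esym/negbTE/mapP => -[j]; rewrite mem_iota => /andP[_ hj] ej.
      have := T_homo j.+1 i hj; rewrite TS; move: ej hu; clear; lia.
  - move=> j; rewrite ltnS leq_eqVlt => /orP[/eqP-> |/jM //]; by exists M.
have [M [rM aM eM jM]] := loop2 _ (leqnn _).
have [s1 q1] := reaches_jump M j3.
rewrite (get_agree aM) // hN in s1.
have send : run P D nu (T (size out)).+1 = (l3 + 2 + size p3 + 1, M).
  by rewrite /run iterS -/(run P D nu _) rM.
(* The halting configuration is a fixed point, so nothing is output after the last answer. *)
have stop u : run P D nu (u + (T (size out)).+1) = (l3 + 2 + size p3 + 1, M).
  elim: u => [|u IH] //; rewrite addSn /run iterS -/(run P D nu _) IH /= /current /=.
  by rewrite addn1 j6.
exists t0, (ts (size out)), (T (size out)).+1, out; split.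
- by [].
- have gap i : i < size out -> (T i.+1).+1 <= (T i).+1 + (delay + 3).
    by move=> hi'; rewrite TS; have := hcost _ hi'; clear; lia.
  rewrite /ts.
  (* Here [k] outputs remain from the [i]-th on. The second disjunct discards [k = 0], for which
     [k.-1] would count wrongly. *)
  have gen k i : i + k = size out ->
     path (fun t t' => t <= t' <= t + (delay + 3)) (T i).+1
       (rcons [seq (T j).+1 | j <- iota i.+1 k.-1] (T (size out)).+1) || (k == 0).
    elim: k i => [|k IH] i ek; first by rewrite orbT.
    rewrite orbF /=; case: k IH ek => [|k] IH ek.
      rewrite /= andbT -ek addn1; rewrite gap ?andbT; last by move: ek; clear; lia.
      by rewrite ltnS T_homo.
    rewrite /= gap ?andbT; last by move: ek; clear; lia.
    rewrite ltnS T_homo //=; have := IH i.+1; rewrite orbF /=; apply; move: ek; clear; lia.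
  case e: (size out) => [|k].
    by rewrite /= T0 andbT leqnSn addn3 addnS ltnS leq_addr.
  rewrite /mkseq /= T0; have := gen k.+1 0; rewrite /= e orbF T0; move=> -> //.
  by rewrite andbT leqnSn addn3 addnS ltnS leq_addr.
- split.
    apply/(sortedP 0) => i; rewrite size_mkseq => hi'.
    rewrite !nth_mkseq ?(ltnW hi') // TS; clear; lia.
  move=> t; case: (ltnP t (T (size out))) => ht; first exact: eM.
  have nin : t \in ts (size out) = false.
    apply/negbTE/mapP => -[j]; rewrite mem_iota => /andP[_ hj] ej.
    have := T_homo j.+1 (size out) hj; rewrite TS; move: ej ht; clear; lia.
  rewrite nin; case: (ltngtP t (T (size out))) => ht'; first by rewrite ltnNge ht in ht'.
    rewrite (_ : t = t - (T (size out)).+1 + (T (size out)).+1); last by rewrite subnK.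
    by rewrite stop /emitting /current /= addn1 j6.
  by rewrite ht' rM /emitting /current /= j3.
- by rewrite send /halted /current /= addn1 j6.
- split=> //; rewrite /ts.
  have gen k i : i + k = size out -> List.Forall2 (fun t a => shows (run P D nu t) a)
      [seq (T j).+1 | j <- iota i k] (drop i out).
    elim: k i => [|k IH] i ek.
      by rewrite drop_oversize /=; [constructor | move: ek; clear; lia].
    have hi' : i < size out by move: ek; clear; lia.
    case eo: (onth out i) => [a|]; last first.
      by move: (onthTE out i); rewrite eo hi'.
    have -> : drop i out = a :: drop i.+1 out.
      rewrite (drop_nth a) //; congr cons; by rewrite (@onth_nth _ a a _ _ eo).
    constructor; last by apply: IH; move: ek; clear; lia.
    have [Mi -> ai] := jM _ hi'; have [d1 d2 d3] := hshow _ _ eo.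
    split=> //; [move=> x hx | ]; rewrite /= -ai //; first exact: d2.
  by have := gen (size out) 0 (add0n _); rewrite drop0.
Qed.
End Assembly.

(** * Running time of loop programs *)

Fixpoint bounds (c : cmd) : seq nat :=
  match c with
  | Skip | Store _ _ _ => [::]
  | Seq c1 c2 | If _ c1 c2 => bounds c1 ++ bounds c2
  | For _ b c => b :: bounds c
  end.

Fixpoint max_bcost (b : bexp) : nat :=
  match b with
  | BEq e1 e2 | BLt e1 e2 => size (comp_expr 0 e1 ++ comp_expr 0 e2) + 3
  | BNum e => size (comp_expr 0 e) + 3
  | BNot b => max_bcost b + 2
  | BAnd b1 b2 => max_bcost b1 + max_bcost b2 + 3
  end.

(* [v b] bounds the value of the register [b]. *)
Fixpoint max_cost (v : nat -> nat) (c : cmd) : nat :=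
  match c with
  | Skip => 0
  | Store a es e => size (comp_exprs 0 es ++ comp_expr 0 e) + 1
  | Seq c1 c2 => max_cost v c1 + max_cost v c2
  | If b c1 c2 => max_bcost b + 3 + max_cost v c1 + max_cost v c2
  | For i b c => 3 + v b * (max_cost v c + 4)
  end.

Section Cost.
Variables (Const : eqType) (g : query Const).
Local Notation memory := (memory Const (carrier g)).

Lemma bcost_le (m : memory) b : bcost m b <= max_bcost b.
Proof.
elim: b => [e1 e2|e1 e2|e|b IH|b1 IH1 b2 IH2] /=; rewrite ?leq_subr ?leq_add2r //.
exact: leq_add.
Qed.

(** No loop bound is written by the command, so the value of a bound at the start is its value in
    every round, and nested loops multiply initial values. *)
Lemma cost_le (W : seq nat) v c (m : memory) :
  {subset writes c <= W} -> all [predC W] (bounds c) ->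
  (forall b, b \in bounds c -> num (get m b) <= v b) -> cost c m <= max_cost v c.
Proof.
have stable c' (m' : memory) : {subset writes c' <= W} ->
    forall s, all [predC W] s -> (forall b, b \in s -> num (get m' b) <= v b) ->
    forall b, b \in s -> num (get (den c' m') b) <= v b.
  move=> sub s /allP hs hv b bs; rewrite /get den_frame; first exact: hv.
  by apply: contra (hs _ bs) => /sub.
elim: c m => [|a es e|c1 IH1 c2 IH2|b c1 IH1 c2 IH2|i b c IH] m //=.
- move=> sub; rewrite all_cat => /andP[h1 h2] hv.
  have s1 : {subset writes c1 <= W} by move=> x hx; rewrite sub // mem_cat hx.
  have s2 : {subset writes c2 <= W} by move=> x hx; rewrite sub // mem_cat hx orbT.
  apply: leq_add; first by apply: IH1 => // b hb; rewrite hv // mem_cat hb.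
  by apply: IH2 => //; apply: stable => // b hb; rewrite hv // mem_cat hb orbT.
- move=> sub; rewrite all_cat => /andP[h1 h2] hv.
  have s1 : {subset writes c1 <= W} by move=> x hx; rewrite sub // mem_cat hx.
  have s2 : {subset writes c2 <= W} by move=> x hx; rewrite sub // mem_cat hx orbT.
  have c1_le : cost c1 m <= max_cost v c1.
    by apply: IH1 => // b' hb; rewrite hv // mem_cat hb.
  have c2_le : cost c2 m <= max_cost v c2.
    by apply: IH2 => // b' hb; rewrite hv // mem_cat hb orbT.
  by have := bcost_le m b; case: ifP => _; move: c1_le c2_le; clear; lia.
- move=> sub /andP[hb hc] hv.
  have s : {subset writes c <= W} by move=> x hx; rewrite sub // inE hx orbT.
  have iW : i \in W by rewrite sub ?mem_head.
  rewrite leq_add2l; set n := num _; have n_le : n <= v b by apply: hv; rewrite mem_head.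
  apply: (@leq_trans (n * (max_cost v c + 4))); last by rewrite leq_mul2r n_le orbT.
  rewrite -[n in n * _]subn0 -sum_nat_const_nat; apply: leq_sum => t _.
  rewrite leq_add2r; apply: IH => // b' hb'.
  elim: t => [|t IHt] /=.
    rewrite get_set_neq; first by rewrite hv // inE hb' orbT.
    by move: (allP hc _ hb'); apply: contraNneq => ->.
  rewrite get_set_neq; last by move: (allP hc _ hb'); apply: contraNneq => ->.
  apply: (stable _ _ s [:: b']); rewrite ?mem_head //=; first by have := allP hc _ hb' => /= ->.
  by move=> b''; rewrite inE => /eqP->.
Qed.
End Cost.

(** With [N.+1] as base, the bounds are monotone in the degree also for [N = 0]. *)
Definition poly_bounded (d : nat) (f : nat -> nat) : Prop :=
  exists B, forall N, f N <= B * N.+1 ^ d.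

Lemma poly_bounded_const B : poly_bounded 0 (fun=> B).
Proof. by exists B => N; rewrite muln1. Qed.

Lemma poly_bounded_weaken d d' f : d <= d' -> poly_bounded d f -> poly_bounded d' f.
Proof.
move=> le_d [B hB]; exists B => N; apply: leq_trans (hB N) _.
by rewrite leq_mul2l leq_pexp2l ?orbT.
Qed.

Lemma poly_boundedD d f f' :
  poly_bounded d f -> poly_bounded d f' -> poly_bounded d (fun N => f N + f' N).
Proof. by move=> [B hB] [B' hB']; exists (B + B') => N; rewrite mulnDl leq_add. Qed.

Lemma poly_boundedM d d' f f' :
  poly_bounded d f -> poly_bounded d' f' -> poly_bounded (d + d') (fun N => f N * f' N).
Proof.
by move=> [B hB] [B' hB']; exists (B * B') => N; rewrite expnD mulnACA leq_mul.
Qed.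

Fixpoint loop_degree (deg : nat -> nat) (c : cmd) : nat :=
  match c with
  | Skip | Store _ _ _ => 0
  | Seq c1 c2 | If _ c1 c2 => maxn (loop_degree deg c1) (loop_degree deg c2)
  | For _ b c => deg b + loop_degree deg c
  end.

Lemma max_cost_poly (v : nat -> nat -> nat) deg c :
  (forall b, b \in bounds c -> poly_bounded (deg b) (fun N => v N b)) ->
  poly_bounded (loop_degree deg c) (fun N => max_cost (v N) c).
Proof.
elim: c => [|a es e|c1 IH1 c2 IH2|b c1 IH1 c2 IH2|i b c IH] /= hv;
  try exact: poly_bounded_const.
- apply: poly_boundedD; [apply: (poly_bounded_weaken (leq_maxl _ _)) |
    apply: (poly_bounded_weaken (leq_maxr _ _))].
    by apply: IH1 => b hb; apply: hv; rewrite mem_cat hb.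
  by apply: IH2 => b hb; apply: hv; rewrite mem_cat hb orbT.
- apply: poly_boundedD; first apply: poly_boundedD.
  + by apply: poly_bounded_weaken (poly_bounded_const _).
  + apply: (poly_bounded_weaken (leq_maxl _ _)).
    by apply: IH1 => b' hb; apply: hv; rewrite mem_cat hb.
  + apply: (poly_bounded_weaken (leq_maxr _ _)).
    by apply: IH2 => b' hb; apply: hv; rewrite mem_cat hb orbT.
- apply: poly_boundedD; first by apply: poly_bounded_weaken (poly_bounded_const _).
  apply: poly_boundedM; first by apply: hv; rewrite mem_head.
  apply: poly_boundedD; last by apply: poly_bounded_weaken (poly_bounded_const _).
  by apply: IH => b' hb; apply: hv; rewrite inE hb orbT.
Qed.

(** * Elimination orders from tree decompositions *)

Section Leaves.
Variables (T : finType) (e : rel T).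
Hypothesis tree : is_tree e.
Implicit Types S A : {set T}.

Let esym : symmetric e. Proof. by case: tree. Qed.
Let eirr : irreflexive e. Proof. by case: tree. Qed.

Definition within S := [rel x y | [&& e x y, x \in S & y \in S]].

Lemma connected_inP S :
  reflect {in S &, forall u v, connect (within S) u v} (connected_in e S).
Proof.
apply: (iffP forall_inP) => [h u v uS vS | h u uS].
  by have /forall_inP := h u uS; apply.
by apply/forall_inP => v vS; apply: h.
Qed.

Lemma within_sym S : connect_sym (within S).
Proof.
apply: sym_connect_sym => x y /=; rewrite esym; congr andb; exact: andbC.
Qed.

Lemma sub_connect_within S A u v :
  A \subset S -> connect (within A) u v -> connect (within S) u v.
Proof.
move=> /subsetP sAS; apply: connect_sub => x y /= /and3P[exy xA yA].
by apply: connect1; rewrite /= exy !sAS.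
Qed.

Lemma connected_in_set1 t : connected_in e [set t].
Proof. by apply/connected_inP => u v /set1P-> /set1P->. Qed.

Lemma connected_in_setU1 S t p :
  connected_in e S -> p \in S -> e t p -> connected_in e (t |: S).
Proof.
move=> /connected_inP cS pS etp; apply/connected_inP.
have tp : connect (within (t |: S)) t p.
  by apply: connect1; rewrite /= etp !inE eqxx pS orbT.
have to_p u : u \in t |: S -> connect (within (t |: S)) u p.
  case/setU1P => [->//|uS]; apply: sub_connect_within (cS _ _ uS pS); exact: subsetUr.
move=> u v uS vS; apply: connect_trans (to_p _ uS) _.
by rewrite within_sym to_p.
Qed.

Lemma connected_in_crossing S A a :
  connected_in e S -> A \proper S -> a \in A ->
  exists p t, [/\ p \in A, t \in S, t \notin A & e t p].
Proof.
move=> /connected_inP cS /properP[/subsetP sAS [b bS bA]] aA.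
have /connectP[q] := cS _ _ (sAS _ aA) bS.
elim: q a aA => [|c q IH] a aA /=.
  by move=> _ eb; move: bA; rewrite eb aA.
case/andP=> /and3P[eac _ cS'] pq lq; case cA : (c \in A); first exact: IH pq lq.
by exists a, c; rewrite aA cS' cA esym eac.
Qed.

(** Two distinct neighbours of [t] in [A] are joined by a simple path inside [A], which [t] would
    close to a cycle. *)
Lemma acyclic_neighbour A t p p' :
  connected_in e A -> t \notin A -> p \in A -> p' \in A -> e t p -> e t p' -> p = p'.
Proof.
move=> /connected_inP cA tA pA p'A etp etp'; apply/eqP/negPn/negP => neq.
have /connectP[q0 pq0 lq0] := cA _ _ pA p'A.
case/shortenP: pq0 lq0 => q pq uq _ lq.
have qA : all (mem A) q.
  elim: q p pA {uq lq neq etp} pq => //= x q IH p pA /andP[/and3P[_ _ xA]] /(IH _ xA) ->.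
  by rewrite xA.
case: tree => _ _ _ _ /(_ (t :: p :: q)); apply.
  by case: q lq {uq pq qA} => //= eq; move: neq; rewrite eq eqxx.
apply/andP; split.
  rewrite /= etp rcons_path -lq esym etp' andbT.
  by apply: sub_path pq => x y /and3P[].
rewrite cons_uniq uq andbT inE negb_or.
apply/andP; split; first by apply: contraNneq tA => ->.
by apply: contra tA => /(allP qA).
Qed.

(* [S'] grows to [S] by adding one vertex at a time; the last one is a leaf. *)
Lemma leaf_outside S S' :
  connected_in e S -> S != set0 -> connected_in e S' -> S' \proper S ->
  exists t, [/\ t \in S, t \notin S', connected_in e (S :\ t) &
    S :\ t = set0 \/
    exists2 p, p \in S :\ t & forall u, u \in S -> e t u -> u = p].
Proof.
move=> cS S0 cS' pS'.
pose P (A : {set T}) := connected_in e A && (A \proper S).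
have PS' : P S' by rewrite /P cS' pS'.
(* [A] is a maximal connected proper part of [S] containing [S']. If [A] is empty, [S] is a single
   vertex. Otherwise adding to [A] an adjacent vertex of [S] must exhaust [S], so exactly one vertex
   is missing, and it is a leaf by acyclicity. *)
have [A /maxsetP[/andP[cA pA] maxA] sS'A] := @maxset_exists _ P _ PS'.
have sAS := proper_sub pA.
have [A0|[a aA]] := set_0Vmem A.
  have [r rS] := set0Pn _ S0.
  have S1 : S = [set r].
    apply/eqP; rewrite eqEsubset sub1set rS andbT; apply/negPn/negP => ns.
    have : [set r] = A.
      by apply: maxA; rewrite ?A0 ?sub0set // /P connected_in_set1 properE sub1set rS.
    by rewrite A0 => /setP/(_ r); rewrite !inE eqxx.
  exists r; rewrite S1 setDv; split; rewrite ?set11 //.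
  - by apply/negP => /(subsetP sS'A); rewrite A0 inE.
  - by apply/connected_inP => u v; rewrite inE.
  - by left.
have [p [t [pA' tS tA etp]]] := connected_in_crossing cS pA aA.
have SE : S = t |: A.
  apply/eqP; rewrite eqEsubset andbC subUset sub1set tS sAS /=.
  apply/negPn/negP => ns.
  have : t |: A = A.
    apply: maxA; last exact: subsetUr.
    by rewrite /P (connected_in_setU1 cA pA' etp) properE ns subUset sub1set tS sAS.
  by move=> /setP/(_ t); rewrite !inE eqxx (negbTE tA).
have St : S :\ t = A by rewrite SE setU1K.
exists t; rewrite St; split=> //.
  by apply: contra tA; apply: (subsetP sS'A).
right; exists p => // u; rewrite SE => /setU1P[->|uA]; first by rewrite eirr.
by move=> etu; apply: acyclic_neighbour cA tA uA pA' etu etp.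
Qed.

Lemma connected_in_leaf A t p :
  connected_in e A -> (forall u, u \in A -> e t u -> u = p) -> connected_in e (A :\ t).
Proof.
move=> /connected_inP cA leaf; apply/connected_inP => u v.
rewrite !inE => /andP[ut uA] /andP[vt vA].
have /connectP[q pq lq] := cA _ _ uA vA.
(* A path can only pass through [t] by stepping from [p] to [t] and back. *)
pose reached x := connect (within (A :\ t)) u (if x == t then p else x).
have step x y : within A x y -> reached x -> reached y.
  rewrite /reached => /and3P[exy xA yA].
  case: (eqVneq x t) exy => [->|xt] exy; case: (eqVneq y t) => [yt|yt] //.
  - by rewrite (leaf y yA).
  - by rewrite -(leaf x xA) // esym -yt.
  - by move=> ux; apply: connect_trans ux (connect1 _); rewrite /= exy !inE xt yt xA yA.
have : reached u by rewrite /reached (negbTE ut).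
suff : reached v -> connect (within (A :\ t)) u v.
  move=> fin ru; apply: fin; rewrite lq.
  have walk : forall q x, path (within A) x q -> reached x -> reached (last x q).
    by elim=> //= y r IH x /andP[xy yr] /(step _ _ xy); apply: IH.
  exact: walk ru.
by rewrite /reached (negbTE vt).
Qed.
End Leaves.

(** * Pruning a project-connex decomposition leaf by leaf *)

Section EliminationOrder.
Variables (Const : eqType) (g : query Const) (k : nat).
Local Open Scope fset_scope.

(* The list of the variables in the order in which they are eliminated, each with
   the set of variables of the table computed for its elimination. *)
Definition elimination := seq (nat * {fset nat}).
Implicit Types (l : elimination) (E B : {fset nat}).

(* The first variable of [l] in [E] is eliminated by a table that covers [E]. *)
Fixpoint hosted l E : bool :=
  if l is (x, B) :: l then (if x \in E then E `<=` B else hosted l E) else E == fset0.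

Definition covered B : Prop :=
  exists s : seq {fset nat}, [/\ size s <= k, {subset s <= hyperedges g}
    & {subset B <= \bigcup_(E <- s) E}].

(** The [hosted] condition is the running intersection property: once [x] is summed out, the
    remaining variables of its table fit into a later table, which can receive the message. The
    condition on projection sets puts the variables that a projection drops before those that it
    keeps. *)
Fixpoint elimination_ok l : Prop :=
  if l is (x, B) :: l' then
    [/\ x \in B, {subset B <= x :: unzip1 l'}, covered B & hosted l' (B `\ x)]
    /\ [/\ x \notin unzip1 l',
           forall y X, y \in unzip1 l' -> X \in proj_sets g -> x \in X -> y \in X
         & elimination_ok l']
  else True.

Lemma hosted0 l : hosted l fset0.
Proof. by elim: l => //= -[x B] l. Qed.

Variable d : tree_decomposition g.
Hypothesis width_d : width d <= k.
Variable W : seq {set node d}.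
Hypothesis W_witness : all2 (@witness_subtree _ g d) (proj_sets g) W.
Hypothesis W_sorted : sorted (fun S S' : {set node d} => S' \subset S) W.

Let e := @edge _ g d.
Let tree : is_tree e := @edge_tree _ g d.

Lemma covered_bag (t : node d) B : {subset B <= bag t} -> covered B.
Proof.
move=> sB; exists (enum_fset (guard t)); split.
- by apply: leq_trans width_d; rewrite (leq_bigmax t).
- by move=> E; apply/fsubsetP: E; apply: guard_edges.
- by move=> x /sB; apply/fsubsetP: x; apply: bag_guarded.
Qed.

Lemma witness_connected S : S \in W -> connected_in e S.
Proof.
elim: (proj_sets g) W W_witness => [|X Xs IH] [|S' W'] //= /andP[/andP[cS' _] h].
by rewrite inE => /orP[/eqP-> // | /IH]; apply.
Qed.

Lemma witness_bags X : X \in proj_sets g ->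
  exists2 S, S \in W & forall x, x \in X <-> exists2 t, t \in S & x \in bag t.
Proof.
elim: (proj_sets g) W W_witness => [|X' Xs IH] [|S' W'] //= /andP[/andP[_ /eqP eX] h].
rewrite inE => /orP[/eqP-> | /IH]; last first.
  by case/(_ _ h) => S SW hS; exists S => //; rewrite inE SW orbT.
exists S'; first exact: mem_head.
move=> x; rewrite -eX; split=> [/bigfcupP[t]|[t tS xt]].
  by rewrite mem_index_enum => /= tS xt; exists t.
by apply/bigfcupP; exists t => //; rewrite mem_index_enum.
Qed.

(** Pruning has to pass through every witness: each one is still intact and strictly inside the
    current set, or the current set has already shrunk into it. *)
Definition comparable_in (S : {set node d}) := forall S', S' \in W -> (S \subset S') || (S' \proper S).

(** The witnesses decrease along [W], so the first one strictly inside [S] contains all the others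
    that are; if there is none, the target is the empty set. *)
Lemma next_target (S : {set node d}) : S != set0 ->
  exists S', [/\ connected_in e S', S' \proper S
    & forall S'', S'' \in W -> S'' \proper S -> S'' \subset S'].
Proof.
move=> S0; case hW : (has (fun S' : {set node d} => S' \proper S) W); last first.
  exists set0; split.
  - by apply/(connected_inP _ _) => u v; rewrite inE.
  - by rewrite properE sub0set subset0.
  - by move=> S'' SW pS; move/hasPn/(_ _ SW): (negbT hW); rewrite pS.
set i := find (fun S' : {set node d} => S' \proper S) W.
have iW : i < size W by rewrite -has_find.
exists (nth set0 W i); split.
- by apply: witness_connected; rewrite mem_nth.
- by apply: (@nth_find _ set0 (fun S' : {set node d} => S' \proper S)).
move=> S'' SW pS; rewrite -(nth_index set0 SW).
apply: (@sorted_leq_nth _ (fun S S' : {set node d} => S' \subset S)) => //.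
- by move=> A B C h1 h2; apply: subset_trans h2 h1.
- by rewrite inE index_mem.
rewrite leqNgt; apply/negP => lt_i.
by have := @before_find _ set0 (fun S' : {set node d} => S' \proper S) _ _ lt_i;
  rewrite nth_index ?pS.
Qed.

Definition in_bags (S : {set node d}) x := [exists t in S, x \in @bag _ g d t].

(** A leaf [t] of [S] outside the next witness is removed. Its private variables, which occur in no
    other bag of [S], are eliminated first, each with a table inside the bag of [t]; the guard of
    [t] then covers the table. The rest is done by induction on [S] without [t]. *)
Lemma eliminate_nodes (S : {set node d}) :
  connected_in e S -> comparable_in S ->
  (forall x, connected_in e [set v in S | x \in @bag _ g d v]) ->
  exists l, [/\ elimination_ok l, (forall x, (x \in unzip1 l) = in_bags S x)
    & forall t E, t \in S -> {subset E <= @bag _ g d t} -> hosted l E].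
Proof.
have [n] := ubnP #|S|; elim: n S => // n IH S; rewrite ltnS => le_n cS cmp cx.
have [S0|S0] := eqVneq S set0.
  exists [::]; split=> //; last by move=> t E; rewrite S0 inE.
  by move=> x; apply/esym/existsP => -[t]; rewrite S0 inE.
have [S' [cS' pS' maxS']] := next_target S0.
have [t [tS tS' cSt leaf]] := leaf_outside tree cS S0 cS' pS'.
pose private x := ~~ in_bags (S :\ t) x.
have [l' [ok_l' vars_l' host_l']] : exists l, [/\ elimination_ok l,
    (forall x, (x \in unzip1 l) = in_bags (S :\ t) x)
    & forall u E, u \in S :\ t -> {subset E <= @bag _ g d u} -> hosted l E].
  apply: IH => //.
  - by rewrite (cardsD1 t) tS in le_n.
  - move=> A AW; have /orP[SA|pA] := cmp _ AW.
      by rewrite (subset_trans (subD1set _ _) SA).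
    have sA := subset_trans (maxS' _ AW pA) (_ : S' \subset S :\ t).
    have {}sA : A \subset S :\ t.
      apply: sA; apply/subsetP => u uS'; rewrite !inE (subsetP (proper_sub pS')) // andbT.
      by apply: contraNneq tS' => <-.
    by rewrite properE sA orbN.
  - move=> x; have -> : [set v in S :\ t | x \in @bag _ g d v]
        = [set v in S | x \in @bag _ g d v] :\ t.
      by apply/setP => v; rewrite !inE andbA.
    case: leaf => [E0|[p pS leaf]].
      apply/connected_inP => u v; rewrite !inE => /and3P[ut uS _].
      by have := in_set0 u; rewrite -E0 !inE ut uS.
    by apply: (connected_in_leaf tree (p := p)) => // u; rewrite inE => /andP[uS _]; apply: leaf.
(* By connectedness, a variable of [t] that also occurs elsewhere in [S] occurs in the only
   neighbour [p]. What is left of the bag of [t] after its private variables are gone thus fits into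
   the bag of [p]. *)
have to_p p x u : (forall v, v \in S -> e t v -> v = p) ->
    x \in @bag _ g d t -> u \in S :\ t -> x \in @bag _ g d u -> x \in @bag _ g d p.
  move=> leaf_p xt uS xu; have /connected_inP/(_ t u) := cx x.
  rewrite !inE tS xt; move: uS; rewrite !inE xu => /andP[ut ->] /(_ isT isT).
  case/connectP => -[|c q] /=; first by move=> _ eu; rewrite eu eqxx in ut.
  by case/andP => /and3P[etc _]; rewrite inE => /andP[cS'' xc] _ _; rewrite -(leaf_p c).
(* A witness strictly inside [S] avoids [t], so its projection set cannot contain a variable private
   to [t]. If [X] contains one, its witness includes [S], and every variable of [S] is in [X]. *)
have lev z y X : z \in @bag _ g d t -> private z -> in_bags S y -> X \in proj_sets g ->
    z \in X -> y \in X.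
  move=> zt pz /existsP[u /andP[uS yu]] XP.
  have [A AW hA] := witness_bags XP => /hA[v vA zv].
  have /orP[SA|pA] := cmp _ AW; first by apply/hA; exists u => //; apply: (subsetP SA).
  case/negP: pz; apply/existsP; exists v; rewrite zv andbT !inE.
  have vS' := subsetP (maxS' _ AW pA) _ vA.
  by rewrite (subsetP (proper_sub pS')) // andbT; apply: contraNneq tS' => <-.
(* The private variables are put in front of [l'] one by one. The last clause is about sets inside
   the bag of [t], including the table scopes left over by these eliminations. *)
have add zs : uniq zs -> {subset zs <= @bag _ g d t} -> all private zs ->
  exists l, [/\ elimination_ok l,
    (forall x, (x \in unzip1 l) = (x \in zs) || in_bags (S :\ t) x),
    (forall u E, u \in S :\ t -> {subset E <= @bag _ g d u} -> hosted l E)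
    & forall E, {subset E <= @bag _ g d t} -> {subset E <= unzip1 l} -> hosted l E].
  elim: zs => [_ _ _|z zs IHz /= /andP[nz uzs] sub /andP[pz pzs]].
    exists l'; split=> // E sE sl.
    have [->|[x xE]] := fset_0Vmem E; first exact: hosted0.
    have := sl _ xE; rewrite vars_l' => /existsP[u /andP[uS xu]].
    case: leaf => [E0|[p pS leaf_p]]; first by rewrite E0 inE in uS.
    apply: (host_l' p) => // y yE.
    have := sl _ yE; rewrite vars_l' => /existsP[v /andP[vS yv]].
    exact: to_p leaf_p (sE _ yE) vS yv.
  have [|//|l [ok_l vars_l host_l hostt_l]] := IHz uzs.
    by move=> x xz; apply: sub; rewrite inE xz orbT.
  have zt : z \in @bag _ g d t by apply: sub; apply: mem_head.
  (* The part of the bag that is still present when [z] is eliminated. *)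
  pose B := [fset x in @bag _ g d t | x \in z :: unzip1 l].
  have zB : z \in B by rewrite !inE zt eqxx.
  have Bt : {subset B <= @bag _ g d t} by move=> x; rewrite !inE => /andP[].
  have zl : z \notin unzip1 l by rewrite vars_l (negbTE nz).
  exists ((z, B) :: l); split=> /=.
  - split; split=> //.
    + by move=> x; rewrite !inE => /andP[].
    + exact: covered_bag Bt.
    + apply: hostt_l => x; rewrite !inE => /andP[xz /andP[xt]]; first by [].
      by rewrite (negbTE xz).
    + move=> y X yl; apply: lev => //; move: yl; rewrite vars_l => /orP[yz|].
        by apply/existsP; exists t; rewrite tS sub // inE yz orbT.
      case/existsP => u /andP[uS yu]; apply/existsP; exists u.
      by move: uS; rewrite inE yu => /andP[_ ->].
  - by move=> x; rewrite !inE vars_l orbA.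
  - move=> u E uS sE; case: ifP => [zE|_]; last exact: host_l uS sE.
    by case/negP: pz; apply/existsP; exists u; rewrite uS sE.
  - move=> E sE sl; case: ifP => [zE|zE].
      by apply/fsubsetP => x xE; rewrite !inE sE //=; have := sl _ xE; rewrite inE.
    apply: hostt_l => // x xE; have := sl _ xE; rewrite inE => /orP[/eqP xz|//].
    by rewrite -xz xE in zE.
have [|||l [ok_l vars_l host_l hostt_l]] := add [seq x <- bag t | private x].
- by rewrite filter_uniq // fset_uniq.
- by move=> x; rewrite mem_filter => /andP[].
- exact: filter_all.
have all_vars x : (x \in unzip1 l) = in_bags S x.
  rewrite vars_l mem_filter; apply/orP/existsP => [[/andP[_ xt]|]|[u /andP[uS xu]]].
  - by exists t; rewrite tS.
  - by case/existsP => u; rewrite !inE => /andP[/andP[_ uS] xu]; exists u; rewrite uS.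
  - case: (boolP (private x)) => px; last by right; move/negbNE: px.
    left; case: (eqVneq u t) xu => [->|ut] xu; first by rewrite xu.
    by case/negP: px; apply/existsP; exists u; rewrite !inE ut uS.
exists l; split=> // u E uS sE; case: (eqVneq u t) sE => [->|ut] sE.
  by apply: hostt_l => // x xE; rewrite all_vars; apply/existsP; exists t; rewrite tS sE.
by apply: (host_l u) => //; rewrite !inE ut.
Qed.
End EliminationOrder.

Lemma elimination_order (Const : eqType) (g : query Const) k : pghw_at_most g k ->
  exists l : elimination, [/\ elimination_ok g k l, unzip1 l =i query_vars g
    & {in hyperedges g, forall E, hosted l E}].
Proof.
case=> w [[d [W [W_witness W_sorted]] width_d] _] le_k.
rewrite -width_d in le_k; have tree := @edge_tree _ g d.
have [|S' _|x|l [ok_l vars_l host_l]] :=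
    eliminate_nodes le_k W_witness W_sorted (S := [set: node d]).
- by case: tree.
- by rewrite properT subTset orbN.
- have -> : [set v in [set: node d] | x \in bag v] = [set v | x \in bag v].
    by apply/setP => v; rewrite !inE.
  case: (boolP (x \in query_vars g)) => [|nx]; first exact: var_connected.
  apply/connected_inP => u v; rewrite !inE => xu.
  by case/negP: nx; apply: (fsubsetP (bag_vars u)).
exists l; split=> // [x|E EH]; last first.
  have [v /fsubsetP sE] := edge_covered d EH; exact: host_l sE.
rewrite vars_l; apply/existsP/idP => [[t /andP[_ xt]]|].
  exact: (fsubsetP (bag_vars t)).
case/bigfcupP => al; rewrite andbT => alq xal.
have [|v /fsubsetP sE] := edge_covered d (E := atom_vars al).
  by rewrite /hyperedges !inE; apply: map_f.
by exists v; rewrite inE sE.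
Qed.

(** * Plans *)

(** Finitely many choices are made by induction, without an axiom. *)
Lemma finite_choice (A : Type) (a0 : A) (P : nat -> A -> Prop) m :
  (forall j, j < m -> exists a, P j a) -> exists f, forall j, j < m -> P j (f j).
Proof.
elim: m => [|m IH] h; first by exists (fun=> a0).
have [|f hf] := IH; first by move=> j jm; apply: h; rewrite ltnS ltnW.
have [a ha] := h m (ltnSn m).
exists (fun j => if j == m then a else f j) => j; rewrite ltnS leq_eqVlt.
case: (eqVneq j m) => [->//|_ /=]; exact: hf.
Qed.

Section Plans.
Variables (Const : eqType) (g : query Const) (k : nat).

Definition term_at (a p : nat) : option (term Const) :=
  obind (fun al : atom Const => onth al.2 p) (onth (body g) a).

(** A sum instead of a maximum: it bounds every arity all the same and is simple to compute for the
    machine. *)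
Definition max_arity : nat := sumn (qschema g).

(* The number of projections that keep [x], as the projection sets decrease. *)
Definition level (x : nat) : nat :=
  iteri (size (proj_sets g))
    (fun i acc => if x \in nth fset0 (proj_sets g) i then i.+1 else acc) 0.

Section Valid.
Variables (m : nat) (pl : nat -> nat -> nat -> nat).

(* The variables are numbered in the order in which they are eliminated.  Table
   [j], with variables [scope j], eliminates variable [j]; the table [m] collects
   the rest.  The result of table [j] is used by table [parent j], and atom [a] by
   table [host a].  The value of variable [v] in table [j] is read off a fact for
   the atom [guard_atom j (slot j v)], at position [slot_pos j v]. *)
Definition var_at j := pl 0 j 0.
Definition scope j v := pl 1 j v == 1.
Definition parent j := pl 2 j 0.
Definition host a := pl 3 a 0.
Definition guard_atom j s := pl 4 j s.
Definition slot j v := pl 5 j v.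
Definition slot_pos j v := pl 6 j v.
Definition term_var a p := pl 7 a p.

Definition valid_var j v : bool :=
  (scope j v ==> [&& ~~ (v < j), (v != j) ==> scope (parent j) v, slot j v < k
      & term_at (guard_atom j (slot j v)) (slot_pos j v) == Some (inl (var_at v))])
  && ((v < j) ==> (var_at v != var_at j) && ~~ (level (var_at j) < level (var_at v))).

(** The condition [~~ scope m j] leaves the root table [m] without variables, so that a single row,
    number 0, represents it. *)
Definition valid_table j : bool :=
  [&& scope j j, j < parent j, parent j < m.+1, ~~ scope m j
    & all (valid_var j) (iota 0 m)].

Definition valid_term a p : bool :=
  if term_at a p is Some (inl x) then
    [&& term_var a p < m, var_at (term_var a p) == x & scope (host a) (term_var a p)]
  else true.

Definition valid_atom a : bool :=
  (host a < m.+1) && all (valid_term a) (iota 0 max_arity).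

Definition valid_plan : bool :=
  all valid_table (iota 0 m) && all valid_atom (iota 0 (size (body g))).
End Valid.

Lemma level_homo x y : (forall X, X \in proj_sets g -> x \in X -> y \in X) ->
  level x <= level y.
Proof.
move=> h; rewrite /level.
suff : forall n, n <= size (proj_sets g) ->
    iteri n (fun i acc => if x \in nth fset0 (proj_sets g) i then i.+1 else acc) 0
    <= iteri n (fun i acc => if y \in nth fset0 (proj_sets g) i then i.+1 else acc) 0 <= n.
  by case/(_ _ (leqnn _))/andP.
elim=> // n IH ltn /=; have /andP[h1 h2] := IH (ltnW ltn).
case: ifP => hx; case: ifP => hy; rewrite ?leqnn ?andbT //.
- by move: hy; rewrite (h _ _ hx) ?mem_nth.
- by apply: leq_trans h1 _; apply: leqW.
- by rewrite h1 leqW.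
Qed.

Section FromElimination.
Variable l : elimination.
Hypothesis ok_l : elimination_ok g k l.
Let xs := unzip1 l.
Let tab j := (nth (0, fset0) l j).2.

Lemma hosted_find l' E : hosted l' E ->
  let i := find (fun x => x \in E) (unzip1 l') in
  (i < size l' /\ {subset E <= (nth (0, fset0) l' i).2}) \/ E = fset0.
Proof.
elim: l' => [|[x B] l' IH] /=; first by move/eqP->; right.
case: ifP => xE; first by move/fsubsetP; left.
by case/IH => [[h1 h2]|->]; [left | right].
Qed.

Lemma elimination_at j : j < size l ->
  [/\ nth 0 xs j \in tab j, {subset tab j <= nth 0 xs j :: drop j.+1 xs},
      covered g k (tab j) & hosted (drop j.+1 l) (tab j `\ nth 0 xs j)%fset]
  /\ (nth 0 xs j \notin drop j.+1 xs) /\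
     (forall y X, y \in drop j.+1 xs -> X \in proj_sets g -> nth 0 xs j \in X -> y \in X).
Proof.
rewrite /xs /tab; elim: l ok_l j => //= -[x B] l' IH [[h1 h2 h3 h4] [h5 h6 h7]] [|j] /=.
  by rewrite !drop0.
by rewrite ltnS; apply: IH.
Qed.

Lemma uniq_elimination : uniq xs.
Proof. by rewrite /xs; elim: l ok_l => //= -[x B] l' IH [_ [-> _]] /IH. Qed.
End FromElimination.

(** A table sends its message to the table of the first later variable in its scope, an atom goes to
    the table of its first eliminated variable, and a variable is read off the first guard that
    contains it. The [hosted] conditions say that these tables are large enough. *)
Lemma valid_plan_exists : pghw_at_most g k -> exists m pl, valid_plan m pl.
Proof.
case/elimination_order => l [ok_l vars_l host_l].
set xs := unzip1 l in vars_l; set m := size l.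
have sz : size xs = m by rewrite size_map.
pose tab j := (nth (0, fset0) l j).2.
have uxs : uniq xs := uniq_elimination ok_l.
have [gu hgu] : exists f : nat -> seq {fset nat}, forall j, j < m ->
    [/\ size (f j) <= k, {subset f j <= hyperedges g}
      & {subset tab j <= \bigcup_(E <- f j) E}%fset].
  apply: (@finite_choice _ [::] (fun j s => [/\ size s <= k, {subset s <= hyperedges g}
      & {subset tab j <= \bigcup_(E <- s) E}%fset])) => j.
  by move=> /(elimination_at ok_l)[[_ _ [s hs] _] _]; exists s.
pose idx x := index x xs.
pose slot' j v := find (fun E : {fset nat} => nth 0 xs v \in E) (gu j).
pose guard' j s := index (nth fset0 (gu j) s) (map (@atom_vars Const) (body g)).
pose terms a := (nth (0, [::]) (body g) a).2.
pose pos' a x := find (fun t : term Const => if t is inl y then y == x else false) (terms a).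
(* A failing [find] returns the length of the list. In fields 2 and 3 this is the intended default:
   a table or an atom with no variable left goes to the root [m]. *)
pose pl f j v :=
  match f with
  | 0 => nth 0 xs j
  | 1 => ((j < m) && (v < m) && (nth 0 xs v \in tab j) : nat)
  | 2 => j.+1 + find (fun x => x \in tab j) (drop j.+1 xs)
  | 3 => find (fun x => x \in nth fset0 (map (@atom_vars Const) (body g)) j) xs
  | 4 => guard' j v
  | 5 => slot' j v
  | 6 => pos' (guard' j (slot' j v)) (nth 0 xs v)
  | _ => if term_at j v is Some (inl x) then idx x else 0
  end.
have scopeE j v : j < m -> v < m -> scope pl j v = (nth 0 xs v \in tab j).
  by rewrite /scope /pl => -> ->; case: (_ \in _).
have later j v : j < m -> v < m -> (nth 0 xs v \in drop j.+1 xs) = (j < v).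
  move=> jm vm; rewrite -[xs in nth _ xs](cat_take_drop j.+1) nth_cat.
  rewrite size_take sz; case: (ltnP j.+1 m) => hj.
    case: ltnP => hv; last by rewrite mem_nth ?hv // size_drop sz; lia.
    move: uxs; rewrite -[xs in uniq xs](cat_take_drop j.+1) cat_uniq => /and3P[_ /hasPn dis _].
    by apply/negbTE/negP => /dis; rewrite /= mem_nth ?size_take ?sz ?hj.
  rewrite [drop _ _]drop_oversize ?sz // in_nil; apply/esym/negbTE; lia.
have tab_ge j v : j < m -> v < m -> nth 0 xs v \in tab j -> j <= v.
  move=> jm vm; have [[_ sub _ _] _] := elimination_at ok_l jm.
  move=> /sub; rewrite inE nth_uniq ?sz // => /orP[/eqP->//|].
  by rewrite later // => /ltnW.
have atom_term a x : a < size (body g) ->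
    x \in nth fset0 (map (@atom_vars Const) (body g)) a ->
    term_at a (pos' a x) = Some (inl x).
  move=> ab; rewrite (nth_map (0, [::])) // => xa.
  have h : has (fun t : term Const => if t is inl y then y == x else false) (terms a).
    move: xa; rewrite /atom_vars inE mem_pmap => /mapP[[y|c] // yt [->]].
    by apply/hasP; exists (inl y) => //=.
  have := nth_find (inl 0) h; rewrite has_find in h.
  rewrite /term_at /pos'; have := onthTE (body g) a; rewrite ab.
  case ea: (onth _ _) => [al|] //= _; rewrite /terms (@onth_nth _ (0, [::]) al _ _ ea) in h *.
  have := onthTE al.2 (find (fun t : term Const => if t is inl y then y == x else false) al.2).
  rewrite h; case ep: (onth _ _) => [t|] // _; rewrite (@onth_nth _ (inl 0) t _ _ ep).
  by case: t {ep} => // y /eqP->.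
exists m, pl; apply/andP; split.
  apply/allP => j; rewrite mem_iota add0n => /= jm.
  have [[x_in sub cov hst] [nin lev]] := elimination_at ok_l jm.
  have par_le : parent pl j < m.+1.
    rewrite /parent /pl; have := find_size (fun x => x \in tab j) (drop j.+1 xs).
    rewrite size_drop sz; move: jm; clear; lia.
  apply/and5P; split=> //.
  - by rewrite scopeE.
  - by rewrite /parent /pl leq_addr.
  - by rewrite /scope /pl ltnn.
  apply/allP => v; rewrite mem_iota add0n => /= vm; apply/andP; split; apply/implyP.
    rewrite scopeE // => xv; apply/and4P; split.
    - by rewrite -leqNgt tab_ge.
    - apply/implyP => vj.
      have xE : nth 0 xs v \in (tab j `\ nth 0 xs j)%fset.
        by rewrite !inE xv andbT nth_uniq ?sz.
      case: (hosted_find hst) => [[lt_i sE]|E0]; last by rewrite E0 inE in xE.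
      have ei : parent pl j = j.+1 + find (fun x => x \in (tab j `\ nth 0 xs j)%fset)
                                          (unzip1 (drop j.+1 l)).
        rewrite /parent /pl /unzip1 map_drop; congr (_ + _); apply: eq_in_find => x xd.
        by rewrite !inE; case: eqP => // ex; rewrite ex (negbTE nin) in xd.
      have pm : parent pl j < m by rewrite ei -ltn_subRL; move: lt_i; rewrite size_drop.
      by rewrite scopeE // /tab ei -nth_drop; apply: sE.
    - have [size_le _ cover] := hgu _ jm; apply: leq_trans size_le.
      rewrite /slot /pl /slot' -has_find; have /bigfcupP[E] := cover _ xv.
      by rewrite andbT => EP xE; apply/hasP; exists E.
    - have [_ sH cover] := hgu _ jm; have /bigfcupP[E] := cover _ xv; rewrite andbT => EP xE.
      have h : has (fun E : {fset nat} => nth 0 xs v \in E) (gu j) by apply/hasP; exists E.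
      have xs' := nth_find fset0 h; rewrite has_find in h.
      set E' := nth fset0 (gu j) (slot' j v) in xs'.
      have E'H : E' \in map (@atom_vars Const) (body g).
        have : E' \in hyperedges g by apply: sH; apply: mem_nth.
        by rewrite /hyperedges inE.
      apply/eqP; apply: atom_term.
        by rewrite /guard_atom /pl /guard' /slot -/E' -(size_map (@atom_vars Const)) index_mem.
      by rewrite /guard_atom /pl /guard' /slot -/E' nth_index.
  move=> vj; have [_ [_ lev']] := elimination_at ok_l vm.
  rewrite /var_at /pl nth_uniq ?sz // neq_ltn vj -leqNgt /=.
  by apply: level_homo => X; apply: lev'; rewrite later.
apply/allP => a; rewrite mem_iota add0n => /= ab.
have ea : nth fset0 (map (@atom_vars Const) (body g)) a \in map (@atom_vars Const) (body g).
  by rewrite mem_nth ?size_map.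
apply/andP; split.
  by rewrite ltnS /host /pl -sz find_size.
apply/allP => p _; rewrite /valid_term; case et: (term_at a p) => [[x|//]|//].
have xa : x \in nth fset0 (map (@atom_vars Const) (body g)) a.
  move: et; rewrite /term_at; have := onthTE (body g) a; rewrite ab.
  case eal: (onth _ _) => [al|] //= _ ep.
  rewrite (nth_map (0, [::])) // (@onth_nth _ (0, [::]) al _ _ eal) /atom_vars inE mem_pmap.
  by apply/mapP; exists (inl x) => //; apply/onthP; exists p.
have x_xs : x \in xs.
  by rewrite vars_l; have /mapP[al alq e] := ea; apply/bigfcupP; exists al; rewrite ?alq // -e.
have im : idx x < m by rewrite -sz index_mem.
have hst : hosted l (nth fset0 (map (@atom_vars Const) (body g)) a).
  by apply: host_l; rewrite /hyperedges inE.
rewrite /term_var /pl et im /var_at /= nth_index // eqxx /=.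
case: (hosted_find hst) => [[lt_i sE]|E0]; last by rewrite E0 inE in xa.
by rewrite scopeE // /idx nth_index //; apply: sE.
Qed.
End Plans.

(** * Coding plans by numbers *)

(* Walks through all pairs of numbers, one antidiagonal after the other. *)
Definition unpair_step (ab : nat * nat) : nat * nat :=
  if ab.1 is a.+1 then (a, ab.2.+1) else (ab.2.+1, 0).

Definition unpair n := iter n unpair_step (0, 0).

(** The walk moves down an antidiagonal from its corner [(s, 0)], so it is enough to see that all
    corners are reached. *)
Lemma unpair_surj a b : exists n, unpair n = (a, b).
Proof.
have walk n c x y : unpair n = (x + c, y) -> unpair (n + c) = (x, y + c).
  elim: c x y => [|c IH] x y; first by rewrite !addn0.
  rewrite addnS => e; have := IH x.+1 y; rewrite addSn => /(_ e) {e}.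
  by rewrite addnS /unpair iterS => ->; rewrite /= addnS.
suff corner s : exists n, unpair n = (s, 0).
  by have [n hn] := corner (a + b); exists (n + b); rewrite (walk _ _ a 0).
elim: s => [|s [n hn]]; first by exists 0.
exists (n + s).+1; rewrite /unpair iterS.
suff gen c x : c <= s -> x = s - c -> iter (n + c) unpair_step (0, 0) = (x, c).
  by rewrite (gen s 0) // subnn.
elim: c x => [|c IH] x le_c ->; first by rewrite addn0 subn0.
rewrite addnS iterS (IH (s - c)) ?(ltnW le_c) //.
by case e : (s - c) => [|y]; [lia | rewrite /unpair_step /=; congr pair; lia].
Qed.

(** A number is read as an infinite sequence by splitting off first components forever; any finite
    initial segment can be prescribed. *)
Definition decode n i := (unpair (iter i (fun c => (unpair c).2) n)).1.

Lemma decode_surj (f : nat -> nat) b : exists n, forall i, i < b -> decode n i = f i.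
Proof.
elim: b f => [|b IH] f; first by exists 0.
have [n' hn'] := IH (fun i => f i.+1); have [n hn] := unpair_surj (f 0) n'.
exists n => -[|i] ib; first by rewrite /decode /= hn.
by rewrite -hn' // /decode iterSr hn.
Qed.

Definition decode3 n f j i := decode (decode (decode n f) j) i.

Lemma decode3_surj (F : nat -> nat -> nat -> nat) b : exists n, forall f j i,
  f < b -> j < b -> i < b -> decode3 n f j i = F f j i.
Proof.
have [h1 hh1] : exists h : nat -> nat -> nat, forall f, f < b -> forall j, j < b ->
    forall i, i < b -> decode (h f j) i = F f j i.
  apply: (@finite_choice _ (fun=> 0) (fun f h => forall j, j < b -> forall i, i < b ->
            decode (h j) i = F f j i)) => f fb.
  by apply: (@finite_choice _ 0 (fun j n => forall i, i < b -> decode n i = F f j i)) => j _;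
    apply: decode_surj.
have [h2 hh2] : exists h : nat -> nat, forall f, f < b -> forall j, j < b ->
    decode (h f) j = h1 f j.
  by apply: (@finite_choice _ 0 (fun f n => forall j, j < b -> decode n j = h1 f j)) => f _;
    apply: decode_surj.
have [n hn] := decode_surj h2 b.
by exists n => f j i fb jb ib; rewrite /decode3 hn // hh2 // hh1.
Qed.

(** * Partial annotations *)

(* [None] stands for the absence of an answer; it is a zero of the semiring, even
   if the annotation domain has a zero of its own. *)
Section PartialAnnotations.
Variable K : Type.
Implicit Types p t : cmonoid K.

Definition omul t (a b : option K) : option K :=
  if a is Some x then if b is Some y then Some (t x y) else None else None.

Definition oadd p (a b : option K) : option K :=
  match a, b with Some x, Some y => Some (p x y) | None, _ => b | _, None => a end.

Lemma omulA t : associative (omul t).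
Proof. by move=> [x|] [y|] [z|] //=; rewrite Monoid.mulmA. Qed.
Lemma omulC t : commutative (omul t).
Proof. by move=> [x|] [y|] //=; rewrite Monoid.mulmC. Qed.
Lemma omul1 t : left_id (Some (munit t)) (omul t).
Proof. by move=> [x|] //=; rewrite Monoid.mul1m. Qed.
HB.instance Definition _ t :=
  Monoid.isComLaw.Build (option K) (Some (munit t)) (omul t) (@omulA t) (@omulC t) (@omul1 t).

Lemma oaddA p : associative (oadd p).
Proof. by move=> [x|] [y|] [z|] //=; rewrite Monoid.mulmA. Qed.
Lemma oaddC p : commutative (oadd p).
Proof. by move=> [x|] [y|] //=; rewrite Monoid.mulmC. Qed.
Lemma oadd0 p : left_id None (oadd p).
Proof. by case. Qed.
HB.instance Definition _ p :=
  Monoid.isComLaw.Build (option K) None (oadd p) (@oaddA p) (@oaddC p) (@oadd0 p).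

Lemma omul0 t a : omul t a None = None.
Proof. by case: a. Qed.

(** The empty sum is [None], which absorbs by construction; sums with present terms are governed by
    distributivity in [K]. *)
Lemma omul_sum p t I (s : seq I) (F : I -> option K) a : right_distributive t p ->
  \big[oadd p/None]_(i <- s) omul t a (F i) = omul t a (\big[oadd p/None]_(i <- s) F i).
Proof.
move=> dist; elim: s => [|i s IH]; first by rewrite !big_nil omul0.
rewrite !big_cons IH; case: a {IH} => [x|] //.
by case: (F i) => [y|]; case: (bigop _ _ _) => [z|] //=; rewrite dist.
Qed.

Lemma omul_prod_some t I (s : seq I) (P : pred I) (F : I -> option K) :
  isSome (\big[omul t/Some (munit t)]_(i <- s | P i) F i) = all (fun i => P i ==> isSome (F i)) s.
Proof.
elim: s => [|i s IH]; first by rewrite big_nil.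
rewrite big_cons /=; case: (P i) => //=; rewrite -IH.
by case: (F i) => [y|] //=; case: (bigop _ _ _).
Qed.

Lemma oadd_sum_some p I (s : seq I) (P : pred I) (F : I -> option K) :
  isSome (\big[oadd p/None]_(i <- s | P i) F i) = has (fun i => P i && isSome (F i)) s.
Proof.
elim: s => [|i s IH]; first by rewrite big_nil.
rewrite big_cons /=; case: (P i) => //=; rewrite -IH.
by case: (F i) => [y|] //=; case: (bigop _ _ _).
Qed.

(** The bridge to [project], whose sum runs over a non-empty list of existing answers and starts
    from the unit of [K]. *)
Lemma oadd_sumE p I (s : seq I) (F : I -> option K) :
  let present := pmap (fun i => omap (pair i) (F i)) s in
  \big[oadd p/None]_(i <- s) F i =
  if present is [::] then None else Some (\big[p/munit p]_(q <- present) q.2).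
Proof.
elim: s => [|i s /= IH]; first by rewrite big_nil.
rewrite big_cons IH; case: (F i) => [x|] //=.
by case: (pmap _ s) => [|q qs]; rewrite /= !big_cons ?big_nil ?Monoid.mulm1.
Qed.
End PartialAnnotations.

(** * Tables *)

Lemma prod_single (K : Type) (t : cmonoid K) (s : seq nat) x y : uniq s -> x \in s ->
  \big[omul t/Some (munit t)]_(j <- s) (if x == j then y else Some (munit t)) = y.
Proof.
move=> us xs; rewrite (bigD1_seq x) //= eqxx big1 => [|j]; first by rewrite omulC omul1.
by rewrite eq_sym => /negbTE->.
Qed.

Lemma seq_nonempty (T : eqType) (s : seq T) : {x | x \in s} + {forall x, (x \in s) = false}.
Proof. by case: s => [|x s]; [right | left; exists x; rewrite mem_head]. Qed.

Lemma In_pmap_pair (T : eqType) (V : Type) (F : T -> option V) s q :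
  List.In q (pmap (fun x => omap (pair x) (F x)) s) <-> q.1 \in s /\ F q.1 = Some q.2.
Proof.
case: q => y v; elim: s => [|x s IH] /=; first by split=> // -[].
rewrite inE; case e : (F x) => [w|] /=.
  split=> [[[<- <-]|/IH[-> ->]]|[/orP[/eqP h|h] h']]; rewrite ?eqxx ?orbT //.
    by left; move: h'; rewrite h e => -[->].
  by right; apply/IH.
split=> [/IH[-> ->]|[/orP[/eqP h|h] h']]; rewrite ?orbT //; first by rewrite -h h' in e.
by apply/IH.
Qed.

Lemma NoDup_pmap_pair (T : eqType) (V : Type) (F : T -> option V) s :
  uniq s -> List.NoDup (pmap (fun x => omap (pair x) (F x)) s).
Proof.
elim: s => [|x s IH] /=; first by constructor.
case/andP => nx /IH nd; case e : (F x) => [v|] //=; constructor=> //.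
by move/In_pmap_pair => /= [xs _]; rewrite xs in nx.
Qed.

(** Stated for [Permutation] because annotations, and hence pairs containing them, have no decidable
    equality. *)
Lemma big_Permutation (I V : Type) (p : cmonoid V) (F : I -> V) s s' :
  Permutation.Permutation s s' ->
  \big[p/munit p]_(q <- s) F q = \big[p/munit p]_(q <- s') F q.
Proof.
elim=> [//|x l l' _ IH|x y l|l1 l2 l3 _ -> _ ->] //; rewrite !big_cons ?IH //.
by rewrite Monoid.mulmCA.
Qed.

(* [o] is the successor of the last element of [l]. *)
Fixpoint successive (T : eqType) (next : T -> option T) (l : seq T) (o : option T) : bool :=
  if l is x :: l' then (next x == if l' is y :: _ then Some y else o) && successive next l' o
  else true.

Lemma successive_cat (T : eqType) (next : T -> option T) l1 l2 o :
  successive next (l1 ++ l2) o = successive next l1 (if l2 is y :: _ then Some y else o) && successive next l2 o.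
Proof.
by elim: l1 => //= x l1 IH; rewrite IH andbA; case: l1 {IH}.
Qed.

Lemma successive_sorted (l : seq nat) : sorted ltn l ->
  successive (fun r => ohead [seq r' <- l | r < r']) l None.
Proof.
(* The prefix [l0] holds the elements already passed. Being smaller, they never count as
   successors. *)
suff gen l0 : sorted ltn (l0 ++ l) -> successive (fun r => ohead [seq r' <- l0 ++ l | r < r']) l None.
  by apply: (gen [::]).
elim: l l0 => //= x l IH l0 srt; rewrite -cat_rcons in srt.
have {}IH := IH _ srt; rewrite cat_rcons in IH srt; rewrite IH andbT.
have := srt; rewrite (sorted_pairwise ltn_trans) pairwise_cat /= => /and3P[/allrelP h _ /andP[/allP hx _]].
rewrite filter_cat /= ltnn (_ : [seq r' <- l0 | x < r'] = [::]) /=; last first.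
  apply/eqP; rewrite -[_ == _]negbK -has_filter; apply/hasPn => y yl.
  by rewrite -leqNgt ltnW // h ?mem_head.
case: l hx {IH srt h} => //= y l hx; by rewrite hx ?mem_head.
Qed.

Section Tables.
Variables (Const : eqType) (g : query Const).
Variables (D : seq (fact Const)) (nu : fact Const -> carrier g) (k m : nat).
Variable pl : nat -> nat -> nat -> nat.
Local Notation K := (carrier g).
Local Notation "1" := (Some (munit (times g))).
Local Notation "a ** b" := (omul (times g) a b) (at level 40, left associativity).
Local Notation var_at := (var_at pl).
Local Notation scope := (scope pl).
Local Notation parent := (parent pl).
Local Notation host := (host pl).
Implicit Types s : nat -> option Const.

Definition row_number := size D ^ k.

(** A row number is a choice of [k] facts, written in base [size D]. *)
Definition digit r i := iter i (fun c => c %/ size D) r %% size D.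

(** Whether the chosen fact matches the guard atom is not tested. The rows only have to include
    every assignment that satisfies the body ([full_candidate]), since each atom is tested in the
    table that hosts it. *)
Definition row j r v : option Const :=
  obind (fun phi : fact Const => onth phi.2 (slot_pos pl j v))
    (onth D (digit r (slot pl j v))).

Definition agree_on (S : pred nat) s s' : bool :=
  all (fun v => S v ==> (s v == s' v)) (iota 0 m).

(** Different choices of facts may give the same row; keeping only the first one lets a sum over
    rows count each assignment once. *)
Definition duplicate j r : bool :=
  has (fun r' => (r' < r) && agree_on (scope j) (row j r') (row j r)) (iota 0 row_number).

Definition term_value s a p : option Const :=
  match term_at g a p with
  | Some (inl _) => s (term_var pl a p)
  | Some (inr c) => Some c
  | None => None
  end.

Definition fact_matches s a f : bool :=
  (omap (fun phi : fact Const => phi.1) (onth D f)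
     == omap (fun al : atom Const => al.1) (onth (body g) a)) &&
  all (fun p => obind (fun phi : fact Const => onth phi.2 p) (onth D f)
                  == term_value s a p) (iota 0 (max_arity g)).

Definition atom_value s a : option K :=
  iteri (size D)
    (fun f acc => if fact_matches s a f then omap nu (onth D f) else acc) None.

Definition lower j v := scope j v && (v != j).

Definition free j := level g (var_at j) == size (proj_sets g).

(** A variable kept by exactly [l] projections is summed out by the next one, at 0-based position
    [l]. The default value is reached by free variables only. *)
Definition op_at j : cmonoid K :=
  nth (times g) [seq p.2 | p <- projections g] (level g (var_at j)).

Variable wt : nat -> nat -> option K.

Definition matching j s : seq nat :=
  [seq r <- iota 0 row_number | isSome (wt j r) && agree_on (lower j) (row j r) s].

Definition message s j : option K :=
  if free j then if matching j s is [::] then None else 1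
  else \big[oadd (op_at j)/None]_(r <- matching j s) wt j r.

Definition weight j s : option K :=
  (\big[omul (times g)/1]_(a <- iota 0 (size (body g)) | host a == j) atom_value s a)
  ** (\big[omul (times g)/1]_(i <- iota 0 m | parent i == j) message s i).

(** A specification by recursion equations. Correctness of the enumeration is derived from these
    equations for an arbitrary [wt]; a solution is constructed later. As the root has no variables,
    any [s] gives the same root weight. *)
Definition is_table : Prop :=
  (forall j r, j < m -> r < row_number ->
     wt j r = if duplicate j r || (row j r j == None) then None else weight j (row j r))
  /\ exists s, wt m 0 = weight m s.

Hypothesis query_ok : semiring_query g.
Hypothesis database_ok : database_over (qschema g) D.
Hypothesis plan_ok : valid_plan g k m pl.
Hypothesis table_ok : is_table.

Lemma valid_tableP j : j < m ->
  [/\ scope j j, j < parent j <= m, ~~ scope m j &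
    forall v, v < m -> valid_var g k pl j v].
Proof.
move=> jm; case/andP: plan_ok => /allP/(_ j) + _.
rewrite mem_iota add0n jm => /(_ isT)/and5P[-> h1 h2 -> /allP h3].
split=> //; first by rewrite h1 -ltnS h2.
by move=> v vm; apply: h3; rewrite mem_iota.
Qed.

Lemma valid_scope j v : j < m -> v < m -> scope j v ->
  [/\ j <= v, v != j -> scope (parent j) v, slot pl j v < k &
   term_at g (guard_atom pl j (slot pl j v)) (slot_pos pl j v) = Some (inl (var_at v))].
Proof.
move=> jm vm sv; have [_ _ _ /(_ v vm)/andP[/implyP/(_ sv)/and4P[h1 /implyP h2 h3 /eqP h4] _]] :=
  valid_tableP jm.
by rewrite leqNgt.
Qed.

Lemma scope_ge j v : j <= m -> v < m -> scope j v -> j <= v.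
Proof.
rewrite leq_eqVlt => /orP[/eqP-> vm|jm vm /(valid_scope jm vm)[]//].
by have [_ _ /negbTE->] := valid_tableP vm.
Qed.

Lemma var_at_inj i j : i < m -> j < m -> var_at i = var_at j -> i = j.
Proof.
move=> im jm e; case: (ltngtP i j) => // h.
  have [_ _ _ /(_ i im)/andP[_]] := valid_tableP jm.
  by rewrite h /= e eqxx.
have [_ _ _ /(_ j jm)/andP[_]] := valid_tableP im.
by rewrite h /= e eqxx.
Qed.

Lemma level_sorted i j : i <= j -> j < m -> level g (var_at i) <= level g (var_at j).
Proof.
rewrite leq_eqVlt => /orP[/eqP->//|ij] jm.
have [_ _ _ /(_ i (ltn_trans ij jm))/andP[_]] := valid_tableP jm.
by rewrite ij /= -leqNgt => /andP[].
Qed.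

Lemma valid_atomP a : a < size (body g) -> host a <= m /\
  forall p x, p < max_arity g -> term_at g a p = Some (inl x) ->
    [/\ term_var pl a p < m, var_at (term_var pl a p) = x & scope (host a) (term_var pl a p)].
Proof.
move=> ab; case/andP: plan_ok => _ /allP/(_ a); rewrite mem_iota ab => /(_ isT)/andP[h1 /allP h2].
split; first by rewrite -ltnS.
move=> p x pa e; have := h2 p; rewrite mem_iota pa => /(_ isT).
by rewrite /valid_term e => /and3P[-> /eqP-> ->].
Qed.

Lemma agree_onP (S : pred nat) s s' :
  reflect (forall v, v < m -> S v -> s v = s' v) (agree_on S s s').
Proof.
apply: (iffP allP) => h v; first by move=> vm Sv; have := h v; rewrite mem_iota Sv => /(_ vm)/eqP.
by rewrite mem_iota add0n => /= vm; apply/implyP => Sv; rewrite h.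
Qed.

Lemma agree_on_eq (S : pred nat) s1 s2 s3 : agree_on S s2 s3 -> agree_on S s1 s2 = agree_on S s1 s3.
Proof.
by move=> /agree_onP h; apply/agree_onP/agree_onP => h' v vm Sv; rewrite h' ?h.
Qed.

Lemma agree_on_sub (S S' : pred nat) s s' :
  (forall v, v < m -> S' v -> S v) -> agree_on S s s' -> agree_on S' s s'.
Proof. by move=> h /agree_onP a; apply/agree_onP => v vm Sv; apply: a; rewrite ?h. Qed.

Lemma body_fits a al : onth (body g) a = Some al -> onth (qschema g) al.1 = Some (size al.2).
Proof.
move=> e; case: query_ok => /and3P[_ /allP h _] _; apply/eqP; apply: (h al).
by apply/onthP; exists a.
Qed.

Lemma facts_fit f phi : onth D f = Some phi -> onth (qschema g) phi.1 = Some (size phi.2).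
Proof.
move=> e; case/andP: database_ok => _ /allP h; apply/eqP; apply: (h phi).
by apply/onthP; exists f.
Qed.

Lemma arity_le r n : onth (qschema g) r = Some n -> n <= max_arity g.
Proof.
rewrite /max_arity; elim: (qschema g) r => [|x s IH] [|r] //=.
  by case=> ->; apply: leq_addr.
by move/IH => h; apply: leq_trans h (leq_addl _ _).
Qed.

Lemma term_value_dep s s' a p : p < max_arity g -> a < size (body g) ->
  agree_on (scope (host a)) s s' -> term_value s a p = term_value s' a p.
Proof.
move=> pa ab /agree_onP h; rewrite /term_value; case e: (term_at _ _ _) => [[x|]|] //.
by have [_ /(_ p x pa e)[tm _ ts]] := valid_atomP ab; apply: h.
Qed.

Lemma atom_value_dep s s' a : a < size (body g) ->
  agree_on (scope (host a)) s s' -> atom_value s a = atom_value s' a.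
Proof.
move=> ab h; rewrite /atom_value; apply: eq_iteri => f acc; congr (if _ then _ else _).
congr andb; apply: eq_in_all => p; rewrite mem_iota add0n => /= pa.
by rewrite (term_value_dep pa ab h).
Qed.

Lemma matching_dep j s s' : agree_on (lower j) s s' -> matching j s = matching j s'.
Proof. by move=> h; apply: eq_filter => r; rewrite (agree_on_eq _ h). Qed.

Lemma message_dep j s s' : agree_on (lower j) s s' -> message s j = message s' j.
Proof. by move=> h; rewrite /message (matching_dep h). Qed.

Lemma lower_parent j v : j < m -> v < m -> lower j v -> scope (parent j) v.
Proof. by move=> jm vm /andP[sv nv]; have [_ h _ _] := valid_scope jm vm sv; apply: h. Qed.

Lemma weight_dep j s s' : agree_on (scope j) s s' -> weight j s = weight j s'.
Proof.
move=> h; congr omul; rewrite big_seq_cond [RHS]big_seq_cond; apply: eq_bigr => i.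
  rewrite mem_iota add0n => /andP[/= ib /eqP hi]; apply: atom_value_dep => //; by rewrite hi.
rewrite mem_iota add0n => /andP[/= im /eqP pi]; apply: message_dep.
by apply: agree_on_sub h => v vm /(lower_parent im vm); rewrite pi.
Qed.

Definition domain : seq Const := undup (flatten [seq phi.2 | phi <- D]).

Lemma row_domain j r v c : row j r v = Some c -> c \in domain.
Proof.
rewrite /row; case e: (onth _ _) => [phi|] //= e'; rewrite mem_undup.
apply/flatten_mapP; exists phi; first by apply/onthP; eexists; exact: e.
by apply/onthP; eexists; exact: e'.
Qed.

(* Whether [s] is a row of table [j], ignoring the weights. *)
Definition candidate j s : bool :=
  (j == m) || has (fun r => agree_on (scope j) (row j r) s) (iota 0 row_number) && isSome (s j).

Lemma candidate_row j s : j < m -> candidate j s ->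
  exists r, [/\ r < row_number, agree_on (scope j) (row j r) s, ~~ duplicate j r
    & row j r j = s j].
Proof.
move=> jm; rewrite /candidate ltn_eqF //= => /andP[/hasP[r0 h0 a0] _].
have ex : exists r, (r < row_number) && agree_on (scope j) (row j r) s.
  by exists r0; rewrite a0 andbT; rewrite mem_iota in h0.
case: (ex_minnP ex) => r /andP[rn ra] rmin; exists r; split=> //; last first.
  by have [jj _ _ _] := valid_tableP jm; apply: (agree_onP _ _ _ ra).
apply/hasPn => r'; rewrite mem_iota add0n => /= rn'; apply/negP => /andP[lt_r ra'].
by have := rmin r'; rewrite rn' -(agree_on_eq _ ra) ra' => /(_ isT); rewrite leqNgt lt_r.
Qed.

Lemma candidate_dep j s s' : j < m -> agree_on (scope j) s s' -> candidate j s = candidate j s'.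
Proof.
move=> jm h; have [jj _ _ _] := valid_tableP jm.
rewrite /candidate (agree_onP _ _ _ h) //; congr (_ || _ && _).
by apply: eq_has => r; rewrite (agree_on_eq _ h).
Qed.

Definition set_var s j c : nat -> option Const := fun v => if v == j then Some c else s v.

Definition cond (b : bool) : option K := if b then 1 else None.

Definition row_weight j s : option K := cond (candidate j s) ** weight j s.

Lemma row_weight_dep j s s' : j < m -> agree_on (scope j) s s' ->
  row_weight j s = row_weight j s'.
Proof. by move=> jm h; rewrite /row_weight (candidate_dep jm h) (weight_dep h). Qed.

Lemma wt_some j r : j < m -> r < row_number -> isSome (wt j r) ->
  [/\ ~~ duplicate j r, isSome (row j r j) & wt j r = weight j (row j r)].
Proof.
move=> jm rn; rewrite table_ok.1 //; case: (duplicate j r) => //=.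
by case: (row j r j) => //= c; case: (_ == _) => // ->.
Qed.

Lemma wt_candidate j r s : j < m -> r < row_number -> ~~ duplicate j r ->
  agree_on (scope j) (row j r) s -> candidate j s -> wt j r = row_weight j s.
Proof.
move=> jm rn nd ra cs; rewrite table_ok.1 // (negbTE nd) /row_weight cs /cond omul1 /=.
have [jj _ _ _] := valid_tableP jm.
rewrite (agree_onP _ _ _ ra) // (weight_dep ra).
by move: cs; rewrite /candidate ltn_eqF //= => /andP[_]; case: (s j).
Qed.

Lemma matching_row j s r : j < m -> r \in matching j s ->
  exists2 c, c \in domain & [/\ row j r j = Some c,
    agree_on (scope j) (row j r) (set_var s j c), ~~ duplicate j r &
    wt j r = row_weight j (set_var s j c)].
Proof.
move=> jm; rewrite mem_filter mem_iota add0n => /andP[/andP[wr ar] rn].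
have [nd + ew] := wt_some jm rn wr; case ec: (row j r j) => [c|] // _.
have a' : agree_on (scope j) (row j r) (set_var s j c).
  apply/agree_onP => v vm sv; rewrite /set_var; case: eqVneq => [->//|nv].
  by apply: (agree_onP _ _ _ ar); rewrite // /lower sv.
exists c; first exact: row_domain ec.
split=> //; rewrite ew (weight_dep a') /row_weight.
suff -> : candidate j (set_var s j c) by rewrite /cond omul1.
rewrite /candidate /set_var eqxx andbT; apply/orP; right.
by apply/hasP; exists r; rewrite ?mem_iota.
Qed.

(** Without duplicates, sending a matching row to the value of its own variable is injective. A
    constant that is not hit gives no candidate row with a weight and contributes [None]. *)
Lemma matching_sum (p : cmonoid K) j s : j < m ->
  \big[oadd p/None]_(r <- matching j s) wt j r =
  \big[oadd p/None]_(c <- domain) row_weight j (set_var s j c).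
Proof.
move=> jm.
have [[c0 _]|dom0] := seq_nonempty domain; last first.
  rewrite !big1_seq // => [c|r] /andP[_]; first by rewrite dom0.
  by case/(matching_row jm) => c; rewrite dom0.
pose key r := odflt c0 (row j r j).
have -> : \big[oadd p/None]_(r <- matching j s) wt j r =
    \big[oadd p/None]_(c <- map key (matching j s)) row_weight j (set_var s j c).
  rewrite big_map; apply: eq_big_seq => r /(matching_row jm)[c _ [ec _ _ ->]].
  by rewrite /key ec.
rewrite [RHS](bigID (fun c => c \in map key (matching j s))) /=.
rewrite [X in oadd p _ X]big1_seq ?Monoid.mulm1 => [|c /andP[nc cd]]; last first.
  case ew : (row_weight _ _) => [w|] //; case/mapP: nc.
  have cs : candidate j (set_var s j c) by move: ew; rewrite /row_weight /cond; case: (candidate _ _).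
  have [r [rn ra nd er]] := candidate_row jm cs.
  have {}er : row j r j = Some c by rewrite er /set_var eqxx.
  exists r; last by rewrite /key er.
  rewrite mem_filter mem_iota add0n /= rn andbT (wt_candidate jm rn nd ra cs) ew /=.
  apply/agree_onP => v vm /andP[sv nv]; rewrite (agree_onP _ _ _ ra) //.
  by rewrite /set_var (negbTE nv).
rewrite -[RHS]big_filter; apply: perm_big; apply: uniq_perm.
- rewrite map_inj_in_uniq ?filter_uniq ?iota_uniq // => r r' hr hr'.
  have [c _ [ec ra nd _]] := matching_row jm hr; have [c' _ [ec' ra' nd' _]] := matching_row jm hr'.
  rewrite /key ec ec' /= => e; rewrite -{}e {c'} in ra' ec'.
  move: hr hr'; rewrite !mem_filter !mem_iota !add0n => /andP[_ /= rn] /andP[_ /= rn'].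
  case: (ltngtP r r') => // lt_r.
    by have /hasPn/(_ r) := nd'; rewrite mem_iota lt_r rn (agree_on_eq _ ra') ra => /(_ isT).
  by have /hasPn/(_ r') := nd; rewrite mem_iota lt_r rn' (agree_on_eq _ ra) ra' => /(_ isT).
- by rewrite filter_uniq // undup_uniq.
- move=> c; rewrite mem_filter andb_idr // => /mapP[r /(matching_row jm)[c' cd [ec _ _ _]] ->].
  by rewrite /key ec.
Qed.

(** Follows from [matching_sum], as a sum over [option] is [None] exactly if all its terms are;
    [times g] merely provides some operation to sum with. *)
Lemma matching_nil j s : j < m ->
  (matching j s == [::]) = ~~ has (fun c => isSome (row_weight j (set_var s j c))) domain.
Proof.
move=> jm; have e := oadd_sum_some (times g) domain predT (fun c => row_weight j (set_var s j c)).
rewrite /= in e; rewrite -e -(matching_sum (times g) s jm) oadd_sum_some /=.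
case em : (matching j s) => [|r rs] //=.
by have : r \in matching j s; [rewrite em mem_head | rewrite mem_filter => /andP[/andP[-> _] _]].
Qed.

(** * Variable elimination compared with exhaustive summation *)

Definition full s : option K :=
  \big[omul (times g)/1]_(a <- iota 0 (size (body g))) atom_value s a.

Lemma atom_value_some s a : isSome (atom_value s a) ->
  exists f phi, [/\ f < size D, onth D f = Some phi & fact_matches s a f].
Proof.
rewrite /atom_value.
suff gen n : n <= size D -> isSome (iteri n
    (fun f acc => if fact_matches s a f then omap nu (onth D f) else acc) None) ->
    exists f phi, [/\ f < size D, onth D f = Some phi & fact_matches s a f].
  exact: (gen _ (leqnn _)).
elim: n => [//|n IH] lt_n /=; case: ifP => [fm _|_]; last exact: (IH (ltnW lt_n)).
by have := onthTE D n; rewrite lt_n; case e: (onth D n) => [phi|] // _; exists n, phi.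
Qed.

Lemma fact_matches_term s a f phi p t : fact_matches s a f -> onth D f = Some phi ->
  term_at g a p = Some t -> [/\ p < max_arity g, isSome (term_value s a p)
    & onth phi.2 p = term_value s a p].
Proof.
rewrite /fact_matches => /andP[+ /allP h] ef; rewrite ef /=.
move=> er; rewrite /term_at; case ea: (onth (body g) a) er => [al|] //= /eqP[er] ep.
have fa := body_fits ea; have ff := facts_fit ef; rewrite er fa in ff.
have pa : p < size al.2 by rewrite -onthTE ep.
have pm : p < max_arity g by apply: leq_trans pa (arity_le fa).
have := h p; rewrite mem_iota pm => /(_ isT); rewrite ef /= => /eqP e.
by split=> //; rewrite -e onthTE; case: ff => <-.
Qed.

Lemma digits_surj (f : nat -> nat) n : (forall i, i < n -> f i < size D) ->
  exists2 r, r < size D ^ n & forall i, i < n -> digit r i = f i.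
Proof.
elim: n f => [|n IH] f h; first by exists 0.
have [|r rn hr] := IH (fun i => f i.+1); first by move=> i ni; apply: h.
have f0 := h 0 isT; exists (f 0 + r * size D).
  rewrite expnS; apply: (@leq_trans (r.+1 * size D)); last by rewrite mulnC leq_mul2l rn orbT.
  by rewrite mulSn ltn_add2r.
move=> [|i] lt_i; first by rewrite /digit /= addnC modnMDl modn_small.
by rewrite -hr // /digit iterSr addnC divnMDl ?(leq_ltn_trans _ f0) // divn_small // addn0.
Qed.

(** If all atoms hold under [s], then a fact matching the guard atom of each slot yields a row that
    reproduces [s] on the scope. *)
Lemma full_candidate s j : isSome (full s) -> j < m -> candidate j s.
Proof.
rewrite /full omul_prod_some => /allP full_s jm.
have [jj _ _ _] := valid_tableP jm.
have source v : v < m -> scope j v -> exists f phi, [/\ f < size D, onth D f = Some phi,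
    fact_matches s (guard_atom pl j (slot pl j v)) f, isSome (s v)
    & onth phi.2 (slot_pos pl j v) = s v].
  move=> vm sv; have [_ _ slot_k et] := valid_scope jm vm sv.
  set a := guard_atom pl j _ in et *.
  have ab : a < size (body g).
    by rewrite -onthTE; move: et; rewrite /term_at; case: (onth _ _).
  have := full_s a; rewrite mem_iota ab => /(_ isT)/atom_value_some[f [phi [fD ef fm]]].
  have [pa ts eo] := fact_matches_term fm ef et.
  have [_ /(_ _ _ pa et)[tm tv _]] := valid_atomP ab.
  have ev : term_var pl a (slot_pos pl j v) = v by apply: var_at_inj.
  have es : term_value s a (slot_pos pl j v) = s v by rewrite /term_value et ev.
  by exists f, phi; rewrite -es.
have [f0 [phi0 [f0D _ _ sj _]]] := source j jm jj.
(* One fact per slot, shared by all the variables read from that slot. A slot whose guard has no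
   matching fact gets [f0]; no variable of the scope is read from it. *)
pose chosen i := find (fun f => fact_matches s (guard_atom pl j i) f) (iota 0 (size D)).
pose f i := if chosen i < size D then chosen i else f0.
have [|r rn hr] := @digits_surj f k; first by move=> i _; rewrite /f; case: ifP.
rewrite /candidate sj andbT; apply/orP; right; apply/hasP; exists r; first by rewrite mem_iota.
apply/agree_onP => v vm sv; have [f1 [phi1 [f1D ef1 fm1 _ ev]]] := source v vm sv.
have [_ _ slot_k et] := valid_scope jm vm sv.
rewrite /row hr // /f.
have hs : has (fun f => fact_matches s (guard_atom pl j (slot pl j v)) f) (iota 0 (size D)).
  by apply/hasP; exists f1; rewrite ?mem_iota.
have fm := nth_find 0 hs; rewrite has_find size_iota in hs.
rewrite -/(chosen _) in fm hs *; rewrite hs nth_iota // add0n in fm *.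
have := onthTE D (chosen (slot pl j v)); rewrite hs.
case ef: (onth D _) => [phi|] // _ /=.
have [_ _ ->] := fact_matches_term fm ef et.
by have [_ _ <-] := fact_matches_term fm1 ef1 et; rewrite ev.
Qed.

(** The reference value: the variables below [c] are summed out over all constants of the database,
    the first of the elimination order innermost. *)
Fixpoint partial_value c s : option K :=
  if c is c.+1 then \big[oadd (op_at c)/None]_(x <- domain) partial_value c (set_var s c x)
  else full s.

(* The factor of table [j] when the variables below [c] are eliminated. *)
Definition factor c j s : option K :=
  cond (candidate j s)
  ** (\big[omul (times g)/1]_(a <- iota 0 (size (body g)) | host a == j) atom_value s a)
  ** (\big[omul (times g)/1]_(i <- iota 0 m | (i < c) && (parent i == j)) message s i).

Lemma factor_dep c j s s' : j <= m -> agree_on (scope j) s s' -> factor c j s = factor c j s'.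
Proof.
move=> jm h; have -> : factor c j s = factor c j s' ** 1; last by rewrite omulC omul1.
rewrite omulC omul1; congr omul; first congr omul.
- move: jm; rewrite leq_eqVlt => /orP[/eqP ej|jm]; first by rewrite /candidate ej eqxx.
  by rewrite (candidate_dep jm h).
- rewrite big_seq_cond [RHS]big_seq_cond; apply: eq_bigr => a.
  rewrite mem_iota add0n => /andP[/= ab /eqP ha]; apply: atom_value_dep => //; by rewrite ha.
- rewrite big_seq_cond [RHS]big_seq_cond; apply: eq_bigr => i.
  rewrite mem_iota add0n => /andP[/= im /andP[_ /eqP pi]]; apply: message_dep.
  by apply: agree_on_sub h => v vm /(lower_parent im vm); rewrite pi.
Qed.

Lemma factor_last j c s : j <= c -> factor c j s = cond (candidate j s) ** weight j s.
Proof.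
move=> jc; rewrite /factor -omulA; congr (_ ** (_ ** _)).
rewrite big_seq_cond [RHS]big_seq_cond; apply: eq_bigl => i.
rewrite mem_iota add0n /=; case im : (i < m) => //=.
case: eqP => [pi|]; last by rewrite andbF.
have [_ /andP[ip _] _ _] := valid_tableP im; rewrite andbT.
by apply: leq_trans jc; rewrite -pi.
Qed.

Lemma factorS c j s : c < m ->
  factor c.+1 j s = factor c j s ** (if parent c == j then message s c else 1).
Proof.
move=> cm; rewrite /factor -!omulA; congr (_ ** (_ ** _)).
rewrite -big_filter -[X in _ = X ** _]big_filter.
have split_iota : iota 0 m = iota 0 c ++ c :: iota c.+1 (m - c.+1).
  by rewrite -[in LHS](subnKC (ltnW cm)) iotaD add0n; case e: (m - c) => [|x];
     [lia | rewrite (_ : m - c.+1 = x) //; lia].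
rewrite split_iota !filter_cat /= ltnSn ltnn /=.
have none (Q : pred nat) : [seq i <- iota c.+1 (m - c.+1) | (i < c.+1) && Q i] = [::].
  apply/eqP; rewrite -[_ == _]negbK -has_filter; apply/hasPn => i.
  by rewrite mem_iota => /andP[ci _]; rewrite ltnNge ci.
have none' (Q : pred nat) : [seq i <- iota c.+1 (m - c.+1) | (i < c) && Q i] = [::].
  apply/eqP; rewrite -[_ == _]negbK -has_filter; apply/hasPn => i.
  by rewrite mem_iota => /andP[ci _]; rewrite ltnNge ltnW.
rewrite none none' cats0 big_cat /=; congr omul.
  rewrite !big_filter big_seq_cond [RHS]big_seq_cond; apply: eq_bigl => i.
  rewrite mem_iota add0n /=; case ic : (i < c) => //=; by rewrite ltnW.
by case: ifP => _; rewrite ?big_cons big_nil // omulC omul1.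
Qed.

Lemma level_le x : level g x <= size (proj_sets g).
Proof. by rewrite /level; elim: (size _) => //= n IH; case: ifP => // _; apply: leqW. Qed.

Lemma op_at_distr c : ~~ free c -> right_distributive (times g) (op_at c).
Proof.
move=> nf; have lt_l : level g (var_at c) < size [seq p.2 | p <- projections g].
  by rewrite size_map -(size_map (fun p => p.1)) ltn_neqAle nf level_le.
have [_ sr] := query_ok; rewrite /op_at.
have : List.In (nth (times g) [seq p.2 | p <- projections g] (level g (var_at c)))
               [seq p.2 | p <- projections g].
  elim: [seq _ | _ <- _] (level _ _) lt_l => //= x xs IH [|i] h; first by left.
  by right; apply: IH.
set o := nth _ _ _; have gen : forall ps, List.In o [seq p.2 | p <- ps] ->
    exists2 p, List.In p ps & p.2 = o.
  move=> A ps; elim: ps => //= p ps IH [e|/IH[q qs eq]]; [exists p | exists q] => //; by [left|right].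
by case/gen => p /sr [dist _] <-.
Qed.

(** The elimination identity. Among the tables from [c] on, only table [c] contains variable [c]
    ([scope_ge]), so the other factors leave the sum by distributivity, and what remains under it is
    the message that [c] sends to its parent. *)
Lemma value_factor c s : (forall j, j < c -> ~~ free j) -> c <= m ->
  partial_value c s = \big[omul (times g)/1]_(j <- iota c (m.+1 - c)) factor c j s.
Proof.
elim: c s => [|c IH] s nf cm.
  (* For [c = 0] there are no messages yet: the atoms are regrouped by host, and the candidate
     conditions can be added because [full] implies them. *)
  rewrite subn0 /partial_value /factor; set I := iota 0 m.+1.
  under eq_bigr => j _ do rewrite [X in _ ** X]big1 ?[_ ** 1]omulC ?omul1 //.
  rewrite big_split /=.
  under [X in _ ** X]eq_bigr => j _ do rewrite big_mkcond.
  rewrite exchange_big /=.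
  have -> : \big[omul (times g)/1]_(a <- iota 0 (size (body g))) \big[omul (times g)/1]_(j <- I)
      (if host a == j then atom_value s a else 1) = full s.
    rewrite /full big_seq [RHS]big_seq; apply: eq_bigr => a; rewrite mem_iota add0n => /= ab.
    have [hm _] := valid_atomP ab.
    have ha : host a \in iota 0 m.+1 by rewrite mem_iota.
    exact: (prod_single _ _ (iota_uniq 0 m.+1) ha).
  case ef : (full s) => [x|]; last by rewrite omul0.
  rewrite big1_seq ?omul1 // => j; rewrite mem_iota add0n ltnS => /andP[_ /=].
  rewrite /cond leq_eqVlt => /orP[/eqP->|jm]; first by rewrite /candidate eqxx.
  by rewrite full_candidate // ef.
(* Setting variable [c] affects only the factor of table [c]. *)
have step x : partial_value c (set_var s c x) =
    (\big[omul (times g)/1]_(j <- iota c.+1 (m - c)) factor c j s) ** factor c c (set_var s c x).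
  rewrite IH; [|by move=> j jc; apply: nf; apply: ltnW|exact: ltnW].
  rewrite subSn 1?ltnW //= big_cons omulC; congr omul.
  rewrite big_seq [RHS]big_seq; apply: eq_bigr => j; rewrite mem_iota => /andP[cj jm].
  have {}jm : j <= m by move: cj jm cm; clear; lia.
  apply: factor_dep => //; apply/agree_onP => v vm /(scope_ge jm vm) jv.
  by rewrite /set_var gtn_eqF // (leq_trans cj).
rewrite /=; under eq_bigr => x _ do rewrite step.
rewrite omul_sum; last by apply: op_at_distr; apply: nf.
rewrite subSS [RHS](eq_bigr _ (fun j _ => factorS j s cm)).
rewrite [RHS]big_split /=; congr omul.
have [_ /andP[cp pm] _ _] := valid_tableP cm.
rewrite prod_single ?iota_uniq ?mem_iota //; last by move: cp pm; clear; lia.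
rewrite /message (negbTE (nf _ (ltnSn _))) matching_sum //.
by apply: eq_bigr => x _; rewrite factor_last.
Qed.

Lemma value_dep c s s' : (forall v, v < m -> s v = s' v) -> partial_value c s = partial_value c s'.
Proof.
elim: c s s' => [|c IH] s s' h /=.
  rewrite /full big_seq [RHS]big_seq; apply: eq_bigr => a; rewrite mem_iota add0n => /= ab.
  by apply: atom_value_dep => //; apply/agree_onP => v vm _; apply: h.
apply: eq_bigr => x _; apply: IH => v vm; rewrite /set_var; case: eqP => // _; exact: h.
Qed.

Lemma value_candidate c s j : (forall j, j < c -> ~~ free j) -> c <= j < m ->
  isSome (partial_value c s) -> candidate j s.
Proof.
move=> nf /andP[cj jm]; rewrite value_factor ?(leq_trans cj (ltnW jm)) // omul_prod_some => /allP/(_ j).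
rewrite mem_iota cj /= subnKC; last by move: cj jm; clear; lia.
rewrite ltnS (ltnW jm) => /(_ isT); rewrite /factor /cond.
by case: (candidate j s).
Qed.

Lemma candidate_domain j s : j < m -> candidate j s -> exists2 x, x \in domain & s j = Some x.
Proof.
move=> jm cs; have [r [_ _ _ er]] := candidate_row jm cs.
move: cs; rewrite /candidate ltn_eqF //= => /andP[_]; case es: (s j) => [x|] // _.
by exists x => //; apply: (@row_domain j r j); rewrite er es.
Qed.

(* The variables from [first_at i] on are those kept by the first [i] projections. *)
Definition first_at i := find (fun j => i <= level g (var_at j)) (iota 0 m).

Lemma first_at_le i : first_at i <= m.
Proof. by rewrite -[m in _ <= m](size_iota 0) find_size. Qed.

Lemma leq_first_at i j : j < m -> (first_at i <= j) = (i <= level g (var_at j)).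
Proof.
move=> jm; apply/idP/idP => h.
  have fm : first_at i < m by apply: leq_ltn_trans jm.
  have hs : has (fun j => i <= level g (var_at j)) (iota 0 m) by rewrite has_find size_iota.
  have := nth_find 0 hs; rewrite nth_iota // add0n => h'.
  by apply: leq_trans h' _; apply: level_sorted.
rewrite leqNgt; apply/negP => lt_j.
by have := before_find 0 lt_j; rewrite nth_iota // add0n h.
Qed.

Lemma leq_first i i' : i <= i' -> first_at i <= first_at i'.
Proof.
move=> ii; case: (ltnP (first_at i') m) => [fm|]; last by apply: leq_trans (first_at_le _).
by rewrite leq_first_at // (leq_trans ii) // -leq_first_at.
Qed.

Definition first_free := first_at (size (proj_sets g)).

Lemma freeE j : j < m -> free j = (first_free <= j).
Proof. by move=> jm; rewrite leq_first_at // /free eqn_leq level_le. Qed.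

(** A free table only announces that some matching row exists. If [s] has a value, its own row is
    such a witness, so these messages can be inserted without changing the product, which turns
    every factor into a full row weight. *)
Lemma value_free s :
  partial_value first_free s =
  \big[omul (times g)/1]_(j <- iota first_free (m.+1 - first_free)) row_weight j s.
Proof.
have f_le := first_at_le (size (proj_sets g)); rewrite -/first_free in f_le.
rewrite value_factor //; last first.
  by move=> j jf; rewrite freeE -?ltnNge // (leq_trans jf).
set I := iota _ _.
(* Messages of free tables are inserted one at a time. If the product is absent it stays absent; if
   it is present, then so is the row weight of [c], and the value of [s] at [c] makes the message
   1. *)
have stable c : first_free <= c <= m ->
    \big[omul (times g)/1]_(j <- I) factor first_free j s
    = \big[omul (times g)/1]_(j <- I) factor c j s.
  elim: c => [|c IH]; first by rewrite leqn0 => /andP[/eqP->].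
  rewrite leq_eqVlt ltnS => /andP[/orP[/eqP->//|fc] cm].
  rewrite IH ?fc ?(ltnW cm) // [RHS](eq_bigr _ (fun j _ => factorS j s cm)) [RHS]big_split /=.
  case eP : (\big[_/_]_(j <- I) factor c j s) => [x|] //.
  have cI : c \in I by rewrite mem_iota fc subnKC; lia.
  have : isSome (factor c c s).
    have : isSome (\big[omul (times g)/1]_(j <- I) factor c j s) by rewrite eP.
    by rewrite omul_prod_some => /allP/(_ c cI).
  rewrite factor_last // -/(row_weight c s) => rw.
  have cs : candidate c s by move: rw; rewrite /row_weight /cond; case: (candidate c s).
  have [y yd ey] := candidate_domain cm cs.
  have em : message s c = 1.
    rewrite /message freeE // fc; case em : (matching c s == [::]); last by case: (matching c s) em.
    move: em; rewrite matching_nil // => /negP[]; apply/hasP; exists y => //.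
    rewrite -(@row_weight_dep c s) //; apply/agree_onP => v vm _.
    by rewrite /set_var; case: eqVneq => [->|].
  have [_ /andP[cp pm] _ _] := valid_tableP cm.
  by rewrite em prod_single ?iota_uniq ?mem_iota 1?[_ ** 1]omulC ?omul1 //; move: fc cp pm; clear; lia.
rewrite (stable m) ?leqnn ?andbT // big_seq [RHS]big_seq; apply: eq_bigr => j.
by rewrite mem_iota => /andP[fj jm]; rewrite factor_last //; move: fj jm f_le; clear; lia.
Qed.

(** * The semantics of the query as a partial value *)

Lemma term_query a p x : term_at g a p = Some (inl x) -> x \in query_vars g.
Proof.
rewrite /term_at; case ea: (onth _ _) => [al|] //= ep.
apply/bigfcupP; exists al; first by rewrite andbT; apply/onthP; exists a.
rewrite /atom_vars inE mem_pmap; apply/mapP; exists (inl x) => //.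
by apply/onthP; exists p.
Qed.

Lemma query_varsP x : x \in query_vars g <-> exists2 j, j < m & var_at j = x.
Proof.
split=> [/bigfcupP[al]|[j jm <-]].
  rewrite andbT => /onthP[a ea].
  rewrite /atom_vars inE mem_pmap => /mapP[[y|c] // /onthP[p ep] [->]].
  have ab : a < size (body g) by rewrite -onthTE ea.
  have et : term_at g a p = Some (inl y) by rewrite /term_at ea.
  have pm : p < max_arity g.
    by apply: leq_trans (arity_le (body_fits ea)); rewrite -onthTE ep.
  by have [_ /(_ _ _ pm et)[h1 h2 _]] := valid_atomP ab; exists (term_var pl a p).
have [jj _ _ _] := valid_tableP jm; have [_ _ _ et] := valid_scope jm jm jj.
exact: term_query et.
Qed.

Definition values (f : assignment Const) v := f.[? var_at v]%fmap.

Lemma term_valueE h a al p : onth (body g) a = Some al -> p < max_arity g ->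
  term_value (values h) a p = obind (image_term h) (onth al.2 p).
Proof.
move=> ea pm; have ab : a < size (body g) by rewrite -onthTE ea.
rewrite /term_value; have et : term_at g a p = onth al.2 p by rewrite /term_at ea.
case ep: (term_at g a p) => [[x|c]|]; rewrite -et ep //=.
by have [_ /(_ _ _ pm ep)[_ h2 _]] := valid_atomP ab; rewrite /values h2.
Qed.

Lemma fact_matchesE h a al f phi :
  onth (body g) a = Some al -> onth D f = Some phi ->
  fact_matches (values h) a f = maps_to h al phi.
Proof.
move=> ea ef; rewrite /fact_matches /maps_to ea ef /=.
rewrite -[Some phi.1 == _]/(phi.1 == al.1) [al.1 == _]eq_sym.
case: eqP => //= er; have fa := body_fits ea; have ff := facts_fit ef; rewrite er fa in ff.
have sz : size al.2 = size phi.2 by case: ff.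
have pm : size al.2 <= max_arity g := arity_le fa.
have key p : p < size al.2 ->
    nth None (map (image_term h) al.2) p = term_value (values h) a p.
  move=> pa; rewrite (term_valueE h ea) ?(leq_trans pa) // (nth_map (inl 0)) //.
  have := onthTE al.2 p; rewrite pa; case ep: (onth _ _) => [t|] // _.
  by rewrite (@onth_nth _ (inl 0) t _ _ ep).
have key' p : nth None (map Some phi.2) p = onth phi.2 p by rewrite onthE.
apply/allP/eqP => [all_p|e p].
  apply: (@eq_from_nth _ None); rewrite !size_map // => p pa.
  by rewrite key // key' -(eqP (all_p p _)) // mem_iota (leq_trans pa pm).
rewrite mem_iota add0n => /= pm'; case: (ltnP p (size al.2)) => pa.
  by rewrite -key // e key'.
rewrite (term_valueE h ea) // !onth_default //; by rewrite -sz.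
Qed.

Lemma atom_valueE h a al phi : onth (body g) a = Some al -> phi \in D -> maps_to h al phi ->
  atom_value (values h) a = Some (nu phi).
Proof.
move=> ea /onthP[f ef] mp.
have only f' phi' : onth D f' = Some phi' -> fact_matches (values h) a f' -> phi' = phi.
  move=> ef'; rewrite (fact_matchesE h ea ef') => /andP[/eqP e1 /eqP e2].
  case/andP: mp => /eqP e3 /eqP e4; rewrite e1 in e3; rewrite e2 in e4.
  by case: phi phi' e3 e4 {ef ef' e1 e2} => r1 c1 [r2 c2] /= -> /inj_map -> // x y [].
have fD : f < size D by rewrite -onthTE ef.
have fm : fact_matches (values h) a f by rewrite (fact_matchesE h ea ef).
rewrite /atom_value.
suff gen n : f < n <= size D -> iteri n
    (fun f acc => if fact_matches (values h) a f then omap nu (onth D f) else acc) None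
    = Some (nu phi) by apply: gen; rewrite fD leqnn.
elim: n => //= n IH /andP[fn nD]; case: ifP => [fm'|nfm].
  have := onthTE D n; rewrite nD; case ef': (onth D n) => [phi'|] // _.
  by rewrite /= (only _ _ ef' fm').
apply: IH; rewrite (ltnW nD) andbT; move: fn; rewrite ltnS leq_eqVlt => /orP[/eqP e|//].
by rewrite -e fm in nfm.
Qed.

Lemma join_value h n :
  join_answer D nu h n <-> domf h = query_vars g /\ full (values h) = Some n.
Proof.
have images fs : all2 (maps_to h) (body g) fs -> {subset fs <= D} ->
    full (values h) = Some (\big[times g/munit (times g)]_(phi <- fs) nu phi).
  move=> al2 sub.
  have sz : size (body g) = size fs by move: al2; rewrite all2E => /andP[/eqP].
  rewrite (big_morph (fun x => Some x) (id1 := 1) (op1 := omul (times g))) //.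
  rewrite (big_nth (0, [::])) /full sz /index_iota subn0.
  rewrite big_seq [RHS]big_seq; apply: eq_bigr => a; rewrite mem_iota add0n => /= af.
  have := onthTE (body g) a; rewrite sz af; case ea: (onth _ _) => [al|] // _.
  apply: (atom_valueE ea); first by rewrite sub ?mem_nth.
  move: al2; rewrite all2E => /andP[_ /(all_nthP ((0, [::]), (0, [::])))/(_ a)].
  rewrite size_zip sz minnn af => /(_ isT); rewrite nth_zip //=.
  by rewrite (@onth_nth _ (0, [::]) al _ _ ea).
split=> [[dh [fs [al2 sub ->]]]|[dh ef]]; first by rewrite (images fs).
split=> //.
suff [fs al2 sub] : exists2 fs, all2 (maps_to h) (body g) fs & {subset fs <= D}.
  by exists fs; split=> //; have := images _ al2 sub; rewrite ef => -[].
have : forall al, al \in body g -> exists2 phi, phi \in D & maps_to h al phi.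
  move=> al /onthP[a ea].
  have : isSome (full (values h)) by rewrite ef.
  rewrite omul_prod_some => /allP/(_ a); rewrite mem_iota -onthTE ea => /(_ isT).
  case/atom_value_some => f [phi [fD e fm]]; exists phi; first by apply/onthP; exists f.
  by rewrite -(fact_matchesE h ea e).
elim: (body g) => [_|al als IH h']; first by exists [::].
have [phi pD mp] := h' al (mem_head _ _).
have [|fs al2 sub] := IH; first by move=> al' h''; apply: h'; rewrite inE h'' orbT.
exists (phi :: fs); first by rewrite /= mp.
by move=> x; rewrite inE => /orP[/eqP->|/sub].
Qed.

(** Shifted by one, so that index 0 is the situation before any projection. *)
Definition kept i : {fset nat} := nth fset0 (query_vars g :: proj_sets g) i.

Lemma kept_sub i i' : i <= i' -> i' <= size (proj_sets g) -> {subset kept i' <= kept i}.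
Proof.
move=> ii' le_n; have [/and3P[_ _ chain] _] := query_ok.
have tr : transitive (fun X Y : {fset nat} => (Y `<=` X)%fset).
  by move=> X Y Z h1 h2; apply: fsubset_trans h2 h1.
have rf : reflexive (fun X Y : {fset nat} => (Y `<=` X)%fset) by move=> X; apply: fsubset_refl.
have srt : sorted (fun X Y : {fset nat} => (Y `<=` X)%fset) (query_vars g :: proj_sets g).
  by rewrite /=; apply: sub_path chain => X Y; apply: fproper_sub.
have le_i := leq_trans ii' le_n.
apply/fsubsetP; apply: (sorted_leq_nth tr rf fset0 srt) ii'; by rewrite inE.
Qed.

Lemma level_kept x i : x \in query_vars g -> i <= size (proj_sets g) ->
  (i <= level g x) = (x \in kept i).
Proof.
move=> xq; rewrite /level.
suff gen n : n <= size (proj_sets g) ->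
    let lv := iteri n (fun i acc => if x \in nth fset0 (proj_sets g) i then i.+1 else acc) 0 in
    lv <= n /\ forall i, i <= n -> (i <= lv) = (x \in kept i).
  by move=> le_i; apply: (gen _ (leqnn _)).2.
elim: n {i} => [_|n IH lt_n] /=.
  by split=> // i; rewrite leqn0 => /eqP->; rewrite xq.
have [le_lv h] := IH (ltnW lt_n); case: ifP => xn; split=> //.
- move=> i le_i; rewrite le_i; apply/esym.
  by apply: (kept_sub le_i lt_n).
- exact: leqW.
- move=> i; rewrite leq_eqVlt => /orP[/eqP->|]; last exact: h.
  by rewrite /kept /= xn; apply/negbTE; rewrite -ltnNge ltnS.
Qed.

Lemma keptP i x : i <= size (proj_sets g) ->
  x \in kept i <-> exists2 j, first_at i <= j < m & var_at j = x.
Proof.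
move=> le_i; have sub := kept_sub (leq0n i) le_i.
split=> [xk|[j /andP[fj jm] <-]].
  have [/(_ (sub _ xk)) [j jm ej] _] := query_varsP x.
  exists j => //; rewrite jm andbT leq_first_at // ej level_kept //; exact: sub.
by rewrite -level_kept -?leq_first_at //; apply/query_varsP; exists j.
Qed.

Fixpoint extensions c t (f : assignment Const) : seq (assignment Const) :=
  if t is t.+1 then flatten [seq extensions c t f.[var_at (c + t) <- x]%fmap | x <- domain]
  else [:: f].

Lemma values_set f j x v : j < m -> v < m ->
  values f.[var_at j <- x]%fmap v = set_var (values f) j x v.
Proof.
move=> jm vm; rewrite /values /set_var fnd_set; congr (if _ then _ else _).
by apply/eqP/eqP => [/(var_at_inj vm jm)|->].
Qed.

Lemma value_extensions (p : cmonoid K) c t f : c + t <= m ->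
  (forall j, c <= j < c + t -> op_at j = p) ->
  partial_value (c + t) (values f) =
  \big[oadd p/None]_(h <- extensions c t f) partial_value c (values h).
Proof.
elim: t f => [|t IH] f; first by rewrite addn0 big_seq1.
rewrite addnS => lt_m hp /=; rewrite big_flatten big_map hp; last by rewrite leq_addr ltnSn.
apply: eq_bigr => x _; rewrite -IH ?(ltnW lt_m) //.
  by apply: value_dep => v vm; rewrite values_set.
by move=> j /andP[cj jt]; apply: hp; rewrite cj ltnW.
Qed.

Definition in_block c t x := has (fun j => var_at j == x) (iota c t).

Lemma extensionsP c t f h : c + t <= m ->
  h \in extensions c t f <->
  (forall x, ~~ in_block c t x -> h.[? x]%fmap = f.[? x]%fmap) /\
  (forall j, c <= j < c + t -> exists2 x, x \in domain & h.[? var_at j]%fmap = Some x).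
Proof.
elim: t f => [|t IH] f.
  move=> _; rewrite inE; split=> [/eqP->|[h1 _]]; last by apply/eqP/fmapP => x; apply: h1.
  by split=> // j; rewrite addn0 ltnNge => /andP[->].
rewrite addnS => lt_m /=.
have block x : in_block c t.+1 x = in_block c t x || (var_at (c + t) == x).
  by rewrite /in_block -addn1 iotaD has_cat /= orbF.
have not_in : ~~ in_block c t (var_at (c + t)).
  apply/hasPn => j; rewrite mem_iota => /andP[cj jt]; apply/eqP => /(var_at_inj (ltn_trans jt lt_m) lt_m) e.
  by rewrite e ltnn in jt.
split=> [/flatten_mapP[y yd /IH]|[h1 h2]].
  case=> [|h1 h2]; first exact: ltnW.
  split=> [x|j]; first by rewrite block negb_or eq_sym => /andP[nb nx]; rewrite h1 // fnd_set (negbTE nx).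
  case/andP => cj; rewrite ltnS leq_eqVlt => /orP[/eqP->|jt]; last by apply: h2; rewrite cj.
  by exists y => //; rewrite h1 // fnd_set eqxx.
have [|y yd ey] := h2 (c + t); first by rewrite leq_addr ltnSn.
apply/flatten_mapP; exists y => //; apply/IH; first exact: ltnW.
split=> [x nb|j /andP[cj jt]]; last by apply: h2; rewrite cj ltnW.
rewrite fnd_set; case: eqVneq => [->//|nx]; apply: h1.
by rewrite block negb_or nb eq_sym.
Qed.

Lemma extensions_uniq c t f : c + t <= m -> uniq (extensions c t f).
Proof.
elim: t f => //= t IH f; rewrite addnS => lt_m.
have : uniq domain by apply: undup_uniq.
elim: domain => //= y ys IHys /andP[ny uys].
rewrite cat_uniq IH ?(ltnW lt_m) // IHys // andbT; apply/hasPn => h.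
case/flatten_mapP => z zs hz; apply/negP => hy.
have not_in : ~~ in_block c t (var_at (c + t)).
  apply/hasPn => j; rewrite mem_iota => /andP[cj jt]; apply/eqP => /(var_at_inj (ltn_trans jt lt_m) lt_m) e.
  by rewrite e ltnn in jt.
have [/(_ hy) [h1 _] _] := @extensionsP c t f.[var_at (c + t) <- y]%fmap h (ltnW lt_m).
have [/(_ hz) [h2 _] _] := @extensionsP c t f.[var_at (c + t) <- z]%fmap h (ltnW lt_m).
move: (h1 _ not_in); rewrite h2 // !fnd_set eqxx => -[e].
by rewrite -e zs in ny.
Qed.

(** The projection sums out the block of variables between [first_at i] and [first_at i.+1]. Its set
    S_f consists of the [extensions] of [f] over this block that have a value. *)
Lemma project_value i (p : cmonoid K) (A : assignment Const -> K -> Prop) f n :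
  i < size (proj_sets g) ->
  (forall j, first_at i <= j < first_at i.+1 -> op_at j = p) ->
  (forall f n, A f n <-> domf f = kept i /\ partial_value (first_at i) (values f) = Some n) ->
  project (kept i.+1) p A f n <->
  domf f = kept i.+1 /\ partial_value (first_at i.+1) (values f) = Some n.
Proof.
move=> lt_i hp hA; set c := first_at i; set c' := first_at i.+1.
have cc : c <= c' by apply: leq_first.
have c'm : c' <= m by apply: first_at_le.
have ct : c + (c' - c) = c' by rewrite subnKC.
set t := c' - c in ct; have ctm : c + t <= m by rewrite ct.
pose pairs := pmap (fun h => omap (pair h) (partial_value c (values h))) (extensions c t f).
have in_pairs q : domf f = kept i.+1 ->
    List.In q pairs <-> A q.1 q.2 /\ q.1.[& kept i.+1]%fmap = f.
  move=> df; rewrite In_pmap_pair hA extensionsP //.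
  have kept_block x : (x \in kept i) <-> (x \in kept i.+1) \/ in_block c t x.
    rewrite keptP ?(ltnW lt_i) // keptP //.
    split=> [[j /andP[cj jm] ej]|[[j /andP[cj jm] ej]|/hasP[j]]].
    - case: (ltnP j c') => jc; last by left; exists j; rewrite ?jc.
      by right; apply/hasP; exists j; rewrite ?mem_iota ?ct ?cj //; apply/eqP.
    - by exists j; rewrite // jm andbT (leq_trans cc).
    - rewrite mem_iota ct => /andP[cj jc] /eqP ej; exists j => //.
      by rewrite cj (leq_trans jc).
  have block_kept x : in_block c t x -> x \notin kept i.+1.
    case/hasP => j; rewrite mem_iota ct => /andP[cj jc] /eqP ej; apply/negP.
    case/(keptP _ lt_i) => j' /andP[cj' jm'] ej'.
    have := var_at_inj (leq_trans jc c'm) jm' (etrans ej (esym ej')) => e.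
    by move: jc; rewrite e ltnNge cj'.
  split=> [[[h1 h2] ev]|[[dq ev] eq]].
    have in_h x : (x \in domf q.1) = (x \in kept i).
      case: (boolP (in_block c t x)) => [bx|nb]; last first.
        rewrite -fndSome h1 // fndSome -[x \in f]/(x \in domf f) df.
        by apply/idP/idP => [xk|/kept_block[//|]]; [apply/kept_block; left | rewrite (negbTE nb)].
      have -> : x \in kept i by apply/kept_block; right.
      case/hasP: bx => j; rewrite mem_iota => jc /eqP <-.
      by have [y _ ey] := h2 j jc; rewrite -fndSome ey.
    split; first by split=> //; apply/fsetP.
    apply/fmapP => x; rewrite fnd_restrict; case: ifP => xk.
      by apply: h1; apply/negP => /block_kept; rewrite xk.
    have xf : x \notin domf f by rewrite df xk.
    by rewrite (not_fnd xf).
  split=> //; split=> [x nb|j /andP[cj jc]].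
    rewrite -eq fnd_restrict; case: ifP => // xk.
    suff xq : x \notin domf q.1 by rewrite (not_fnd xq).
    by rewrite dq; apply/negP => /kept_block[]; [rewrite xk | rewrite (negbTE nb)].
  (* Constants outside [domain] are impossible here: an annotation makes [q.1] a candidate for table
     [j], whose rows hold constants of the database. *)
  have jm : j < m by apply: leq_trans ctm.
  have nf j' : j' < c -> ~~ free j'.
    move=> jc'; rewrite freeE -?ltnNge; last by apply: ltn_trans jm; apply: leq_trans cj.
    by apply: leq_trans jc' (leq_first (ltnW lt_i)).
  have : isSome (partial_value c (values q.1)) by rewrite ev.
  by move/(value_candidate nf (_ : c <= j < m)); rewrite cj jm => /(_ isT)/(candidate_domain jm).
have value_pairs : domf f = kept i.+1 ->
    partial_value c' (values f) = if pairs is [::] then None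
      else Some (\big[p/munit p]_(q <- pairs) q.2).
  by move=> df; rewrite -ct (@value_extensions p) ?oadd_sumE // ct.
split=> [[df [s [s0 nds ins ->]]]|[df ev]]; split=> //.
  (* Two duplicate-free enumerations of S_f give the same sum. *)
  have perm : Permutation.Permutation s pairs.
    apply: Permutation.NoDup_Permutation => //.
      by apply: NoDup_pmap_pair; apply: extensions_uniq.
    by move=> q; rewrite ins in_pairs.
  rewrite value_pairs // (big_Permutation _ _ perm).
  by case: pairs perm {in_pairs value_pairs} => // /Permutation.Permutation_sym/Permutation.Permutation_nil.
move: ev; rewrite value_pairs //; case ep : pairs => [|q qs] // [<-].
exists pairs; split; rewrite ?ep //.
- by rewrite -ep; apply: NoDup_pmap_pair; apply: extensions_uniq.
- by move=> q'; rewrite -ep in_pairs.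
Qed.

Lemma answer_value f n :
  answer D nu f n <-> domf f = free_vars g /\ partial_value first_free (values f) = Some n.
Proof.
pose answers i := foldl (fun A p => project p.1 p.2 A) (join_answer D nu) (take i (projections g)).
have size_p : size (proj_sets g) = size (projections g) by rewrite size_map.
suff gen i : i <= size (proj_sets g) -> forall f n,
    answers i f n <-> domf f = kept i /\ partial_value (first_at i) (values f) = Some n.
  have := gen _ (leqnn _) f n; rewrite /answers {1}size_p take_size.
  by rewrite (_ : kept _ = free_vars g) //; exact: (nth_last fset0 (query_vars g :: _)).
elim: i => [_|i IH lt_i] {}f {}n.
  rewrite /answers take0 /= join_value.
  have -> // : first_at 0 = 0.
  by apply/eqP; rewrite -leqn0; case: (posnP m) => [e|m0];
    [rewrite -[in X in _ <= X]e first_at_le | rewrite leq_first_at].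
have lt_i' : i < size (projections g) by rewrite -size_p.
pose p0 := (fset0 : {fset nat}, times g).
rewrite /answers (take_nth p0) // -cats1 foldl_cat /= -/(answers i).
have -> : (nth p0 (projections g) i).1 = kept i.+1 by rewrite /kept /= (nth_map p0).
apply: project_value => // [j /andP[ij ji]|]; last by apply: IH; apply: ltnW.
have jm : j < m by apply: leq_trans ji (first_at_le _).
rewrite /op_at (_ : level g (var_at j) = i) ?(nth_map p0) //.
by apply/eqP; rewrite eqn_leq -[i <= _]leq_first_at // ij andbT leqNgt -leq_first_at // -ltnNge.
Qed.

(** ** Enumeration *)

(* A state lists the current rows of the tables [j, ..., m - 1]. *)
Definition row_of j (st : seq nat) i := nth 0 st (i - j).

Definition chain j (st : seq nat) : seq nat :=
  matching j (row (parent j) (row_of j.+1 st (parent j))).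

Definition first_row j r : option nat := ohead (matching j (row (parent j) r)).

Definition next_row j r : option nat := ohead [seq r' <- matching j (row j r) | r < r'].

Definition restart j (st : seq nat) : seq nat :=
  odflt 0 (first_row j (row_of j.+1 st (parent j))) :: st.

Fixpoint states t : seq (seq nat) :=
  if t is t.+1 then
    flatten [seq [seq r :: st | r <- chain (m - t.+1) st] | st <- states t]
  else [:: [::]].

Fixpoint next_state t (st : seq nat) : option (seq nat) :=
  match t, st with
  | t.+1, r :: st =>
      if next_row (m - t.+1) r is Some r' then Some (r' :: st)
      else omap (restart (m - t.+1)) (next_state t st)
  | _, _ => None
  end.

Fixpoint start_state t : seq nat :=
  if t is t.+1 then restart (m - t.+1) (start_state t) else [::].

Definition state_ok j st : Prop := size st = m - j /\
  forall i, j <= i < m -> row_of j st i \in matching i (row (parent i) (row_of j st (parent i))).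

Lemma row_of_cons j r st i : j < i -> row_of j (r :: st) i = row_of j.+1 st i.
Proof. by move=> ji; rewrite /row_of (_ : i - j = (i - j.+1).+1) //; move: ji; clear; lia. Qed.

Lemma row_of_head j r st : row_of j (r :: st) j = r.
Proof. by rewrite /row_of subnn. Qed.

(** The default of [nth] is at the same time the only row of the root. *)
Lemma row_of_last j st : size st = m - j -> row_of j st m = 0.
Proof. by move=> h; rewrite /row_of nth_default ?h. Qed.

Lemma state_okS j r st : j < m ->
  state_ok j (r :: st) <-> state_ok j.+1 st /\ r \in chain j st.
Proof.
move=> jm; split=> [[sz h]|[[sz h] hr]].
  split; last first.
    have [_ /andP[jp _] _ _] := valid_tableP jm.
    by have := h j; rewrite leqnn jm row_of_head row_of_cons // => /(_ isT).
  split=> [|i /andP[ji im]]; first by move: sz jm => /=; clear; lia.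
  have [_ /andP[ip _] _ _] := valid_tableP im.
  have := h i; rewrite (ltnW ji) im !row_of_cons // ?(ltn_trans ji) //; exact.
split=> [|i]; first by move: sz jm => /=; clear; lia.
rewrite leq_eqVlt => /andP[/orP[/eqP<-|ji] im].
  have [_ /andP[jp _] _ _] := valid_tableP jm.
  by rewrite row_of_head row_of_cons.
have [_ /andP[ip _] _ _] := valid_tableP im.
by rewrite !row_of_cons ?(ltn_trans ji ip) //; apply: h; rewrite ji.
Qed.

Lemma statesP t st : t <= m -> st \in states t <-> state_ok (m - t) st.
Proof.
elim: t st => [|t IH] st tm.
  rewrite subn0 inE; split=> [/eqP->|[sz _]].
    by split; rewrite ?subnn // => i; rewrite ltnNge; case: leqP.
  by apply/eqP/size0nil; rewrite sz subnn.
have lt_m : m - t.+1 < m by move: tm; clear; lia.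
have eS : (m - t.+1).+1 = m - t by move: tm; clear; lia.
split=> [/flatten_mapP[st' /(IH _ (ltnW tm)) ok' /mapP[r hr ->]]|ok].
  by apply/(state_okS _ _ lt_m); rewrite eS.
case: st ok => [[sz _]|r st /state_okS []//]; first by move: sz tm => /=; clear; lia.
rewrite eS => ok' hr; apply/flatten_mapP; exists st; first by apply/(IH _ (ltnW tm)).
by apply/mapP; exists r.
Qed.

Lemma states_uniq t : uniq (states t).
Proof.
elim: t => //= t; elim: (states t) => //= st sts IH /andP[nst usts].
rewrite cat_uniq IH // andbT map_inj_uniq => [|r r' []//].
rewrite filter_uniq ?iota_uniq //=; apply/hasPn => x /flatten_mapP[st' st's /mapP[r _ ->]].
by apply/negP => /mapP[r' _ [_ e]]; rewrite -e st's in nst.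
Qed.

Hypothesis root_ok : isSome (wt m 0).

Lemma weight_message i j s : j < m -> parent j = i -> isSome (weight i s) -> isSome (message s j).
Proof.
move=> jm pj; rewrite /weight; case: (bigop _ _ _) => //= x.
case e : (\big[_/_]_(_ <- _ | _) _) => [y|] // _.
have : isSome (\big[omul (times g)/1]_(i0 <- iota 0 m | parent i0 == i) message s i0) by rewrite e.
by rewrite omul_prod_some => /allP/(_ j); rewrite mem_iota add0n jm pj eqxx => /(_ isT).
Qed.

Lemma weight_root s s' : weight m s = weight m s'.
Proof.
apply: weight_dep; apply/agree_onP => v vm sv.
by have [_ _ /negP] := valid_tableP vm.
Qed.

Lemma state_row j st i : state_ok j st -> j <= i <= m -> isSome (wt i (row_of j st i)).
Proof.
case=> sz h /andP[ji]; rewrite leq_eqVlt => /orP[/eqP->|im]; first by rewrite row_of_last.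
by have := h i; rewrite ji im mem_filter => /(_ isT)/andP[/andP[]].
Qed.

(** No dead ends: the current row of the parent has a weight, so every message to it is present, and
    a free table sends one only if some row matches. *)
Lemma chain_neq_nil j st : first_free <= j < m -> state_ok j.+1 st -> chain j st != [::].
Proof.
move=> /andP[fj jm] ok; have [_ /andP[jp pm] _ _] := valid_tableP jm.
have := state_row ok (_ : j.+1 <= parent j <= m); rewrite jp pm => /(_ isT).
set r := row_of _ _ _ => wr.
have : isSome (weight (parent j) (row (parent j) r)).
  move: pm wr; rewrite leq_eqVlt => /orP[/eqP ep|pm'].
    rewrite /r ep row_of_last; last by case: ok.
    by have [_ [s ->]] := table_ok; rewrite (weight_root s (row m 0)).
  case: ok => _ /(_ (parent j)); rewrite jp pm' => /(_ isT).
  rewrite mem_filter mem_iota -/r => /andP[_ /= rn] wr.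
  by have [_ _ <-] := wt_some pm' rn wr.
move=> /(weight_message jm erefl); rewrite /message freeE // fj.
by rewrite /chain -/r; case: (matching _ _).
Qed.

(** All rows of a chain agree with [r] on the variables shared with the parent. The successor is
    therefore determined by [r] alone and can be tabulated in advance. *)
Lemma next_row_chain j st r : j < m -> r \in chain j st ->
  next_row j r = ohead [seq r' <- chain j st | r < r'].
Proof.
move=> jm; rewrite mem_filter => /andP[/andP[_ ar] _].
by rewrite /next_row (matching_dep ar).
Qed.

(** The tables with the smallest numbers vary fastest. Each block of states is non-empty by
    [chain_neq_nil], so a carry lands on the first row of the next block. *)
Lemma states_successive t : t <= m - first_free ->
  ohead (states t) = Some (start_state t) /\ successive (next_state t) (states t) None.
Proof.
elim: t => [//|t IH] tm; have [IHs IHo] := IH (ltnW tm).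
set j := m - t.+1; have fl := first_at_le (size (proj_sets g)); rewrite -/first_free in fl.
have jm : first_free <= j < m by move: tm; rewrite /j; clear; lia.
have eS : j.+1 = m - t by move: tm; rewrite /j; clear; lia.
have t_le : t <= m by move: tm; clear; lia.
have ok st : st \in states t -> state_ok j.+1 st by rewrite eS => /statesP; apply.
have hd st : st \in states t -> exists l, chain j st = odflt 0 (first_row j (row_of j.+1 st (parent j))) :: l.
  move=> /ok /(chain_neq_nil jm); rewrite /chain /first_row.
  by case: (matching _ _) => // r l _; exists l.
have block st : st \in states t ->
    successive (next_state t.+1) [seq r :: st | r <- chain j st] (omap (restart j) (next_state t st)).
  move=> sts; have srt : sorted ltn (chain j st).
    by apply: sorted_filter (iota_ltn_sorted _ _); apply: ltn_trans.
  have := successive_sorted srt; have : {subset chain j st <= chain j st} by [].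
  (* The list that is walked through is generalised, while the one in which successors are looked up
     stays fixed. *)
  move: {1 4 5}(chain j st) => l; elim: l => //= r l IHl sub /andP[/eqP e o].
  rewrite IHl //; last by move=> x xl; apply: sub; rewrite inE xl orbT.
  rewrite andbT -/j (next_row_chain _ (sub _ (mem_head _ _))); last by case/andP: jm.
  by rewrite e; case: l {IHl sub e o}.
split.
  rewrite /= -/j; move: IHs hd; case: (states t) => //= st sts [<-] hd.
  by have [l ->] := hd st (mem_head _ _).
rewrite [states t.+1]/= -/j; move: IHo hd block; move: (next_state t.+1) => next.
elim: (states t) => // st sts IHsts.
rewrite [successive _ _ _]/= => /andP[/eqP e o] hd block; rewrite [map _ _]/= [flatten _]/= successive_cat.
rewrite IHsts // => [|st' h|st' h]; try by [apply: hd; rewrite inE h orbT | apply: block; rewrite inE h orbT].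
rewrite andbT; have := block st (mem_head _ _); rewrite e.
case: sts hd {e o block IHsts} => [//|st' sts] hd /=.
by have [|l ->] := hd st'; first by rewrite !inE eqxx orbT.
Qed.

Definition state_assignment st : assignment Const :=
  foldr (fun v (f : assignment Const) =>
      if row v (row_of first_free st v) v is Some c then f.[var_at v <- c]%fmap else f)
    [fmap]%fmap (iota first_free (m - first_free)).

Definition state_annotation st : option K :=
  wt m 0 ** \big[omul (times g)/1]_(j <- iota first_free (m - first_free))
              wt j (row_of first_free st j).

Lemma state_assignmentE st v : v < m ->
  values (state_assignment st) v =
  if first_free <= v then row v (row_of first_free st v) v else None.
Proof.
move=> vm; have fl := first_at_le (size (proj_sets g)); rewrite -/first_free in fl.
have -> : (first_free <= v) = (v \in iota first_free (m - first_free)).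
  by rewrite mem_iota subnKC // vm andbT.
rewrite /state_assignment.
have : {subset iota first_free (m - first_free) <= iota 0 m}.
  by move=> x; rewrite !mem_iota subnKC // => /andP[].
elim: (iota _ (m - _)) => [_|w ws IH sub] /=; first by rewrite /values fnd_fmap0.
have {}IH := IH (fun x h => sub x (mem_behead (s := w :: ws) h)).
have wm : w < m by have := sub w (mem_head _ _); rewrite mem_iota.
rewrite inE; case er : (row w _ w) => [c|].
  by rewrite values_set // /set_var; case: eqP => //= ->.
by rewrite IH; case: eqVneq => //= ->; rewrite er if_same.
Qed.

(** From the root downwards: a variable of table [i] other than its own is shared with the parent,
    on which the matching row agrees, and the parent is settled before. *)
Lemma state_agree st i : state_ok first_free st -> first_free <= i < m ->
  agree_on (scope i) (row i (row_of first_free st i)) (values (state_assignment st)).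
Proof.
case=> _ ok; have [n] := ubnP (m - i); elim: n i => // n IH i le_n /andP[fi im].
apply/agree_onP => v vm sv; rewrite state_assignmentE //.
have [iv to_par _ _] := valid_scope im vm sv; rewrite (leq_trans fi iv).
case: (eqVneq v i) => [->//|vi].
have [_ /andP[ip pm] _ _] := valid_tableP im.
have := ok i; rewrite fi im mem_filter => /(_ isT)/andP[/andP[_ ar] _].
rewrite (agree_onP _ _ _ ar) //; last by rewrite /lower sv.
have pm' : parent i < m.
  move: pm; rewrite leq_eqVlt => /orP[/eqP ep|//]; have := to_par vi.
  by have [_ _ /negbTE] := valid_tableP vm; rewrite ep => ->.
have ff : first_free <= parent i < m by rewrite pm' andbT (leq_trans fi (ltnW ip)).
have lt_n : m - parent i < n by move: le_n ip im; clear; lia.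
rewrite (agree_onP _ _ _ (IH _ lt_n ff)) // ?to_par //.
by rewrite state_assignmentE // (leq_trans fi iv).
Qed.

Lemma state_row_weight st i : state_ok first_free st -> first_free <= i < m ->
  row_weight i (values (state_assignment st)) = wt i (row_of first_free st i)
  /\ ~~ duplicate i (row_of first_free st i).
Proof.
move=> ok fi; have ag := state_agree ok fi; have /andP[ffi im] := fi.
have := ok.2 i fi; rewrite mem_filter mem_iota => /andP[/andP[wi _] /= ri].
have [nd ri' _] := wt_some im ri wi.
rewrite (@wt_candidate i (row_of first_free st i) (values (state_assignment st))) //.
have [ii _ _ _] := valid_tableP im.
rewrite /candidate -(agree_onP _ _ _ ag) // ri' andbT; apply/orP; right.
by apply/hasP; exists (row_of first_free st i); rewrite ?mem_iota.
Qed.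

Lemma state_value st : state_ok first_free st ->
  partial_value first_free (values (state_assignment st)) = state_annotation st.
Proof.
have fl := first_at_le (size (proj_sets g)); rewrite -/first_free in fl.
move=> ok; rewrite value_free subSn // -addn1 iotaD big_cat /= big_seq1 subnKC // omulC.
congr omul.
  rewrite /row_weight /candidate eqxx /cond omul1.
  by have [_ [s ->]] := table_ok; apply: weight_root.
rewrite big_seq [RHS]big_seq; apply: eq_bigr => i; rewrite mem_iota subnKC // => fi.
by have [-> _] := state_row_weight ok fi.
Qed.

Lemma free_varsP x : x \in free_vars g <-> exists2 j, first_free <= j < m & var_at j = x.
Proof.
rewrite -(_ : kept (size (proj_sets g)) = free_vars g); first exact: keptP.
exact: (nth_last fset0 (query_vars g :: _)).
Qed.

Lemma state_free_vars st : state_ok first_free st ->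
  domf (state_assignment st) = free_vars g.
Proof.
have fl := first_at_le (size (proj_sets g)); rewrite -/first_free in fl.
case=> _ ok; rewrite /state_assignment.
have some_row v : v \in iota first_free (m - first_free) ->
    isSome (row v (row_of first_free st v) v).
  rewrite mem_iota subnKC // => /andP[fv vm].
  have := ok v; rewrite fv vm => /(_ isT)/(matching_row vm)[c _ [-> _ _ _]].
  by [].
apply/fsetP => x; apply/idP/idP => [|/free_varsP[j jm <-]].
  move=> h; apply/free_varsP.
  suff : has (fun v => var_at v == x) (iota first_free (m - first_free)).
    by case/hasP => v; rewrite mem_iota subnKC // => vm /eqP <-; exists v.
  move: h; elim: (iota _ _) => [|v vs IH] /=; first by rewrite inE.
  case: (row v _ v) => [c|]; last by move/IH->; rewrite orbT.
  by rewrite mem_setf inE eq_sym => /orP[->//|/IH->]; rewrite orbT.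
have /andP[fj jm'] := jm.
have := state_assignmentE st jm'; rewrite fj /values -/(state_assignment st).
have := some_row j; rewrite mem_iota subnKC // jm => /(_ isT).
by case: (row j _ j) => // c _ e; rewrite -fndSome -/(state_assignment st) e.
Qed.

Definition outputs : seq (assignment Const * K) :=
  pmap (fun st => omap (pair (state_assignment st)) (state_annotation st))
    (states (m - first_free)).

Lemma first_freeK : m - (m - first_free) = first_free.
Proof. by rewrite subKn // first_at_le. Qed.

Lemma states_ok st : st \in states (m - first_free) <-> state_ok first_free st.
Proof. by rewrite statesP ?leq_subr // first_freeK. Qed.

Lemma state_annotation_some st : state_ok first_free st -> isSome (state_annotation st).
Proof.
have fl := first_at_le (size (proj_sets g)); rewrite -/first_free in fl.
move=> ok; rewrite /state_annotation; case: (wt m 0) root_ok => // x _.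
suff : isSome (\big[omul (times g)/1]_(j <- iota first_free (m - first_free))
    wt j (row_of first_free st j)) by case: (bigop _ _ _).
rewrite omul_prod_some; apply/allP => j; rewrite mem_iota subnKC //= => /andP[fj jm].
by apply: (state_row ok); rewrite fj ltnW.
Qed.

Lemma state_unique i s r r' : i < m -> r < row_number -> r' < row_number ->
  ~~ duplicate i r -> ~~ duplicate i r' ->
  agree_on (scope i) (row i r) s -> agree_on (scope i) (row i r') s -> r = r'.
Proof.
move=> im rn rn' nd nd' ra ra'; case: (ltngtP r r') => // lt_r.
  by have /hasPn/(_ r) := nd'; rewrite mem_iota lt_r rn (agree_on_eq _ ra') ra => /(_ isT).
by have /hasPn/(_ r') := nd; rewrite mem_iota lt_r rn' (agree_on_eq _ ra) ra' => /(_ isT).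
Qed.

(** The rows of a state are not duplicates, so in each table the assignment determines the row. *)
Lemma state_assignment_inj st st' : state_ok first_free st -> state_ok first_free st' ->
  state_assignment st = state_assignment st' -> st = st'.
Proof.
move=> ok ok' e; apply: (@eq_from_nth _ 0); first by rewrite ok.1 ok'.1.
move=> i; rewrite ok.1 => lt_i.
have fi : first_free <= first_free + i < m by rewrite leq_addr -ltn_subRL.
have row_ofE st0 : row_of first_free st0 (first_free + i) = nth 0 st0 i by rewrite /row_of addKn.
rewrite -!row_ofE; have /andP[_ im] := fi.
have in_range st0 : state_ok first_free st0 -> row_of first_free st0 (first_free + i) < row_number.
  by case=> _ /(_ _ fi); rewrite mem_filter mem_iota => /andP[_].
apply: (@state_unique (first_free + i) (values (state_assignment st))) => //.
- exact: in_range.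
- exact: in_range.
- by have [] := state_row_weight ok fi.
- by have [] := state_row_weight ok' fi.
- exact: state_agree.
- by rewrite e; apply: state_agree.
Qed.

(** A value at [f] makes [f] a candidate for every free table. The rows that represent it, chosen
    from the root downwards, match each other as they all agree with [f]. *)
Lemma state_of_value f n : domf f = free_vars g -> partial_value first_free (values f) = Some n ->
  exists2 st, state_ok first_free st & state_assignment st = f.
Proof.
have fl := first_at_le (size (proj_sets g)); rewrite -/first_free in fl.
move=> df; rewrite value_free => ev.
have rw j : first_free <= j <= m -> isSome (row_weight j (values f)).
  move=> /andP[fj jm].
  have : isSome (Some n) by []; rewrite -ev omul_prod_some => /allP/(_ j).
  rewrite mem_iota fj subnKC ?ltnS ?jm => [/(_ isT)//|].
  by move: fl; clear; lia.
have cand j : first_free <= j < m -> exists r, [/\ r < row_number,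
    agree_on (scope j) (row j r) (values f), ~~ duplicate j r & isSome (wt j r)].
  move=> /andP[fj jm]; have := rw j; rewrite fj (ltnW jm) => /(_ isT) w.
  have cj : candidate j (values f).
    by move: w; rewrite /row_weight /cond; case: (candidate _ _).
  have [r [rn ra nd _]] := candidate_row jm cj.
  by exists r; split=> //; rewrite (wt_candidate jm rn nd ra cj).
have [st [ok ag]] : exists st, state_ok first_free st /\ forall i, first_free <= i < m ->
    agree_on (scope i) (row i (row_of first_free st i)) (values f).
  suff gen t : t <= m - first_free -> exists st, state_ok (m - t) st /\
      forall i, m - t <= i < m -> agree_on (scope i) (row i (row_of (m - t) st i)) (values f).
    by have := gen _ (leqnn _); rewrite first_freeK.
  elim: t => [_|t IH tm].
    exists [::]; split; last by move=> i; rewrite subn0 ltnNge; case: leqP.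
    by split; rewrite ?subn0 ?subnn // => i; rewrite ltnNge; case: leqP.
  have [st [ok ag]] := IH (ltnW tm).
  set j := m - t.+1; have fj : first_free <= j < m by move: tm; rewrite /j; clear; lia.
  have eS : m - t = j.+1 by move: tm; rewrite /j; clear; lia.
  rewrite eS in ok ag; have /andP[_ jm] := fj.
  have [r [rn ra nd wr]] := cand j fj; exists (r :: st).
  have [_ /andP[jp pm] _ _] := valid_tableP jm.
  split.
    apply/state_okS => //; split=> //.
    rewrite mem_filter mem_iota add0n /= rn andbT wr; apply/agree_onP => v vm lv.
    have sp := lower_parent jm vm lv; have /andP[sv _] := lv.
    have pm' : parent j < m.
      move: pm; rewrite leq_eqVlt => /orP[/eqP ep|//].
      by have [_ _ /negbTE] := valid_tableP vm; rewrite ep in sp *; rewrite sp.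
    rewrite (agree_onP _ _ _ ra) //; apply/esym/(agree_onP _ _ _ (ag (parent j) _)) => //.
    by rewrite jp.
  move=> i; rewrite leq_eqVlt => /andP[/orP[/eqP<-|ji] im]; first by rewrite row_of_head.
  by rewrite row_of_cons //; apply: ag; rewrite ji.
exists st => //; apply/fmapP => x.
case: (boolP (x \in free_vars g)) => [/free_varsP[j /andP[fj jm] <-]|nx]; last first.
  have nf : x \notin domf f by rewrite df.
  have ns : x \notin domf (state_assignment st) by rewrite state_free_vars.
  by rewrite (not_fnd nf) (not_fnd ns).
rewrite -[LHS]/(values (state_assignment st) j) state_assignmentE // fj.
have [jj _ _ _] := valid_tableP jm.
by rewrite (agree_onP _ _ _ (ag j _)) ?fj.
Qed.

Lemma outputs_answers f n : List.In (f, n) outputs <-> answer D nu f n.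
Proof.
have in_outputs : List.In (f, n) outputs <->
    exists2 st, st \in states (m - first_free) &
      state_assignment st = f /\ state_annotation st = Some n.
  rewrite /outputs; elim: (states _) => [|st sts IH] /=; first by split=> // -[].
  case ea : (state_annotation st) => [x|] /=; last first.
    rewrite IH; split=> [[st' h h']|[st' + h']].
      by exists st' => //; rewrite inE h orbT.
    by rewrite inE => /orP[/eqP e|h]; [rewrite e ea in h'; case: h' | exists st'].
  rewrite IH; split=> [[[<- <-]|[st' h h']]|[st' + h']].
  - by exists st; rewrite ?mem_head.
  - by exists st' => //; rewrite inE h orbT.
  - rewrite inE => /orP[/eqP e|h]; last by right; exists st'.
    by left; move: h'; rewrite e ea => -[-> [->]].
rewrite in_outputs answer_value; split=> [[st /states_ok ok [<- ea]]|[df ev]].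
  by rewrite state_free_vars // state_value.
have [st ok e] := state_of_value df ev.
exists st; first exact/states_ok.
by rewrite -state_value // e.
Qed.

Lemma NoDup_outputs : List.NoDup outputs.
Proof.
have := states_uniq (m - first_free).
have : forall st, st \in states (m - first_free) -> state_ok first_free st.
  by move=> st /states_ok.
rewrite /outputs; elim: (states _) => [|st sts IH] ok /=; first by constructor.
case/andP => nst ust.
have {}IH := IH (fun st' h => ok st' (mem_behead (s := st :: sts) h)) ust.
case: (state_annotation st) => [x|] //=; constructor=> // hin.
suff [st' st's e] : exists2 st', st' \in sts & state_assignment st' = state_assignment st.
  have eq : st' = st.
    by apply: state_assignment_inj e; apply: ok; rewrite ?mem_head // inE st's orbT.
  by rewrite -eq st's in nst.
elim: sts hin {IH ok nst ust} => //= st' sts IH.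
case: (state_annotation st') => [y|] /=.
  case=> [[e _]|/IH[st'' h h']]; first by exists st'; rewrite ?mem_head.
  by exists st'' => //; rewrite inE h orbT.
by case/IH => st'' h h'; exists st'' => //; rewrite inE h orbT.
Qed.

(** No state is without an annotation, so an answer can be output after every move of the
    odometer. *)
Lemma size_outputs : size outputs = size (states (m - first_free)).
Proof.
rewrite size_pmap -size_filter (@eq_in_filter _ _ predT) ?filter_predT //.
by move=> st /states_ok /state_annotation_some; case: (state_annotation st).
Qed.

Lemma onth_outputs i a : onth outputs i = Some a -> exists st,
  [/\ onth (states (m - first_free)) i = Some st, state_ok first_free st,
    a.1 = state_assignment st & Some a.2 = state_annotation st].
Proof.
have : forall st, st \in states (m - first_free) -> state_ok first_free st.
  by move=> st /states_ok.
rewrite /outputs; elim: (states _) i => [|st sts IH] i ok //=; first by case: i.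
have oks := ok st (mem_head _ _); have := state_annotation_some oks.
case ea : (state_annotation st) => [x|] // _; case: i => [|i] /=.
  by case=> <-; exists st.
by apply: IH => st' h; apply: ok; rewrite inE h orbT.
Qed.
End Tables.

(** * The program *)

Notation aCODE := 13 (only parsing).
Notation aFOUND := 14 (only parsing).
Notation aOK := 15 (only parsing).
Notation aVARS := 16 (only parsing).
Notation aBOUND := 17 (only parsing).
Notation aARITY := 18 (only parsing).
Notation aK := 19 (only parsing).
Notation aPLAN := 20 (only parsing).
Notation aLEVEL := 21 (only parsing).
Notation aF := 22 (only parsing).
Notation aJ := 23 (only parsing).
Notation aI := 24 (only parsing).
Notation aC0 := 25 (only parsing).
Notation aC1 := 26 (only parsing).
Notation aC2 := 27 (only parsing).
Notation aFST := 28 (only parsing).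
Notation aSND := 29 (only parsing).
Notation aT := 30 (only parsing).
Notation aEIGHT := 31 (only parsing).
Notation aL := 32 (only parsing).
Notation aP := 33 (only parsing).
Notation aCARD := 34 (only parsing).
Notation aROWS := 35 (only parsing).
Notation aIDX := 36 (only parsing).
Notation aCUR := 37 (only parsing).
Notation aQ := 38 (only parsing).
Notation aROW := 39 (only parsing).
Notation aSG := 40 (only parsing).      (* current assignment *)
Notation aWT := 41 (only parsing).      (* weights of the rows, Bot for None *)
Notation aR := 42 (only parsing).
Notation aV := 43 (only parsing).
Notation aR2 := 44 (only parsing).
Notation aA := 45 (only parsing).
Notation aFL := 46 (only parsing).
Notation aDUP := 47 (only parsing).
Notation aACC := 48 (only parsing).
Notation aVAL := 49 (only parsing).
Notation aMSG := 50 (only parsing).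
Notation aFIRST := 51 (only parsing).
Notation aNEXT := 52 (only parsing).
Notation aCURROW := 53 (only parsing).  (* current row of each table *)
Notation aPOS := 54 (only parsing).
Notation aHIT := 55 (only parsing).
Notation aDONE := 56 (only parsing).
Notation aBOT := 57 (only parsing).     (* never written *)
Notation aX := 58 (only parsing).

Definition rd r : expr := ELoad r [::].
Definition wr r e : cmd := Store r [::] e.
Definition when b c : cmd := If b c Skip.
Definition otherwise b c : cmd := If b Skip c.
Definition plan_at f j i : expr := ELoad aPLAN [:: ENum f; j; i].
Definition var_e j := plan_at 0 j (ENum 0).
Definition scope_b j v := BEq (plan_at 1 j v) (ENum 1).
Definition parent_e j := plan_at 2 j (ENum 0).
Definition host_e a := plan_at 3 a (ENum 0).
Definition level_e j := ELoad aLEVEL [:: j].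
Definition free_b j := BEq (level_e j) (rd 5).
Definition bot_b e := BEq e (rd aBOT).

Infix ";;" := Seq (at level 61, right associativity).

Definition unpair_cmd c : cmd :=
  wr aFST (ENum 0);; wr aSND (ENum 0);;
  For aT c
    (If (BEq (rd aFST) (ENum 0))
       (wr aFST (EAdd (rd aSND) (ENum 1));; wr aSND (ENum 0))
       (wr aFST (ESub (rd aFST) (ENum 1));; wr aSND (EAdd (rd aSND) (ENum 1)))).

(** Only a finite part of the coded plan is stored. The bound exceeds every table, atom, position,
    slot and field number that a check of the plan looks up. *)
Definition guess_cmd : cmd :=
  wr aC0 (rd aCODE);; unpair_cmd aC0;; wr aVARS (rd aFST);; wr aC0 (rd aSND);;
  wr aBOUND (EAdd (EAdd (EAdd (EAdd (rd aVARS) (rd 2)) (rd aARITY)) (rd aK)) (ENum 8));;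
  For aF aEIGHT
    (unpair_cmd aC0;; wr aC1 (rd aFST);; wr aC0 (rd aSND);;
     For aJ aBOUND
       (unpair_cmd aC1;; wr aC2 (rd aFST);; wr aC1 (rd aSND);;
        For aI aBOUND
          (unpair_cmd aC2;; Store aPLAN [:: rd aF; rd aJ; rd aI] (rd aFST);;
           wr aC2 (rd aSND)))).

Definition level_cmd : cmd :=
  For aJ aVARS
    (Store aLEVEL [:: rd aJ] (ENum 0);;
     For aL 5
       (wr aCARD (ELoad 6 [:: rd aL]);;
        For aP aCARD
          (when (BEq (ELoad 7 [:: rd aL; rd aP]) (var_e (rd aJ)))
             (Store aLEVEL [:: rd aJ] (EAdd (rd aL) (ENum 1)))))).

Definition implb_b b1 b2 := BNot (BAnd b1 (BNot b2)).

Definition table_b j : bexp :=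
  BAnd (BAnd (scope_b j j) (BLt j (parent_e j)))
    (BAnd (BLt (parent_e j) (EAdd (rd aVARS) (ENum 1))) (BNot (scope_b (rd aVARS) j))).

Definition var_b j v : bexp :=
  BAnd
    (implb_b (scope_b j v)
      (BAnd (BAnd (BNot (BLt v j)) (implb_b (BNot (BEq v j)) (scope_b (parent_e j) v)))
        (BAnd (BLt (plan_at 5 j v) (rd aK))
          (BEq (ELoad 4 [:: plan_at 4 j (plan_at 5 j v); plan_at 6 j v]) (var_e v)))))
    (implb_b (BLt v j)
      (BAnd (BNot (BEq (var_e v) (var_e j))) (BNot (BLt (level_e j) (level_e v))))).

Definition term_b a p : bexp :=
  implb_b (BNum (ELoad 4 [:: a; p]))
    (BAnd (BLt (plan_at 7 a p) (rd aVARS))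
      (BAnd (BEq (var_e (plan_at 7 a p)) (ELoad 4 [:: a; p]))
        (scope_b (host_e a) (plan_at 7 a p)))).

Definition fail : cmd := wr aOK (ENum 0).

Definition check_cmd : cmd :=
  wr aOK (ENum 1);;
  For aJ aVARS
    (otherwise (table_b (rd aJ)) fail;;
     For aI aVARS (otherwise (var_b (rd aJ) (rd aI)) fail));;
  For aJ 2
    (otherwise (BLt (host_e (rd aJ)) (EAdd (rd aVARS) (ENum 1))) fail;;
     For aI aARITY (otherwise (term_b (rd aJ) (rd aI)) fail)).

Definition search_cmd : cmd :=
  guess_cmd;; level_cmd;; check_cmd;;
  when (BEq (rd aOK) (ENum 1)) (wr aFOUND (ENum 1));;
  wr aCODE (EAdd (rd aCODE) (ENum 1)).

Definition init_cmd k : cmd :=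
  wr aARITY (ENum 0);; For aI 0 (wr aARITY (EAdd (rd aARITY) (ELoad 1 [:: rd aI])));;
  wr aK (ENum k);; wr aEIGHT (ENum 8);; wr aCODE (ENum 0).

(** The power [size D ^ k], with multiplication by repeated addition. *)
Definition rows_cmd : cmd :=
  wr aROWS (ENum 1);;
  For aI aK
    (wr aCUR (ENum 0);; For aT 8 (wr aCUR (EAdd (rd aCUR) (rd aROWS)));; wr aROWS (rd aCUR)).

(** Division by repeated subtraction. The quotients never exceed the row number, so [aROWS] rounds
    are enough. *)
Definition digits_cmd : cmd :=
  wr aCUR (rd aR);;
  For aI aK
    (wr aQ (ENum 0);;
     For aT aROWS
       (otherwise (BLt (rd aCUR) (rd 8))
          (wr aCUR (ESub (rd aCUR) (rd 8));; wr aQ (EAdd (rd aQ) (ENum 1))));;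
     Store aIDX [:: rd aI] (rd aCUR);; wr aCUR (rd aQ)).

Definition read_row_cmd : cmd :=
  For aV aVARS
    (If (scope_b (rd aJ) (rd aV))
       (Store aSG [:: rd aV]
          (ELoad 10 [:: ELoad aIDX [:: plan_at 5 (rd aJ) (rd aV)]; plan_at 6 (rd aJ) (rd aV)]);;
        Store aROW [:: rd aJ; rd aR; rd aV] (ELoad aSG [:: rd aV]))
       (Store aSG [:: rd aV] (rd aBOT))).

Definition load_row_cmd j r : cmd :=
  For aV aVARS
    (If (scope_b j (rd aV)) (Store aSG [:: rd aV] (ELoad aROW [:: j; r; rd aV]))
       (Store aSG [:: rd aV] (rd aBOT))).

(* Compares the row [aR2] of the table [j] with the current assignment, either on
   all the variables of the table or on all but its own one, [j]. *)
Definition agree_cmd j (all_scope : bool) : cmd :=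
  wr aFL (ENum 1);;
  For aV aVARS
    (when (BAnd (scope_b j (rd aV))
                (BNot (BEq (ELoad aROW [:: j; rd aR2; rd aV]) (ELoad aSG [:: rd aV]))))
      (if all_scope then wr aFL (ENum 0) else otherwise (BEq (rd aV) j) (wr aFL (ENum 0)))).

Definition duplicate_cmd : cmd :=
  wr aDUP (ENum 0);;
  For aR2 aROWS
    (agree_cmd (rd aJ) true;;
     when (BAnd (BLt (rd aR2) (rd aR)) (BEq (rd aFL) (ENum 1))) (wr aDUP (ENum 1))).

Definition atom_cmd : cmd :=
  wr aVAL (rd aBOT);;
  For aF 8
    (wr aFL (ENum 1);;
     otherwise (BEq (ELoad 9 [:: rd aF]) (ELoad 3 [:: rd aA])) (wr aFL (ENum 0));;
     For aP aARITY
       (wr aX (ELoad 4 [:: rd aA; rd aP]);;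
        when (BNum (rd aX)) (wr aX (ELoad aSG [:: plan_at 7 (rd aA) (rd aP)]));;
        otherwise (BEq (ELoad 10 [:: rd aF; rd aP]) (rd aX)) (wr aFL (ENum 0)));;
     when (BEq (rd aFL) (ENum 1)) (wr aVAL (ELoad 11 [:: rd aF]))).

Definition message_cmd : cmd :=
  wr aMSG (rd aBOT);;
  For aR2 aROWS
    (agree_cmd (rd aI) false;;
     when (BAnd (BNot (bot_b (ELoad aWT [:: rd aI; rd aR2]))) (BEq (rd aFL) (ENum 1)))
       (If (free_b (rd aI)) (wr aMSG EUnit)
         (If (bot_b (rd aMSG)) (wr aMSG (ELoad aWT [:: rd aI; rd aR2]))
            (wr aMSG (EPlus (level_e (rd aI)) (rd aMSG) (ELoad aWT [:: rd aI; rd aR2])))))).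

Definition weight_cmd : cmd :=
  wr aACC EUnit;;
  For aA 2
    (when (BEq (host_e (rd aA)) (rd aJ)) (atom_cmd;; wr aACC (ETimes (rd aACC) (rd aVAL))));;
  For aI aVARS
    (when (BEq (parent_e (rd aI)) (rd aJ)) (message_cmd;; wr aACC (ETimes (rd aACC) (rd aMSG)))).

Definition tables_cmd : cmd :=
  For aJ aVARS
    (For aR aROWS
       (digits_cmd;; read_row_cmd;; duplicate_cmd;; weight_cmd;;
        otherwise (BAnd (BNot (bot_b (ELoad aSG [:: rd aJ]))) (BEq (rd aDUP) (ENum 0)))
          (wr aACC (rd aBOT));;
        Store aWT [:: rd aJ; rd aR] (rd aACC)));;
  wr aJ (rd aVARS);; weight_cmd;; Store aWT [:: rd aVARS; ENum 0] (rd aACC).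

(* The first row of table [aJ] that agrees with the current assignment and satisfies
   [b]. *)
Definition find_cmd b : cmd :=
  wr aHIT (rd aBOT);;
  For aR2 aROWS
    (agree_cmd (rd aJ) false;;
     when (BAnd (BAnd (BNot (bot_b (ELoad aWT [:: rd aJ; rd aR2]))) (BEq (rd aFL) (ENum 1)))
             (BAnd b (bot_b (rd aHIT))))
       (wr aHIT (rd aR2))).

Definition true_b := BNum (ENum 0).

Definition links_cmd : cmd :=
  For aJ aVARS
    (For aR aROWS
       (load_row_cmd (parent_e (rd aJ)) (rd aR);; find_cmd true_b;;
        Store aFIRST [:: rd aJ; rd aR] (rd aHIT);;
        load_row_cmd (rd aJ) (rd aR);; find_cmd (BLt (rd aR) (rd aR2));;
        Store aNEXT [:: rd aJ; rd aR] (rd aHIT))).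

Definition currow_e j := ELoad aCURROW [:: j].

(** The loop counts upwards, but a parent has a larger number than its children and must be refilled
    first; hence the reversed index [aI]. *)
Definition refill_cmd : cmd :=
  For aT aVARS
    (wr aI (ESub (ESub (rd aVARS) (ENum 1)) (rd aT));;
     when (BAnd (free_b (rd aI)) (BLt (rd aI) (rd aPOS)))
       (Store aCURROW [:: rd aI]
          (ELoad aFIRST [:: rd aI; currow_e (parent_e (rd aI))]))).

Definition output_cmd : cmd :=
  wr aACC (ELoad aWT [:: rd aVARS; ENum 0]);;
  For aJ aVARS
    (when (free_b (rd aJ))
       (Store 12 [:: var_e (rd aJ)] (ELoad aROW [:: rd aJ; currow_e (rd aJ); rd aJ]);;
        wr aACC (ETimes (rd aACC) (ELoad aWT [:: rd aJ; currow_e (rd aJ)]))));;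
  wr 12 (rd aACC).

(** Without a root weight there is no answer, and [aDONE] is set before the first exit test;
    whatever [output_cmd] then writes is never output. *)
Definition start_cmd : cmd :=
  Store aCURROW [:: rd aVARS] (ENum 0);; wr aPOS (rd aVARS);; refill_cmd;;
  when (bot_b (ELoad aWT [:: rd aVARS; ENum 0])) (wr aDONE (ENum 1));; output_cmd.

(** Separated from [rows_cmd] because [cost_le] wants loop bounds that the command does not write:
    [aROWS] is computed there and bounds loops here. *)
Definition tables_phase : cmd := tables_cmd;; links_cmd;; start_cmd.

Definition data_cmd : cmd := rows_cmd;; tables_phase.

(** [aHIT] records the smallest free table whose row has a successor; the free tables below it are
    refilled. All loops are over variables, so the time does not depend on the database. *)
Definition advance_cmd : cmd :=
  wr aHIT (rd aBOT);;
  For aJ aVARS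
    (when (BAnd (BAnd (free_b (rd aJ)) (bot_b (rd aHIT)))
             (BNot (bot_b (ELoad aNEXT [:: rd aJ; currow_e (rd aJ)]))))
       (Store aCURROW [:: rd aJ] (ELoad aNEXT [:: rd aJ; currow_e (rd aJ)]);;
        wr aHIT (rd aJ)));;
  If (bot_b (rd aHIT)) (wr aDONE (ENum 1))
    (wr aPOS (rd aHIT);; refill_cmd);;
  output_cmd.

Ltac mem := repeat match goal with
  | |- context [update ?m ?a ?i ?v ?a'] =>
      first [ rewrite (@update_neq _ _ m a i v a' isT)
            | change (update m a i v a') with (fun i' => if i' == i then v else m a i'); cbv beta ]
  end.

Ltac seqs := repeat match goal with
  | |- context [den (Seq ?a ?b) ?m] => change (den (Seq a b) m) with (den b (den a m))
  end.

(** * Loop rules and the specification of the plan search *)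

Section Specifications.
Variables (Const : eqType) (g : query Const).
Local Notation K := (carrier g).
Local Notation memory := (memory Const K).
Local Notation value := (value Const K).
Implicit Types (m : memory).

Definition keeps (W : seq nat) m m' : Prop := forall a, a \notin W -> m' a = m a.

(** The rule for loop invariants. The frame [keeps] is supplied separately, so that an invariant
    needs to mention only what the loop changes. *)
Lemma for_ind i b c m n (P : nat -> memory -> Prop) :
  m b [::] = Num n ->
  P 0 (set_reg m i (Num 0)) ->
  (forall t m', t < n -> m' i [::] = Num t -> keeps (i :: writes c) m m' -> P t m' ->
     P t.+1 (set_reg (den c m') i (Num t.+1))) ->
  P n (den (For i b c) m).
Proof.
move=> hb h0 hS; rewrite /= /get hb /=.
suff gen t : t <= n ->
   let m' := iteri t (fun t m' => set_reg (den c m') i (Num t.+1)) (set_reg m i (Num 0)) in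
   [/\ m' i [::] = Num t, keeps (i :: writes c) m m' & P t m'] by case: (gen n (leqnn n)).
elim: t => [_|t IH lt_n] /=.
  split=> //; first by rewrite /set_reg /update !eqxx.
  by move=> a; rewrite inE negb_or => /andP[ai _]; rewrite /set_reg update_neq.
have [h1 h2 h3] := IH (ltnW lt_n); split; last exact: hS.
  by rewrite /set_reg /update !eqxx.
move=> a aW; have := aW; rewrite inE negb_or => /andP[ai ac].
by rewrite /set_reg update_neq // den_frame // h2.
Qed.

(* A loop whose body acts on a part [S] of the memory as a function of that part. *)
Lemma for_iteri (T : Type) (S : memory -> T) (F : nat -> T -> T) i b c m n :
  m b [::] = Num n ->
  (forall m' v, S (set_reg m' i v) = S m') ->
  (forall t m', t < n -> m' i [::] = Num t -> keeps (i :: writes c) m m' ->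
     S (den c m') = F t (S m')) ->
  S (den (For i b c) m) = iteri n F (S m).
Proof.
move=> hb hi hS.
apply: (@for_ind i b c m n (fun t m' => S m' = iteri t F (S m)) hb) => [|t m' tn it kp /= <-].
  by rewrite hi.
by rewrite hi (hS t).
Qed.

Lemma unpair_spec c m n : c != aFST -> c != aSND -> m c [::] = Num n ->
  let m' := den (unpair_cmd c) m in
  m' aFST [::] = Num (unpair n).1 /\ m' aSND [::] = Num (unpair n).2.
Proof.
move=> c1 c2 hc; rewrite /unpair_cmd; seqs; set body := If _ _ _.
set m1 := den _ (den _ m).
have [e1 e2] : m1 aFST [::] = Num 0 /\ m1 aSND [::] = Num 0 by [].
have ec : m1 c [::] = Num n.
  by rewrite /m1 /= !update_neq // eq_sym.
apply: (@for_ind aT c body m1 n (fun t m' =>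
   m' aFST [::] = Num (unpair t).1 /\ m' aSND [::] = Num (unpair t).2) ec).
  by rewrite /set_reg; mem.
move=> t m' tn _ _; rewrite -[unpair t.+1]/(unpair_step (unpair t)).
case: (unpair t) => [[|x] y] [/= h1 h2]; rewrite /body /= /load /= h1 /= /load /= ?h1 ?h2 /=.
  by rewrite /set_reg; mem; rewrite /= addn1.
by rewrite /set_reg /load /=; mem; rewrite /= h2 /= addn1 subn1.
Qed.

Definition num1 i : seq (key Const) := [:: inl i].
Definition num2 i j : seq (key Const) := [:: inl i; inl j].
Definition num3 i j l : seq (key Const) := [:: inl i; inl j; inl l].

Lemma eq_num1 i i' : (num1 i == num1 i') = (i == i').
Proof. by rewrite /num1 !eqseq_cons andbT. Qed.
Lemma eq_num2 i j i' j' : (num2 i j == num2 i' j') = (i == i') && (j == j').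
Proof. by rewrite /num2 !eqseq_cons andbT. Qed.
Lemma eq_num3 i j l i' j' l' :
  (num3 i j l == num3 i' j' l') = [&& i == i', j == j' & l == l'].
Proof. by rewrite /num3 !eqseq_cons andbT. Qed.

Lemma guess_row m c b f j : m aC2 [::] = Num c -> m aBOUND [::] = Num b ->
  m aF [::] = Num f -> m aJ [::] = Num j ->
  let m' := den (For aI aBOUND
     (unpair_cmd aC2;; Store aPLAN [:: rd aF; rd aJ; rd aI] (rd aFST);; wr aC2 (rd aSND))) m in
  forall f' j' i', m' aPLAN (num3 f' j' i') =
    if [&& f' == f, j' == j & i' < b] then Num (decode c i') else m aPLAN (num3 f' j' i').
Proof.
move=> hc hb hf hj; set body := unpair_cmd _;; _.
pose inv t m' := m' aC2 [::] = Num (iter t (fun c => (unpair c).2) c) /\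
  forall f' j' i', m' aPLAN (num3 f' j' i') =
    if [&& f' == f, j' == j & i' < t] then Num (decode c i') else m aPLAN (num3 f' j' i').
suff [] : inv b (den (For aI aBOUND body) m) by [].
apply: (@for_ind aI aBOUND body m b inv hb).
  by split=> [|f' j' i']; rewrite /set_reg; mem; rewrite // ?ltn0 !andbF.
move=> t m' tn it kp [h1 h2]; rewrite /body; seqs.
have [u1 u2] := @unpair_spec aC2 m' _ isT isT h1.
set m1 := den (unpair_cmd aC2) m' in u1 u2 *.
have fr a : a \notin writes (unpair_cmd aC2) -> m1 a = m' a by apply: den_frame.
have ef : m1 aF [::] = Num f by rewrite (fr aF isT) (kp aF isT).
have ej : m1 aJ [::] = Num j by rewrite (fr aJ isT) (kp aJ isT).
have ei : m1 aI [::] = Num t by rewrite (fr aI isT).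
rewrite /= /load /= ef ej ei /= u1; rewrite /set_reg.
split=> [|f' j' i']; mem; first by rewrite /= u2.
rewrite -/(num3 _ _ _) eq_num3 ltnS [i' <= t]leq_eqVlt (fr aPLAN isT) h2.
case: (f' == f); case: (j' == j) => //=; case: (eqVneq i' t) => [->|] //=.
Qed.

Lemma guess_table m c b f : m aC1 [::] = Num c -> m aBOUND [::] = Num b ->
  m aF [::] = Num f ->
  let m' := den (For aJ aBOUND
       (unpair_cmd aC1;; wr aC2 (rd aFST);; wr aC1 (rd aSND);;
        For aI aBOUND
          (unpair_cmd aC2;; Store aPLAN [:: rd aF; rd aJ; rd aI] (rd aFST);;
           wr aC2 (rd aSND)))) m in
  forall f' j' i', m' aPLAN (num3 f' j' i') =
    if [&& f' == f, j' < b & i' < b] then Num (decode (decode c j') i')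
    else m aPLAN (num3 f' j' i').
Proof.
move=> hc hb hf; set inner := For aI _ _; set body := unpair_cmd _;; _.
pose inv t m' := m' aC1 [::] = Num (iter t (fun c => (unpair c).2) c) /\
  forall f' j' i', m' aPLAN (num3 f' j' i') =
    if [&& f' == f, j' < t & i' < b] then Num (decode (decode c j') i')
    else m aPLAN (num3 f' j' i').
suff [] : inv b (den (For aJ aBOUND body) m) by [].
apply: (@for_ind aJ aBOUND body m b inv hb).
  by split=> [|f' j' i']; rewrite /set_reg; mem; rewrite // ?ltn0 !andbF.
move=> t m' tn it kp [h1 h2]; rewrite /body; seqs.
have [u1 u2] := @unpair_spec aC1 m' _ isT isT h1.
set m1 := den (unpair_cmd aC1) m' in u1 u2 *.
have fr a : a \notin writes (unpair_cmd aC1) -> m1 a = m' a by apply: den_frame.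
set m2 := den (wr aC1 _) _.
have e1 : m2 aC1 [::] = Num (iter t.+1 (fun c => (unpair c).2) c).
  by rewrite /m2 /= /load /= /set_reg; mem; rewrite /= -u2; mem.
have e2 : m2 aC2 [::] = Num (decode c t).
  by rewrite /m2 /= /load /= /set_reg; mem; rewrite /= u1.
have eb : m2 aBOUND [::] = Num b by rewrite /m2 /m1 !den_frame // (kp aBOUND isT).
have ef : m2 aF [::] = Num f by rewrite /m2 /m1 !den_frame // (kp aF isT).
have ej : m2 aJ [::] = Num t by rewrite /m2 /m1 !den_frame.
have hrow := guess_row e2 eb ef ej; rewrite -/inner in hrow.
have e1' : den inner m2 aC1 [::] = m2 aC1 [::] by rewrite (@den_frame _ _ inner m2 26 isT).
split=> [|f' j' i']; rewrite /set_reg; mem; first by rewrite e1'.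
rewrite hrow; have -> : m2 aPLAN = m' aPLAN by rewrite /m2 /m1 !den_frame.
rewrite h2 ltnS [j' <= t]leq_eqVlt.
by case: (f' == f) => //=; case: (eqVneq j' t) => [->|] //=; case: (i' < b); rewrite ?andbF.
Qed.

Lemma guess_spec m n l ar k : m aCODE [::] = Num n -> m 2 [::] = Num l ->
  m aARITY [::] = Num ar -> m aK [::] = Num k -> m aEIGHT [::] = Num 8 ->
  let b := (unpair n).1 + l + ar + k + 8 in
  let m' := den guess_cmd m in
  m' aVARS [::] = Num (unpair n).1 /\
  forall f j i, f < 8 -> j < b -> i < b ->
    m' aPLAN (num3 f j i) = Num (decode3 (unpair n).2 f j i).
Proof.
move=> hn hl har hk h8 b; rewrite /guess_cmd.
set outer := For aF _ _; seqs.
set m0 := den (wr aC0 _) m.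
have e0 : m0 aC0 [::] = Num n by rewrite /m0 /= /load /= /set_reg; mem; rewrite /= hn.
have [u1 u2] := @unpair_spec aC0 m0 _ isT isT e0.
set m1 := den (unpair_cmd aC0) m0 in u1 u2 *.
set m2 := den (wr aBOUND _) _.
have v2 : m2 aVARS [::] = Num (unpair n).1.
  by rewrite /m2 /= /load /= /set_reg; mem; rewrite /= u1.
have c2 : m2 aC0 [::] = Num (unpair n).2.
  by rewrite /m2 /= /load /= /set_reg; mem; rewrite /= u2.
have b2 : m2 aBOUND [::] = Num b.
  rewrite /m2 /= /load /= /set_reg; mem; rewrite /= u1.
  by rewrite /m1 /m0 !den_frame // hl har hk.
have e2 : m2 aEIGHT [::] = Num 8.
  by rewrite /m2 /m1 /m0 !den_frame.
have fr3 a : a \notin writes outer -> den outer m2 a = m2 a by apply: den_frame.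
split; first by rewrite (fr3 aVARS isT).
pose inv t m' := m' aC0 [::] = Num (iter t (fun c => (unpair c).2) (unpair n).2) /\
  forall f j i, f < t -> j < b -> i < b ->
    m' aPLAN (num3 f j i) = Num (decode3 (unpair n).2 f j i).
suff [] : inv 8 (den outer m2) by [].
rewrite /outer; set body := unpair_cmd _;; _; apply: (@for_ind aF aEIGHT body m2 8 inv e2).
  by split=> [|f j i]; rewrite /set_reg; mem.
move=> t m' tn it kp [h1 h2]; rewrite /body; seqs.
have [w1 w2] := @unpair_spec aC0 m' _ isT isT h1.
set m3 := den (unpair_cmd aC0) m' in w1 w2 *.
set m4 := den (wr aC0 _) _.
have e4 : m4 aC0 [::] = Num (iter t.+1 (fun c => (unpair c).2) (unpair n).2).
  by rewrite /m4 /= /load /= /set_reg; mem; rewrite /= -w2; mem.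
have c4 : m4 aC1 [::] = Num (decode (unpair n).2 t).
  by rewrite /m4 /= /load /= /set_reg; mem; rewrite /= w1.
have b4 : m4 aBOUND [::] = Num b by rewrite /m4 /m3 !den_frame // (kp aBOUND isT).
have f4 : m4 aF [::] = Num t by rewrite /m4 /m3 !den_frame.
have htab := guess_table c4 b4 f4.
set inner := For aJ _ _ in htab *.
have e4' : den inner m4 aC0 [::] = m4 aC0 [::] by rewrite (@den_frame _ _ inner m4 25 isT).
split=> [|f j i ft jb ib]; rewrite /set_reg; mem; first by rewrite e4'.
rewrite htab jb ib !andbT; have -> : m4 aPLAN = m' aPLAN by rewrite /m4 /m3 !den_frame.
case: eqVneq => [->|nf] //.
by rewrite h2 //; move: ft nf; clear; lia.
Qed.

Lemma iteri_if (T : Type) n (p : pred nat) (w v : T) :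
  iteri n (fun t v => if p t then w else v) v = if has p (iota 0 n) then w else v.
Proof.
elim: n => // n IH; rewrite [iteri _ _ _]/= IH -[n.+1]addn1 iotaD has_cat /= orbF orbC.
by case: (p n).
Qed.

Lemma iteri_unless (T : Type) n (p : pred nat) (w v : T) :
  iteri n (fun t v => if p t then v else w) v = if all p (iota 0 n) then v else w.
Proof.
elim: n => // n IH; rewrite [iteri _ _ _]/= IH -[n.+1]addn1 iotaD all_cat /= andbT andbC.
by case: (p n).
Qed.

Definition vcst (o : option Const) : value := oapp Cst Bot o.
Definition vann (o : option K) : value := oapp Ann Bot o.
Definition vnum (o : option nat) : value := oapp Num Bot o.
Definition vterm (o : option (term Const)) : value :=
  oapp (fun t : term Const => match t with inl x => Num x | inr c => Cst c end) Bot o.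

Section StaticMemory.
Variables (D : seq (fact Const)) (nu : fact Const -> K) (k nv : nat).
Variable pl : nat -> nat -> nat -> nat.
Let bound := nv + size (body g) + max_arity g + k + 8.

(** The plan is known below [bound] only, as no more of it has been decoded; each access to it has
    to be justified by a bound on its indices. *)
Definition base m : Prop :=
  [/\ forall a, a < 12 -> m a = @input_memory Const g D nu a,
      m aVARS [::] = Num nv, m aARITY [::] = Num (max_arity g), m aK [::] = Num k
    & (m aBOT [::] = Bot /\ forall f j i, f < 8 -> j < bound -> i < bound ->
         m aPLAN (num3 f j i) = Num (pl f j i))].

Definition has_levels m : Prop :=
  forall j, j < nv -> m aLEVEL (num1 j) = Num (level g (var_at pl j)).

Definition base_arrays := iota 0 12 ++ [:: aVARS; aARITY; aK; aPLAN; aBOT].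

Lemma base_keeps W m m' : all [predC W] base_arrays -> keeps W m m' -> base m -> base m'.
Proof.
move=> /allP hW kp; have e a : a \in base_arrays -> m' a = m a by move=> h; apply: kp; apply: hW.
case=> h1 h2 h3 h4 [h5 h6]; split; rewrite ?(e 16) ?(e 18) ?(e 19) //.
  by move=> a ha; rewrite e ?h1 // mem_cat mem_iota ha.
by rewrite (e 57) // (e 20).
Qed.

Lemma base_den c m : all [predC writes c] base_arrays -> base m -> base (den c m).
Proof. by move=> h; apply: (base_keeps h) => a ha; apply: den_frame. Qed.

Lemma eval_plan m f ej ei j i : base m -> eval m ej = Num j -> eval m ei = Num i ->
  f < 8 -> j < bound -> i < bound -> eval m (plan_at f ej ei) = Num (pl f j i).
Proof. by case=> _ _ _ _ [_ h] /= -> ->; exact: h. Qed.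

Lemma var_in_bound j : j <= nv -> j < bound.
Proof. by rewrite /bound; clear; lia. Qed.

Lemma base_input m a : base m -> a < 12 -> m a = @input_memory Const g D nu a.
Proof. by case=> h _ _ _ _; apply: h. Qed.

Lemma level_spec m : base m -> has_levels (den level_cmd m).
Proof.
move=> bm; rewrite /level_cmd.
set inner := For aL 5 _; set body := Store _ _ _;; _.
have hn : m aVARS [::] = Num nv by case: bm.
pose inv t m' := forall j, j < t -> j < nv -> m' aLEVEL (num1 j) = Num (level g (var_at pl j)).
suff h : inv nv (den (For aJ aVARS body) m) by move=> j jn; apply: h.
apply: (@for_ind aJ aVARS body m nv inv hn); first by move=> j; rewrite ltn0.
move=> t m' tn it kp h.
have bm' : base m' by apply: (base_keeps _ kp bm).
set m1 := den (Store aLEVEL [:: rd aJ] (ENum 0)) m'.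
have l1 j : m1 aLEVEL (num1 j) = if j == t then Num 0 else m' aLEVEL (num1 j).
  by rewrite /m1 /= /load /= it /=; mem; rewrite -/(num1 _) eq_num1.
have it1 : m1 aJ [::] = Num t by rewrite /m1 den_frame.
have bm1 : base m1 by apply: base_den bm'.
have hn1 : m1 5 [::] = Num (size (proj_sets g)) by rewrite (base_input bm1).
have key j : den inner m1 aLEVEL (num1 j) =
    if j == t then Num (level g (var_at pl t)) else m1 aLEVEL (num1 j).
  pose F L (v : value) := if var_at pl t \in nth fset0 (proj_sets g) L then Num L.+1 else v.
  have e := @for_iteri _ (fun m => m aLEVEL (num1 j))
    (fun L v => if j == t then F L v else v) aL 5 _ m1 _ hn1.
  rewrite e {e}; [|by move=> m2 v; rewrite /set_reg; mem|].
    rewrite l1; case: (j == t); last by elim: (size _).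
    rewrite /level; elim: (size _) => //= n ->; by rewrite /F; case: ifP.
  move=> L m2 Ln iL kp2; have bm2 : base m2 by apply: (base_keeps _ kp2 bm1).
  have := onthTE (proj_sets g) L; rewrite Ln; case eX : (onth _ _) => [X|] // _.
  rewrite /F (@onth_nth _ fset0 X _ _ eX) -[in X in X = _]/(den (_;; _) m2); seqs.
  set m3 := den (wr aCARD _) m2.
  have bm3 : base m3 by apply: base_den bm2.
  have cd : m3 aCARD [::] = Num (size (enum_fset X)).
    rewrite /m3 /= /load /= /load /= iL /=; mem.
    by rewrite (base_input bm2) //= eX.
  have jt3 : m3 aJ [::] = Num t by rewrite /m3 den_frame // (kp2 aJ isT).
  have iL3 : m3 aL [::] = Num L by rewrite /m3 den_frame.
  have -> : m2 aLEVEL (num1 j) = m3 aLEVEL (num1 j) by rewrite /m3 den_frame.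
  have e := @for_iteri _ (fun m => m aLEVEL (num1 j))
    (fun p v => if (j == t) && (nth 0 (enum_fset X) p == var_at pl t) then Num L.+1 else v) aP aCARD _ m3 _ cd.
  rewrite e {e}; [|by move=> m4 v; rewrite /set_reg; mem|].
    rewrite iteri_if; case: (j == t) => /=; last by rewrite has_pred0.
    congr (if _ then _ else _); apply/hasP/idP => [[p]|xX].
      by rewrite mem_iota => pn /eqP <-; apply: mem_nth.
    exists (index (var_at pl t) (enum_fset X)); first by rewrite mem_iota index_mem.
    by rewrite nth_index.
  move=> p m4 pn ip kp4; have bm4 : base m4 by apply: (base_keeps _ kp4 bm3).
  have ej : eval m4 (rd aJ) = Num t by rewrite /= /load /= (kp4 aJ isT).
  have ex := eval_plan bm4 ej (erefl (eval m4 (ENum 0))) (isT : 0 < 8) (var_in_bound (ltnW tn)) (var_in_bound (leq0n _)).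
  have iL4 : m4 aL [::] = Num L by rewrite (kp4 aL isT).
  have e7 : eval m4 (ELoad 7 [:: rd aL; rd aP]) = Num (nth 0 (enum_fset X) p).
    rewrite /= /load /= /load /= ip iL4 /=.
    rewrite (base_input bm4) //= eX /=; have := onthTE (enum_fset X) p; rewrite pn.
    by case ep : (onth _ _) => [x|] // _; rewrite (@onth_nth _ 0 x _ _ ep).
  rewrite /when; set bb := BEq _ _; have -> : den (If bb (Store aLEVEL [:: rd aJ] (EAdd (rd aL) (ENum 1))) Skip) m4
     = if beval m4 bb then den (Store aLEVEL [:: rd aJ] (EAdd (rd aL) (ENum 1))) m4 else m4 by [].
  have -> : beval m4 bb = (nth 0 (enum_fset X) p == var_at pl t).
    by rewrite /bb -[beval _ _]/(veq (eval _ _) (eval _ _)) e7 ex.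
  case: (nth _ _ _ == _); last by rewrite andbF.
  rewrite andbT; move: ej; rewrite /= /load /= => -> /=; rewrite iL4 /=; mem.
  by rewrite -/(num1 _) eq_num1 addn1.
move=> j jt jn; rewrite /body; seqs; rewrite -/m1 /set_reg; mem.
rewrite key l1; case: eqVneq => [->//|nj]; apply: h => //.
by move: jt nj; clear; lia.
Qed.

Lemma eval_rd m r v : m r [::] = v -> eval m (rd r) = v.
Proof. by []. Qed.

Lemma den_if m b c1 c2 : den (If b c1 c2) m = if beval m b then den c1 m else den c2 m.
Proof. by []. Qed.

Lemma beval_eq m e1 e2 v1 v2 : eval m e1 = v1 -> eval m e2 = v2 ->
  beval m (BEq e1 e2) = veq v1 v2.
Proof. by move=> /= -> ->. Qed.

Lemma beval_lt m e1 e2 n1 n2 : eval m e1 = Num n1 -> eval m e2 = Num n2 ->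
  beval m (BLt e1 e2) = (n1 < n2).
Proof. by move=> /= -> ->. Qed.

Lemma beval_and m b1 b2 : beval m (BAnd b1 b2) = beval m b1 && beval m b2.
Proof. by []. Qed.

Lemma beval_not m b : beval m (BNot b) = ~~ beval m b.
Proof. by []. Qed.

Lemma beval_impl m b1 b2 : beval m (implb_b b1 b2) = (beval m b1 ==> beval m b2).
Proof. by rewrite /= negb_and negbK implybE. Qed.

Lemma eval_var m ej j : base m -> eval m ej = Num j -> j <= nv ->
  eval m (var_e ej) = Num (var_at pl j).
Proof. by move=> bm ej' jn; apply: eval_plan; rewrite ?var_in_bound. Qed.

Lemma beval_scope m ej ev j v : base m -> eval m ej = Num j -> eval m ev = Num v ->
  j < bound -> v < bound -> beval m (scope_b ej ev) = scope pl j v.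
Proof.
by move=> bm ej' ev' jn vn; rewrite (beval_eq (eval_plan bm ej' ev' (isT : 1 < 8) jn vn) erefl).
Qed.

Lemma eval_parent m ej j : base m -> eval m ej = Num j -> j <= nv ->
  eval m (parent_e ej) = Num (parent pl j).
Proof. by move=> bm ej' jn; apply: eval_plan; rewrite ?var_in_bound. Qed.

Lemma host_in_bound a : a < size (body g) -> a < bound.
Proof. by rewrite /bound; clear; lia. Qed.

Lemma eval_host m ea a : base m -> eval m ea = Num a -> a < size (body g) ->
  eval m (host_e ea) = Num (host pl a).
Proof. move=> bm ea' an; apply: eval_plan => //; [exact: host_in_bound | exact: var_in_bound]. Qed.

Lemma eval_level m ej j : has_levels m -> eval m ej = Num j -> j < nv ->
  eval m (level_e ej) = Num (level g (var_at pl j)).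
Proof. by move=> lm /= -> jn; apply: lm. Qed.

Lemma eval_term m ea ep a p : base m -> eval m ea = Num a -> eval m ep = Num p ->
  eval m (ELoad 4 [:: ea; ep]) = vterm (term_at g a p).
Proof. by move=> bm /= -> ->; rewrite /load /= (base_input bm). Qed.

Lemma veq_term o x : veq (vterm o) (Num x) = (o == Some (inl x)).
Proof. by case: o => [[y|c]|]. Qed.

Lemma beval_table m ej j : base m -> eval m ej = Num j -> j < nv ->
  beval m (table_b ej) =
  [&& scope pl j j, j < parent pl j, parent pl j < nv.+1 & ~~ scope pl nv j].
Proof.
move=> bm hj jn; have jb := var_in_bound (ltnW jn).
have hv : eval m (rd aVARS) = Num nv by case: bm.
rewrite /table_b !beval_and beval_not (beval_scope bm hj hj jb jb).
rewrite (beval_scope bm hv hj (var_in_bound (leqnn _)) jb).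
rewrite (beval_lt hj (eval_parent bm hj (ltnW jn))).
have h1 : eval m (EAdd (rd aVARS) (ENum 1)) = Num nv.+1.
  by rewrite /= -[load _ _ _]/(eval m (rd aVARS)) hv /= addn1.
by rewrite (beval_lt (eval_parent bm hj (ltnW jn)) h1) -!andbA.
Qed.

Lemma beval_var m ej ev j v : base m -> has_levels m -> eval m ej = Num j ->
  eval m ev = Num v -> j < nv -> v < nv -> parent pl j <= nv ->
  beval m (var_b ej ev) = valid_var g k pl j v.
Proof.
move=> bm lm hj hv jn vn pn.
have jb := var_in_bound (ltnW jn); have vb := var_in_bound (ltnW vn).
rewrite /var_b !(beval_and, beval_impl) !beval_not (beval_scope bm hj hv jb vb).
rewrite (beval_lt hv hj) (beval_eq hv hj).
rewrite (beval_scope bm (eval_parent bm hj (ltnW jn)) hv (var_in_bound pn) vb).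
rewrite (beval_eq (eval_var bm hv (ltnW vn)) (eval_var bm hj (ltnW jn))).
rewrite (beval_lt (eval_level lm hj jn) (eval_level lm hv vn)).
have hs := eval_plan bm hj hv (isT : 5 < 8) jb vb.
have hk : eval m (rd aK) = Num k by case: bm.
rewrite (beval_lt hs hk) /valid_var -!andbA.
congr (_ && _); congr (_ ==> _); congr [&& _, _ & _].
(* The guard is looked up at index [slot pl j v], which lies in the decoded range only if the
   preceding test succeeds; if it fails, both sides are false. *)
rewrite -/(slot pl j v); case sk : (slot pl j v < k) => //=.
have sb : slot pl j v < bound by move: sk; rewrite /bound; clear; lia.
have hG := eval_plan bm hj hs (isT : 4 < 8) jb sb.
have hp := eval_plan bm hj hv (isT : 6 < 8) jb vb.
rewrite -[X in X = _]/(beval m (BEq (ELoad 4 [:: plan_at 4 ej (plan_at 5 ej ev); plan_at 6 ej ev]) (var_e ev))).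
by rewrite (beval_eq (eval_term bm hG hp) (eval_var bm hv (ltnW vn))) veq_term.
Qed.

Lemma beval_term m ea ep a p : base m -> eval m ea = Num a -> eval m ep = Num p ->
  a < size (body g) -> p < max_arity g -> host pl a <= nv ->
  beval m (term_b ea ep) = valid_term g nv pl a p.
Proof.
move=> bm ha hp an pn hn; have ab := host_in_bound an.
have pb : p < bound by move: pn; rewrite /bound; clear; lia.
have ht := eval_term bm ha hp; have hT := eval_plan bm ha hp (isT : 7 < 8) ab pb.
rewrite /term_b beval_impl !beval_and (_ : beval m (BNum _) = is_num (vterm (term_at g a p))); last first.
  by rewrite -ht.
have hv : eval m (rd aVARS) = Num nv by case: bm.
rewrite (beval_lt hT hv) /valid_term; case et : (term_at g a p) ht => [[x|c]|] //= ht.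
rewrite -/(term_var pl a p); case tn : (term_var pl a p < nv) => //=.
have e1 := eval_var bm hT (ltnW tn).
have {}ht : eval m (ELoad 4 [:: ea; ep]) = Num x := ht.
rewrite -[veq _ _]/(beval m (BEq (var_e (plan_at 7 ea ep)) (ELoad 4 [:: ea; ep]))).
rewrite (beval_eq e1 ht) -[X in _ && X]/(beval m (scope_b (host_e ea) (plan_at 7 ea ep))).
by rewrite (beval_scope bm (eval_host bm ha an) hT) // var_in_bound // ltnW.
Qed.

Lemma levels_den c m : aLEVEL \notin writes c -> has_levels m -> has_levels (den c m).
Proof. by move=> h lm j jn; rewrite den_frame // lm. Qed.

Lemma den_otherwise_fail m b :
  den (otherwise b fail) m aOK [::] = if beval m b then m aOK [::] else Num 0.
Proof. by rewrite /otherwise den_if; case: ifP => // _; rewrite /=; mem. Qed.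

Lemma check_spec m : base m -> has_levels m ->
  den check_cmd m aOK [::] = Num (valid_plan g k nv pl).
Proof.
move=> bm lm; rewrite /check_cmd; seqs.
set m0 := den (wr aOK (ENum 1)) m.
set loop1 := For aJ aVARS _; set loop2 := For aJ 2 _.
have bm0 : base m0 by apply: base_den bm.
have lm0 : has_levels m0 by apply: levels_den lm.
have ok0 : m0 aOK [::] = Num 1 by rewrite /m0 /=; mem.
have v0 : m0 aVARS [::] = Num nv by case: bm0.
have h1 : den loop1 m0 aOK [::] =
    iteri nv (fun j v => if valid_table g k nv pl j then v else Num 0) (m0 aOK [::]).
  apply: (@for_iteri _ (fun m => m aOK [::])) => //.
  move=> j m1 jn ij kp; seqs; set m2 := den (otherwise _ fail) m1.
  have bm1 : base m1 by apply: (base_keeps _ kp bm0).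
  have lm1 : has_levels m1 by move=> j' jn'; rewrite (kp aLEVEL isT) lm0.
  have ok2 : m2 aOK [::] = if [&& scope pl j j, j < parent pl j, parent pl j < nv.+1 & ~~ scope pl nv j]
                           then m1 aOK [::] else Num 0.
    by rewrite /m2 den_otherwise_fail (beval_table bm1 (eval_rd ij) jn).
  have bm2 : base m2 by apply: base_den bm1.
  have lm2 : has_levels m2 by apply: levels_den lm1.
  have v2 : m2 aVARS [::] = Num nv by case: bm2.
  have ij2 : m2 aJ [::] = Num j by rewrite /m2 den_frame.
  case et : [&& _, _, _ & _] ok2 => ok2.
    have pn : parent pl j <= nv by case/and4P: et.
    have -> : valid_table g k nv pl j = all (valid_var g k pl j) (iota 0 nv).
      by rewrite /valid_table; case/and4P: et => -> -> -> ->.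
    rewrite -iteri_unless -ok2.
    apply: (@for_iteri _ (fun m => m aOK [::])) => //.
    move=> v m3 vn iv kp3; rewrite den_otherwise_fail.
    have bm3 : base m3 by apply: (base_keeps _ kp3 bm2).
    have lm3 : has_levels m3 by move=> j' jn'; rewrite (kp3 aLEVEL isT) lm2.
    by rewrite (beval_var bm3 lm3 (eval_rd _) (eval_rd iv) jn vn pn) // (kp3 aJ isT).
  (* After a failed table test the parent may lie outside the decoded part, so the tests of the
     inner loop are unpredictable. They can only write 0 to [aOK], which is 0 already. *)
  have -> : valid_table g k nv pl j = false.
    by rewrite /valid_table; move: et; case: (scope _ _ _); case: (_ < parent _ _);
       case: (parent _ _ < _); case: (scope _ _ _).
  apply: (@for_ind aI aVARS _ m2 nv (fun _ m => m aOK [::] = Num 0) v2).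
    by rewrite /set_reg; mem.
  move=> v m3 _ _ _ ok3; rewrite /set_reg; mem; rewrite den_otherwise_fail ok3.
  by case: ifP.
have bm1 : base (den loop1 m0) by apply: base_den bm0.
have l1 : den loop1 m0 2 [::] = Num (size (body g)) by rewrite (base_input bm1).
have h2 : den loop2 (den loop1 m0) aOK [::] =
    iteri (size (body g)) (fun a v => if valid_atom g nv pl a then v else Num 0)
      (den loop1 m0 aOK [::]).
  apply: (@for_iteri _ (fun m => m aOK [::])) => //.
  move=> a m1 an ia kp; seqs; set m2 := den (otherwise _ fail) m1.
  have bm1' : base m1 by apply: (base_keeps _ kp bm1).
  have va : eval m1 (EAdd (rd aVARS) (ENum 1)) = Num nv.+1.
    by case: bm1' => _ e _ _ _; rewrite /= /load /= e /= addn1.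
  have ok2 : m2 aOK [::] = if host pl a < nv.+1 then m1 aOK [::] else Num 0.
    by rewrite /m2 den_otherwise_fail (beval_lt (eval_host bm1' (eval_rd ia) an) va).
  have bm2 : base m2 by apply: base_den bm1'.
  have v2 : m2 aARITY [::] = Num (max_arity g) by case: bm2.
  case et : (_ < _) ok2 => ok2.
    have -> : valid_atom g nv pl a = all (valid_term g nv pl a) (iota 0 (max_arity g)).
      by rewrite /valid_atom et.
    rewrite -iteri_unless -ok2.
    apply: (@for_iteri _ (fun m => m aOK [::])) => //.
    move=> p m3 pn ip kp3; rewrite den_otherwise_fail.
    have bm3 : base m3 by apply: (base_keeps _ kp3 bm2).
    rewrite (beval_term bm3 (eval_rd _) (eval_rd ip) an pn) //.
    by rewrite (kp3 aJ isT) /m2 den_frame.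
  have -> : valid_atom g nv pl a = false by rewrite /valid_atom et.
  apply: (@for_ind aI aARITY _ m2 _ (fun _ m => m aOK [::] = Num 0) v2).
    by rewrite /set_reg; mem.
  move=> p m3 _ _ _ ok3; rewrite /set_reg; mem; rewrite den_otherwise_fail ok3.
  by case: ifP.
rewrite h2 iteri_unless h1 iteri_unless ok0 /valid_plan.
by case: (all _ _); case: (all _ _).
Qed.
End StaticMemory.

Lemma den_input c m a : a < 12 -> all (leq 12) (writes c) -> den c m a = m a.
Proof.
move=> ha /allP h; apply: den_frame; apply/negP => /h; by rewrite leqNgt ha.
Qed.

Section Search.
Variables (D : seq (fact Const)) (nu : fact Const -> K) (k : nat).

Definition ready n m : Prop :=
  [/\ forall a, a < 12 -> m a = @input_memory Const g D nu a,
      m aARITY [::] = Num (max_arity g), m aK [::] = Num k, m aEIGHT [::] = Num 8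
    & m aCODE [::] = Num n /\ m aBOT [::] = Bot].

Lemma init_spec : let m := den (init_cmd k) (@input_memory Const g D nu) in
  ready 0 m /\ m aFOUND [::] = Bot.
Proof.
rewrite /init_cmd; seqs; set m0 := den (wr aARITY _) _; set loop := For aI 0 _.
have h0 : m0 0 [::] = Num (size (qschema g)) by rewrite /m0 den_frame.
have ar : den loop m0 aARITY [::] = Num (max_arity g).
  have e := @for_iteri _ (fun m : memory => m aARITY [::])
    (fun r v => arith addn v (Num (nth 0 (qschema g) r))) aI 0 _ m0 _ h0.
  rewrite e {e} //.
    rewrite /m0 /=; mem; rewrite /max_arity.
    suff gen n : n <= size (qschema g) ->
      iteri n (fun r (v : value) => arith addn v (Num (nth 0 (qschema g) r))) (Num 0)
        = Num (sumn (take n (qschema g))) by rewrite gen // take_size.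
    elim: n => [|n IH] lt_n; first by rewrite take0.
    by rewrite /= IH ?(ltnW lt_n) // (take_nth 0) // sumn_rcons.
  move=> r m1 rn ir kp; rewrite /= /load /= /load /= ir /=; mem.
  have -> : m1 1 = @input_memory Const g D nu 1 by rewrite (kp 1 isT) /m0 den_frame.
  by rewrite /=; have := onthTE (qschema g) r; rewrite rn; case e : (onth _ _) => [x|] // _;
     rewrite (@onth_nth _ 0 x _ _ e).
split; last by rewrite !den_frame.
split.
- by move=> a ha; rewrite !den_input // /m0 den_input.
- by rewrite den_frame // den_frame // den_frame.
- by [].
- by [].
- by split; rewrite // !den_frame.
Qed.

Lemma search_spec n m : ready n m ->
  let pl := decode3 (unpair n).2 in let nv := (unpair n).1 in
  let m' := den search_cmd m in
  [/\ ready n.+1 m', base D nu k nv pl m', has_levels nv pl m' &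
      m' aFOUND [::] = if valid_plan g k nv pl then Num 1 else m aFOUND [::]].
Proof.
move=> [h1 h2 h3 h4 [h5 h6]] pl nv; rewrite /search_cmd; seqs.
have hl : m 2 [::] = Num (size (body g)) by rewrite h1.
have [g1 g2] := guess_spec h5 hl h2 h3 h4.
set m1 := den guess_cmd m in g1 g2 *.
have b1 : base D nu k nv pl m1.
  have f a : a \notin writes guess_cmd -> m1 a = m a by apply: den_frame.
  split; [by move=> a ha; rewrite /m1 den_input ?h1 | exact: g1 | by rewrite f | by rewrite f |].
  by split; [rewrite f | exact: g2].
have l2 := level_spec b1; set m2 := den level_cmd m1 in l2 *.
have b2 : base D nu k nv pl m2 by apply: base_den b1.
have ok3 := check_spec b2 l2; set m3 := den check_cmd m2 in ok3 *.
have b3 : base D nu k nv pl m3 by apply: base_den b2.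
have l3 : has_levels nv pl m3 by apply: levels_den l2.
set m4 := den (when _ _) m3.
have b4 : base D nu k nv pl m4 by apply: base_den b3.
have l4 : has_levels nv pl m4 by apply: levels_den l3.
have c4 : m4 aCODE [::] = Num n by rewrite /m4 /m3 /m2 /m1 !den_frame.
have b5 : base D nu k nv pl (den (wr aCODE (EAdd (rd aCODE) (ENum 1))) m4) by apply: base_den b4.
set m5 := den (wr aCODE _) m4 in b5 *.
have f5 a : a != 13 -> m5 a = m4 a by move=> na; rewrite /m5 den_frame // inE.
have e5 : m5 aCODE [::] = Num n.+1 by rewrite /m5 /= /load /= c4 /=; mem; rewrite addn1.
split; [| exact: b5 | by move=> j jn; rewrite f5 // l4 |].
- case: (b5) => i5 _ a5 k5 [bot5 _]; split; [exact: i5 | exact: a5 | exact: k5 | | by split].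
  by rewrite f5 // /m4 /m3 /m2 /m1 !den_frame.
rewrite f5 // /m4 /when den_if (beval_eq (eval_rd ok3) (erefl (eval m3 (ENum 1)))) /=.
by case: (valid_plan _ _ _ _) => /=; [mem | rewrite /m3 /m2 /m1 !den_frame].
Qed.
End Search.
End Specifications.

Section DataPhase.
Variables (Const : eqType) (g : query Const).
Variables (D : seq (fact Const)) (nu : fact Const -> carrier g) (k nv : nat).
Variable pl : nat -> nat -> nat -> nat.
Local Notation K := (carrier g).
Local Notation memory := (memory Const K).
Local Notation value := (value Const K).
Local Notation base := (@base Const g D nu k nv pl).
Local Notation has_levels := (@has_levels Const g nv pl).
Local Notation vcst := (@vcst Const g).
Local Notation vann := (@vann Const g).
Local Notation scope := (scope pl).
Local Notation parent := (parent pl).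
Local Notation host := (host pl).
Local Notation row := (row D pl).
Local Notation rows := (row_number D k).
Local Notation num1 := (@num1 Const).
Local Notation num2 := (@num2 Const).
Local Notation num3 := (@num3 Const).
Local Notation lower := (lower pl).
Let bound := nv + size (body g) + max_arity g + k + 8.
Implicit Types (m : memory) (s : nat -> option Const).

Hypothesis query_ok : semiring_query g.
Hypothesis database_ok : database_over (qschema g) D.
Hypothesis plan_ok : valid_plan g k nv pl.

(** ** Weights of the rows *)

(** Recursion on fuel [n]: the weight of table [j] refers only to its children, whose numbers are
    smaller, so fuel [j.+1] is enough. *)
Fixpoint wt_approx n j r : option K :=
  if n is n.+1 then
    if j == nv then weight D nu k nv pl (wt_approx n) nv (fun=> None)
    else if duplicate D k nv pl j r || (row j r j == None) then None
    else weight D nu k nv pl (wt_approx n) j (row j r)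
  else None.

Definition wt j r := wt_approx j.+1 j r.

Lemma weight_ext (w w' : nat -> nat -> option K) j s :
  (forall i r, i < nv -> parent i = j -> w i r = w' i r) ->
  weight D nu k nv pl w j s = weight D nu k nv pl w' j s.
Proof.
move=> h; congr omul; rewrite big_seq_cond [RHS]big_seq_cond; apply: eq_bigr => i.
rewrite mem_iota add0n => /andP[/= im /eqP pi].
have em : matching D k nv pl w i s = matching D k nv pl w' i s.
  by apply: eq_filter => r; rewrite h.
rewrite /message em; case: ifP => // _; apply: eq_bigr => r _; exact: h.
Qed.

Lemma parent_gt i : i < nv -> i < parent i.
Proof. by move=> im; have [_ /andP[h _] _ _] := valid_tableP plan_ok im. Qed.

Lemma wt_approxE n j r : j < n -> j <= nv -> wt_approx n j r = wt j r.
Proof.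
have [b] := ubnP j; elim: b j r n => // b IH j r [//|n] jb jn jm; rewrite /wt /=.
have same j' s : j = j' -> weight D nu k nv pl (wt_approx n) j' s = weight D nu k nv pl (wt_approx j) j' s.
  move=> <-; apply: weight_ext => i r' im pi; have ij := parent_gt im; rewrite pi in ij.
  have ib : i < b := leq_trans ij jb.
  by rewrite (IH i r' n ib (leq_trans ij jn) (ltnW im)) (IH i r' j ib ij (ltnW im)).
by case: eqP => [e|_]; rewrite same.
Qed.

Lemma weight_wt j s : j <= nv ->
  weight D nu k nv pl (wt_approx j) j s = weight D nu k nv pl wt j s.
Proof.
move=> jm; apply: weight_ext => i r im pi; have ij := parent_gt im; rewrite pi in ij.
by rewrite wt_approxE // ltnW.
Qed.

Lemma wtE j r : j < nv -> wt j r =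
  if duplicate D k nv pl j r || (row j r j == None) then None
  else weight D nu k nv pl wt j (row j r).
Proof. by move=> jm; rewrite /wt /= (ltn_eqF jm) weight_wt // ltnW. Qed.

Lemma wt_root r : wt nv r = weight D nu k nv pl wt nv (fun=> None).
Proof. by rewrite /wt /= eqxx weight_wt. Qed.

Lemma wt_is_table : is_table D nu k nv pl wt.
Proof.
by split=> [j r jm _|]; [exact: wtE | exists (fun=> None); exact: wt_root].
Qed.

(** ** Specifications of the data phase *)

Definition dmem m : Prop := [/\ base m, has_levels m & m aROWS [::] = Num rows].

Definition data_arrays := base_arrays ++ [:: aLEVEL; aROWS].

Lemma dmem_keeps W m m' : all [predC W] data_arrays -> keeps W m m' -> dmem m -> dmem m'.
Proof.
rewrite all_cat => /andP[hW /= /and3P[h1 h2 _]] kp [bm lm rm].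
by split; [exact: base_keeps hW kp bm | move=> j jn; rewrite kp // lm | rewrite kp].
Qed.

Lemma dmem_den c m : all [predC writes c] data_arrays -> dmem m -> dmem (den c m).
Proof. by move=> h; apply: (dmem_keeps h) => a ha; apply: den_frame. Qed.

Lemma eval_rdE m r : eval m (rd r) = m r [::].
Proof. by []. Qed.

Lemma den_wr m r e : den (wr r e) m = update m r [::] (eval m e).
Proof. by []. Qed.

Lemma den_skip m : den Skip m = m.
Proof. by []. Qed.

Lemma den_store1 m a e1 e i : eval m e1 = Num i ->
  den (Store a [:: e1] e) m = update m a (num1 i) (eval m e).
Proof. by move=> /= ->. Qed.

Lemma den_store2 m a e1 e2 e i j : eval m e1 = Num i -> eval m e2 = Num j ->
  den (Store a [:: e1; e2] e) m = update m a (num2 i j) (eval m e).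
Proof. by move=> /= -> ->. Qed.

Lemma den_store3 m a e1 e2 e3 e i j l :
  eval m e1 = Num i -> eval m e2 = Num j -> eval m e3 = Num l ->
  den (Store a [:: e1; e2; e3] e) m = update m a (num3 i j l) (eval m e).
Proof. by move=> /= -> -> ->. Qed.

Lemma eval_load1 m a e1 i : eval m e1 = Num i -> eval m (ELoad a [:: e1]) = m a (num1 i).
Proof. by move=> /= ->. Qed.

Lemma eval_load2 m a e1 e2 i j : eval m e1 = Num i -> eval m e2 = Num j ->
  eval m (ELoad a [:: e1; e2]) = m a (num2 i j).
Proof. by move=> /= -> ->. Qed.

Lemma eval_load3 m a e1 e2 e3 i j l :
  eval m e1 = Num i -> eval m e2 = Num j -> eval m e3 = Num l ->
  eval m (ELoad a [:: e1; e2; e3]) = m a (num3 i j l).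
Proof. by move=> /= -> -> ->. Qed.

Lemma rows_spec m : base m -> den rows_cmd m aROWS [::] = Num rows.
Proof.
move=> bm; rewrite /rows_cmd; seqs; set m0 := den (wr aROWS _) m.
set body := wr aCUR _;; _.
have hk : m0 aK [::] = Num k by rewrite /m0 den_frame //; case: bm.
have bm0 : base m0 by apply: base_den bm.
apply: (@for_ind _ _ aI aK body m0 k (fun t m' => m' aROWS [::] = Num (size D ^ t)) hk).
  by rewrite /set_reg /m0 /=; mem; mem.
move=> t m1 tk _ kp h1; have bm1 : base m1 by apply: (base_keeps _ kp bm0).
rewrite /set_reg /body; mem; seqs; set m2 := den (wr aCUR _) m1; set loop := For aT 8 _.
have hN : m2 8 [::] = Num (size D) by rewrite /m2 den_frame // (base_input bm1).
have h2 : m2 aROWS [::] = Num (size D ^ t) by rewrite /m2 den_frame.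
suff h : den loop m2 aCUR [::] = Num (size D ^ t.+1) by rewrite den_wr (eval_rd h); mem.
rewrite (@for_iteri _ _ _ (fun m : memory => m aCUR [::])
   (fun _ v => arith addn v (Num (size D ^ t))) aT 8 _ m2 _ hN) //.
  rewrite /m2 /=; mem; rewrite expnS.
  by move: (size D ^ t) => x; elim: (size D) => //= n ->; rewrite /= mulSn addnC.
by move=> u m3 _ _ kp3; rewrite /= /load /= (kp3 aROWS isT) h2; mem.
Qed.

Lemma digits_spec m r : dmem m -> m aR [::] = Num r -> r < rows ->
  forall i, i < k -> den digits_cmd m aIDX (num1 i) = Num (digit D r i).
Proof.
move=> dm hr lt_r; rewrite /digits_cmd; seqs; set m0 := den (wr aCUR _) m.
set body := wr aQ _;; _.
have dm0 : dmem m0 by apply: dmem_den dm.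
have hk : m0 aK [::] = Num k by case: dm0 => -[].
have c0 : m0 aCUR [::] = Num r by rewrite /m0 /= /load /= hr; mem.
pose quo i := iter i (fun c => c %/ size D) r.
have quo_le i : quo i <= r.
  by elim: i => //= i IH; apply: leq_trans IH; apply: leq_div.
pose inv t m' := m' aCUR [::] = Num (quo t) /\
  forall i, i < t -> m' aIDX (num1 i) = Num (digit D r i).
suff [] : inv k (den (For aI aK body) m0) by [].
apply: (@for_ind _ _ aI aK body m0 k inv hk).
  by split; rewrite /set_reg; mem.
move=> t m1 tk it kp [h1 h2]; have dm1 : dmem m1 by apply: (dmem_keeps _ kp dm0).
have N_gt0 : 0 < size D.
  by move: lt_r; rewrite /row_number; case: (size D) => //; rewrite exp0n // (leq_ltn_trans _ tk).
rewrite /body; seqs; set m2 := den (wr aQ _) m1; set loop := For aT aROWS _.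
have dm2 : dmem m2 by apply: dmem_den dm1.
have hN : m2 aROWS [::] = Num rows by case: dm2.
have [c3 q3] : den loop m2 aCUR [::] = Num (quo t %% size D) /\
               den loop m2 aQ [::] = Num (quo t %/ size D).
  (* Either the remainder has been reached, or each of the [u] rounds so far has subtracted once. *)
  pose inv2 u m' := exists c q, [/\ m' aCUR [::] = Num c, m' aQ [::] = Num q,
    quo t = q * size D + c & (c < size D) || (q == u)].
  have [c [q [-> -> e]]] : inv2 rows (den loop m2).
    apply: (@for_ind _ _ aT aROWS _ m2 rows inv2 hN).
      by exists (quo t), 0; rewrite /set_reg; mem; rewrite /m2 den_wr; mem; rewrite eqxx orbT.
    move=> u m3 _ _ kp3 [c [q [hc hq e cq]]].
    have dm3 : dmem m3 by apply: (dmem_keeps _ kp3 dm2).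
    have h8 : eval m3 (rd 8) = Num (size D).
      by rewrite -[LHS]/(m3 8 [::]); case: dm3 => bm3 _ _; rewrite (base_input bm3).
    rewrite /set_reg; rewrite /otherwise den_if (beval_lt (eval_rd hc) h8).
    case: ifP => [lt_c|/negbT]; first by exists c, q; rewrite lt_c; mem.
    rewrite -leqNgt => le_c; rewrite ltnNge le_c orFb in cq; move/eqP: cq => eq.
    exists (c - size D), q.+1; seqs; split.
    - by rewrite !den_wr; mem; rewrite /= -[load _ 8 _]/(eval m3 (rd 8)) h8 -[load _ _ _]/(m3 37 [::]) hc.
    - by rewrite !den_wr; mem; rewrite /= /load /=; mem; rewrite hq /= addn1.
    - by rewrite e mulSn; move: le_c; clear; lia.
    - by rewrite eq eqxx orbT.
  case: ltnP => [lt_c _|le_c /= /eqP eq].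
    by rewrite e divnMDl // modnMDl divn_small // modn_small // addn0.
  (* If all [rows] rounds had subtracted, then [rows * size D <= quo t <= r < rows], which is
     absurd. *)
  have := quo_le t; rewrite e eq => h.
  have : rows <= rows * size D by rewrite leq_pmulr.
  by move: h lt_r; clear; lia.
have it3 : den loop m2 aI [::] = Num t by rewrite den_frame // /m2 den_frame.
rewrite /set_reg; split=> [|i]; mem.
  by rewrite den_wr; mem; rewrite eval_rdE den_frame.
rewrite ltnS => le_i; rewrite den_frame // (den_store1 _ _ (eval_rd it3)) (eval_rd c3); mem.
rewrite eq_num1; case: eqVneq => [->//|ni].
rewrite den_frame // /m2 den_frame // h2 //.
by move: le_i ni; clear; lia.
Qed.

Lemma veq_cst (a b : option Const) : veq (vcst a) (vcst b) = (a == b).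
Proof. by case: a b => [a|] [b|]. Qed.

Lemma dmem_scope m ej ev j v : dmem m -> eval m ej = Num j -> eval m ev = Num v ->
  j <= nv -> v < nv -> beval m (scope_b ej ev) = scope j v.
Proof.
by move=> [bm _ _] hj hv jn vn; apply: (beval_scope bm hj hv); rewrite var_in_bound // ltnW.
Qed.

Definition has_row m j r : Prop :=
  forall v, v < nv -> scope j v -> m aROW (num3 j r v) = vcst (row j r v).

Definition has_assignment m s : Prop := forall v, v < nv -> m aSG (num1 v) = vcst (s v).

Definition cut j r v : option Const := if scope j v then row j r v else None.

Lemma dmem_bot m : dmem m -> m aBOT [::] = Bot.
Proof. by case=> -[_ _ _ _ []]. Qed.

Lemma dmem_vars m : dmem m -> m aVARS [::] = Num nv.
Proof. by case=> -[]. Qed.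

Lemma read_row_spec m j r : dmem m -> m aJ [::] = Num j -> m aR [::] = Num r -> j < nv ->
  (forall i, i < k -> m aIDX (num1 i) = Num (digit D r i)) ->
  let m' := den read_row_cmd m in
  [/\ has_assignment m' (cut j r), has_row m' j r &
      forall j' r' v, (j', r') <> (j, r) -> m' aROW (num3 j' r' v) = m aROW (num3 j' r' v)].
Proof.
move=> dm hj hr jn hidx; rewrite /read_row_cmd; set body := If _ _ _.
pose inv t m' := [/\ forall v, v < t -> v < nv -> m' aSG (num1 v) = vcst (cut j r v),
  forall v, v < t -> v < nv -> scope j v -> m' aROW (num3 j r v) = vcst (row j r v) &
  forall j' r' v, (j', r') <> (j, r) -> m' aROW (num3 j' r' v) = m aROW (num3 j' r' v)].
have [h1 h2 h3] : inv nv (den (For aV aVARS body) m); last first.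
  by split=> // v vn; [apply: h1 | apply: h2].
apply: (@for_ind _ _ aV aVARS body m nv inv (dmem_vars dm)); first by split; rewrite /set_reg; mem.
move=> t m1 tn it kp [h1 h2 h3]; have dm1 : dmem m1 by apply: (dmem_keeps _ kp dm).
have hj1 : eval m1 (rd aJ) = Num j by rewrite eval_rdE (kp aJ isT).
have ht : eval m1 (rd aV) = Num t by rewrite eval_rdE.
have upd v x m2 : m2 aSG = update m1 aSG (num1 t) x aSG -> x = vcst (cut j r t) -> v < t.+1 -> v < nv ->
    m2 aSG (num1 v) = vcst (cut j r v).
  move=> -> ->; mem; rewrite ltnS leq_eqVlt eq_num1; case: eqVneq => [->//|_ /=]; exact: h1.
rewrite /body den_if (dmem_scope dm1 hj1 ht (ltnW jn) tn); case: ifP => st; last first.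
  rewrite (den_store1 _ _ ht) eval_rdE (dmem_bot dm1) /set_reg; split.
  - by move=> v; apply: (upd _ Bot); rewrite ?/cut ?st //; mem.
  - move=> v; mem; rewrite ltnS leq_eqVlt => /orP[/eqP->|vt] vn sv; last exact: h2.
    by rewrite sv in st.
  - by move=> j' r' v ne; mem; apply: h3.
have [jt _ slot_k _] := valid_scope plan_ok jn tn st.
have tb := var_in_bound g k (ltnW tn); have jb := var_in_bound g k (ltnW jn).
have [bm1 _ _] := dm1.
have hs := eval_plan bm1 hj1 ht (isT : 5 < 8) jb tb.
have hp := eval_plan bm1 hj1 ht (isT : 6 < 8) jb tb.
have hi : eval m1 (ELoad aIDX [:: plan_at 5 (rd aJ) (rd aV)]) = Num (digit D r (slot pl j t)).
  by rewrite (eval_load1 _ hs) (kp aIDX isT) hidx.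
have hv : eval m1 (ELoad 10 [:: ELoad aIDX [:: plan_at 5 (rd aJ) (rd aV)]; plan_at 6 (rd aJ) (rd aV)])
    = vcst (row j r t).
  by rewrite (eval_load2 _ hi hp) (base_input bm1).
seqs; rewrite (den_store1 _ _ ht) hv; set m2 := update m1 _ _ _.
have fr a : a != aSG -> m2 a = m1 a by move=> ne; rewrite /m2 update_neq.
have hj2 : eval m2 (rd aJ) = Num j by rewrite eval_rdE fr.
have hr2 : eval m2 (rd aR) = Num r by rewrite eval_rdE fr // (kp aR isT).
have ht2 : eval m2 (rd aV) = Num t by rewrite eval_rdE fr.
rewrite (den_store3 _ _ hj2 hr2 ht2) (eval_load1 _ ht2) /set_reg.
have -> : m2 aSG (num1 t) = vcst (row j r t) by rewrite /m2; mem; rewrite eqxx.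
split.
- by move=> v; apply: (upd _ (vcst (row j r t))); rewrite ?/cut ?st //; mem.
- move=> v; mem; rewrite eq_num3 !eqxx /= fr // ltnS leq_eqVlt.
  case: (eqVneq v t) => [->//|_ /=]; exact: h2.
- move=> j' r' v ne; mem; rewrite eq_num3 fr //; case: eqVneq => [ej|_]; last exact: h3.
  case: eqVneq => [er|_]; last exact: h3; by case: ne; rewrite ej er.
Qed.

Lemma load_row_spec m ej er j r : dmem m -> j <= nv ->
  (forall m', keeps [:: aV; aSG] m m' -> eval m' ej = Num j /\ eval m' er = Num r) ->
  has_row m j r -> has_assignment (den (load_row_cmd ej er) m) (cut j r).
Proof.
move=> dm jn he hrow; rewrite /load_row_cmd; set body := If _ _ _.
pose inv t m' := forall v, v < t -> v < nv -> m' aSG (num1 v) = vcst (cut j r v).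
suff h : inv nv (den (For aV aVARS body) m) by move=> v vn; apply: h.
apply: (@for_ind _ _ aV aVARS body m nv inv (dmem_vars dm)) => // t m1 tn it kp h.
have kp' : keeps [:: aV; aSG] m m1.
  by move=> a; rewrite !inE !negb_or => /andP[h1 h2]; apply: kp; rewrite /= !inE !negb_or h1 h2.
have dm1 : dmem m1 by apply: (dmem_keeps _ kp' dm).
have [hj hr] := he _ kp'; have ht : eval m1 (rd aV) = Num t by rewrite eval_rdE.
suff [x hx ->] : exists2 x, x = vcst (cut j r t) & den body m1 = update m1 aSG (num1 t) x.
  move=> v; rewrite /set_reg; mem; rewrite ltnS leq_eqVlt eq_num1 hx.
  by case: eqVneq => [->//|_ /=]; apply: h.
rewrite /body den_if (dmem_scope dm1 hj ht jn tn) /cut; case: ifP => st.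
  exists (vcst (row j r t)) => //; rewrite (den_store1 _ _ ht) (eval_load3 _ hj hr ht).
  by rewrite (kp' aROW isT) hrow.
by exists Bot => //; rewrite (den_store1 _ _ ht) eval_rdE (dmem_bot dm1).
Qed.

Lemma agree_spec m ej b j r s : dmem m -> j <= nv ->
  (forall m', keeps [:: aV; aFL] m m' -> eval m' ej = Num j) ->
  m aR2 [::] = Num r -> has_row m j r -> has_assignment m s ->
  den (agree_cmd ej b) m aFL [::]
    = Num (agree_on nv (if b then scope j else lower j) (row j r) s).
Proof.
move=> dm jn he hr hrow hs; rewrite /agree_cmd; seqs.
set m0 := den (wr aFL _) m; set body := when _ _.
have dm0 : dmem m0 by apply: dmem_den dm.
rewrite (@for_iteri _ _ _ (fun m : memory => m aFL [::])
  (fun v acc => if (if b then scope j else lower j) v ==> (row j r v == s v) then acc else Num 0)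
  aV aVARS body m0 _ (dmem_vars dm0)) //.
  by rewrite iteri_unless /m0 den_wr; mem; rewrite /agree_on; case: (all _ _).
move=> v m1 vn iv kp.
have kp' : keeps [:: aV; aFL] m m1.
  move=> a ha; have na : a \notin aV :: writes body by rewrite /body; case: (b); exact: ha.
  rewrite (kp a na) /m0 den_frame //.
  by move: ha; rewrite !inE negb_or => /andP[].
have dm1 : dmem m1 by apply: (dmem_keeps _ kp' dm).
have hj := he _ kp'; have hv : eval m1 (rd aV) = Num v by rewrite eval_rdE.
have hr1 : eval m1 (rd aR2) = Num r by rewrite eval_rdE (kp' aR2 isT).
rewrite /body /when den_if beval_and beval_not (dmem_scope dm1 hj hv jn vn).
case sv : (scope j v); last first.
  by rewrite /=; case: (b); rewrite ?/lower sv.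
rewrite andTb (beval_eq (eval_load3 _ hj hr1 hv) (eval_load1 _ hv)).
rewrite (kp' aROW isT) (kp' aSG isT) hrow // hs // veq_cst.
case: (row j r v == s v); first by rewrite implybT.
rewrite implybF; case: (b); first by rewrite sv den_wr; mem.
rewrite /lower sv /otherwise den_if (beval_eq hv hj) /=.
by case: eqP => //= _; mem.
Qed.

Lemma duplicate_spec m j r : dmem m -> m aJ [::] = Num j -> m aR [::] = Num r ->
  j < nv -> (forall r', r' < r -> has_row m j r') -> has_assignment m (cut j r) ->
  den duplicate_cmd m aDUP [::] = Num (duplicate D k nv pl j r).
Proof.
move=> dm hj hr jn hrow hs; rewrite /duplicate_cmd; seqs.
set m0 := den (wr aDUP _) m; set body := Seq _ _.
have dm0 : dmem m0 by apply: dmem_den dm.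
have hn : m0 aROWS [::] = Num rows by case: dm0.
rewrite (@for_iteri _ _ _ (fun m : memory => m aDUP [::])
  (fun r' acc => if (r' < r) && agree_on nv (scope j) (row j r') (row j r) then Num 1 else acc)
  aR2 aROWS body m0 _ hn) //.
  by rewrite iteri_if /m0 den_wr; mem; rewrite /duplicate; case: (has _ _).
move=> r' m1 rn ir kp; have dm1 : dmem m1 by apply: (dmem_keeps _ kp dm0).
rewrite /body; seqs; set m2 := den (agree_cmd _ _) m1.
have hr2 : eval m2 (rd aR) = Num r.
  by rewrite eval_rdE /m2 den_frame // (kp aR isT) /m0 den_frame.
have hr2' : eval m2 (rd aR2) = Num r' by rewrite eval_rdE /m2 den_frame.
rewrite /when den_if beval_and (beval_lt hr2' hr2).
case: ltnP => [lt_r|_] /=; last by rewrite /m2 den_frame.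
have hfl : eval m2 (rd aFL) = Num (agree_on nv (scope j) (row j r') (row j r)).
  rewrite eval_rdE /m2 (@agree_spec _ _ true j r' (cut j r)) // 1?ltnW //.
  - congr (Num (nat_of_bool _)); apply: eq_all => v; rewrite /cut; by case: (scope j v).
  - by move=> m' kp'; rewrite eval_rdE (kp' aJ isT) (kp aJ isT) /m0 den_frame.
  - by move=> v vn sv; rewrite (kp aROW isT) /m0 den_frame // hrow.
  - by move=> v vn; rewrite (kp aSG isT) /m0 den_frame // hs.
rewrite -[veq _ _]/(veq (eval m2 (rd aFL)) (Num 1)) hfl.
by case: (agree_on _ _ _ _) => /=; [mem | rewrite /m2 den_frame].
Qed.

Lemma iteri_morph (T T' : Type) (h : T -> T') n F F' v :
  (forall t x, t < n -> F' t (h x) = h (F t x)) -> iteri n F' (h v) = h (iteri n F v).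
Proof. by elim: n => //= n IH e; rewrite IH ?e // => t x tn; apply: e; apply: ltnW. Qed.

Lemma atom_spec m a s : dmem m -> m aA [::] = Num a -> a < size (body g) ->
  has_assignment m s -> den atom_cmd m aVAL [::] = vann (atom_value D nu pl s a).
Proof.
move=> dm ha ab hs; rewrite /atom_cmd; seqs; set m0 := den (wr aVAL _) m.
set body := Seq _ _; have dm0 : dmem m0 by apply: dmem_den dm.
have hN : m0 8 [::] = Num (size D) by case: dm0 => bm0 _ _; rewrite (base_input bm0).
have v0 : m0 aVAL [::] = vann None.
  by rewrite /m0 den_wr; mem; rewrite eval_rdE (dmem_bot dm).
pose F f (acc : value) :=
  if fact_matches g D pl s a f then vann (omap nu (onth D f)) else acc.
rewrite (@for_iteri _ _ _ (fun m : memory => m aVAL [::]) F aF 8 body m0 _ hN) //.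
  rewrite v0 /atom_value; apply: iteri_morph => f x _; rewrite /F.
  by case: ifP.
move=> f m1 fn jf kp; have dm1 : dmem m1 by apply: (dmem_keeps _ kp dm0).
have ha1 : m1 aA [::] = Num a by rewrite (kp aA isT) /m0 den_frame.
rewrite /body; seqs; set m2 := den (wr aFL _) m1; set m3 := den (otherwise _ _) m2.
set loop := For aP aARITY _; have dm2 : dmem m2 by apply: dmem_den dm1.
have dm3 : dmem m3 by apply: dmem_den dm2.
have fl3 : m3 aFL [::] = if omap (fun phi : fact Const => phi.1) (onth D f)
    == omap (fun al : atom Const => al.1) (onth (Defs.body g) a) then Num 1 else Num 0.
  have hf2 : eval m2 (rd aF) = Num f by rewrite eval_rdE /m2 den_frame.
  have ha2 : eval m2 (rd aA) = Num a by rewrite eval_rdE /m2 den_frame.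
  rewrite /m3 /otherwise den_if (beval_eq (eval_load1 _ hf2) (eval_load1 _ ha2)).
  have [bm2 _ _] := dm2; rewrite !(base_input bm2) //.
  have -> : veq (@input_memory _ g D nu 9 (num1 f)) (@input_memory _ g D nu 3 (num1 a)) =
    (omap (fun phi : fact Const => phi.1) (onth D f)
       == omap (fun al : atom Const => al.1) (onth (Defs.body g) a)).
    by rewrite /=; case: (onth D f) => [phi|]; case: (onth _ a) => [al|].
  by case: eqP => _; rewrite ?den_wr; mem; rewrite /m2 ?den_wr; mem.
have hA : m3 aARITY [::] = Num (max_arity g) by case: dm3 => -[].
have fl4 : den loop m3 aFL [::] = Num (fact_matches g D pl s a f).
  rewrite (@for_iteri _ _ _ (fun m : memory => m aFL [::])
    (fun p acc => if obind (fun phi : fact Const => onth phi.2 p) (onth D f)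
                     == term_value g pl s a p then acc else Num 0) aP aARITY _ m3 _ hA) //.
    rewrite iteri_unless fl3 /fact_matches; case: (all _ _); rewrite ?andbT ?andbF //.
    by case: ifP.
  move=> p m4 pn ip kp4; seqs; have dm4 : dmem m4 by apply: (dmem_keeps _ kp4 dm3).
  set m5 := den (wr aX _) m4; set m6 := den (when _ _) m5.
  have [bm4 _ _] := dm4; have dm5 : dmem m5 by apply: dmem_den dm4.
  have [bm5 _ _] := dm5; have dm6 : dmem m6 by apply: dmem_den dm5.
  have [bm6 _ _] := dm6.
  have ha4 : eval m4 (rd aA) = Num a.
    by rewrite eval_rdE (kp4 aA isT) /m3 den_frame // /m2 den_frame.
  have hx5 : m5 aX [::] = vterm g (term_at g a p).
    by rewrite /m5 den_wr; mem; rewrite (eval_term bm4 ha4 (eval_rd ip)).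
  have ha5 : eval m5 (rd aA) = Num a by rewrite eval_rdE /m5 den_frame.
  have hp5 : eval m5 (rd aP) = Num p by rewrite eval_rdE /m5 den_frame.
  have hx6 : m6 aX [::] = vcst (term_value g pl s a p).
    rewrite /m6 /when den_if -[beval _ _]/(is_num (m5 aX [::])) hx5 /term_value.
    case et : (term_at g a p) hx5 => [[x|c]|] hx5; last 2 first.
    - exact: hx5.
    - exact: hx5.
    rewrite [is_num _]/=; have [_ /(_ p x pn et)[tn _ _]] := valid_atomP plan_ok ab.
    have pb : p < bound by move: pn; rewrite /bound; clear; lia.
    have e7 := eval_plan bm5 ha5 hp5 (isT : 7 < 8) (host_in_bound k nv ab) pb.
    rewrite den_wr; mem; rewrite (eval_load1 _ e7) /m5 den_frame // (kp4 aSG isT) /m3 den_frame //.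
    by rewrite /m2 den_frame // (kp aSG isT) /m0 den_frame // hs.
  have hf6 : eval m6 (rd aF) = Num f.
    by rewrite eval_rdE /m6 den_frame // /m5 den_frame // (kp4 aF isT) /m3 den_frame // /m2 den_frame.
  have hp6 : eval m6 (rd aP) = Num p by rewrite eval_rdE /m6 den_frame.
  rewrite /otherwise den_if (beval_eq (eval_load2 _ hf6 hp6) (eval_rd hx6)) (base_input bm6) //.
  rewrite -[@input_memory _ _ _ _ _ _]/(vcst (obind (fun phi : fact Const => onth phi.2 p) (onth D f))).
  rewrite veq_cst; case: eqP => _; last by rewrite den_wr; mem.
  by rewrite den_skip /m6 den_frame // /m5 den_frame.
rewrite /when den_if (beval_eq (eval_rd fl4) (erefl (eval _ (ENum 1)))) /F.
have -> : veq (Num (fact_matches g D pl s a f) : value) (Num 1) = fact_matches g D pl s a f.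
  by case: (fact_matches _ _ _ _ _ _).
case: (fact_matches _ _ _ _ _ _).
  have hf4 : eval (den loop m3) (rd aF) = Num f.
    by rewrite eval_rdE den_frame // /m3 den_frame // /m2 den_frame.
  rewrite den_wr; mem; rewrite (eval_load1 _ hf4).
  have dm4 : dmem (den loop m3) by apply: dmem_den dm3.
  by have [bm4 _ _] := dm4; rewrite (base_input bm4) //=; case: (onth D f).
by rewrite den_skip den_frame // /m3 den_frame // /m2 den_frame.
Qed.

End DataPhase.

(** * Computing the tables and the links between rows *)

Section Tables.
Variables (Const : eqType) (g : query Const).
Variables (D : seq (fact Const)) (nu : fact Const -> carrier g) (k nv : nat).
Variable pl : nat -> nat -> nat -> nat.
Local Notation K := (carrier g).
Local Notation memory := (memory Const K).
Local Notation value := (value Const K).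
Local Notation vcst := (@vcst Const g).
Local Notation vann := (@vann Const g).
Local Notation vnum := (@vnum Const g).
Local Notation scope := (scope pl).
Local Notation parent := (parent pl).
Local Notation host := (host pl).
Local Notation row := (row D pl).
Local Notation rows := (row_number D k).
Local Notation num1 := (@num1 Const).
Local Notation num2 := (@num2 Const).
Let bound := nv + size (body g) + max_arity g + k + 8.
Implicit Types (m : memory) (s : nat -> option Const).

Hypothesis query_ok : semiring_query g.
Hypothesis database_ok : database_over (qschema g) D.
Hypothesis plan_ok : valid_plan g k nv pl.

Local Notation wt := (@wt Const g D nu k nv pl).
Local Notation dmem := (@dmem Const g D nu k nv pl).
Local Notation has_row := (@has_row Const g D nv pl).
Local Notation has_assignment := (@has_assignment Const g nv).
Local Notation cut := (cut D pl).
Local Notation lower := (lower pl).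
Local Notation free := (free g pl).

Definition has_table m j : Prop := forall r, r < rows ->
  has_row m j r /\ m aWT (num2 j r) = vann (wt j r).

Lemma beval_bot m e (v : value) : dmem m -> eval m e = v ->
  beval m (bot_b e) = if v is Bot then true else false.
Proof.
by move=> dm he; rewrite /bot_b (beval_eq he (eval_rdE m aBOT)) (dmem_bot dm); case: v {he}.
Qed.

Lemma beval_free m ej j : dmem m -> eval m ej = Num j -> j < nv ->
  beval m (free_b ej) = free j.
Proof.
move=> [bm lm _] hj jn; rewrite /free_b (beval_eq (eval_level lm hj jn) (eval_rdE m 5)).
by rewrite (base_input bm).
Qed.

Lemma eval_times m e1 e2 a b : eval m e1 = vann a -> eval m e2 = vann b ->
  eval m (ETimes e1 e2) = vann (omul (times g) a b).
Proof. by move=> /= -> ->; case: a b => [a|] [b|]. Qed.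

Lemma iteri_big (T : Type) (one : T) (op : Monoid.com_law one) n (P : pred nat) (F : nat -> T) x :
  iteri n (fun t acc => if P t then op acc (F t) else acc) x
  = op x (\big[op/one]_(t <- iota 0 n | P t) F t).
Proof.
elim: n => [|n IH]; first by rewrite big_nil Monoid.mulm1.
rewrite [iteri _ _ _]/= IH -[n.+1]addn1 iotaD big_cat /= add0n big_cons big_nil.
by case: (P n); rewrite ?Monoid.mulm1 // Monoid.mulmA.
Qed.

Lemma message_spec m i s : dmem m -> m aI [::] = Num i -> i < nv ->
  has_assignment m s -> has_table m i ->
  den message_cmd m aMSG [::] = vann (message D k nv pl wt s i).
Proof.
move=> dm hi im hs htab; rewrite /message_cmd; seqs; set m0 := den (wr aMSG _) m.
set body := Seq _ _; have dm0 : dmem m0 by apply: dmem_den dm.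
have hn : m0 aROWS [::] = Num rows by case: dm0.
(* One accumulator covers both kinds of tables: for a free one it becomes the unit at the first
   match and stays so. *)
pose match_row r := isSome (wt i r) && agree_on nv (lower i) (row i r) s.
pose G r acc := if match_row r then (if free i then Some (munit (times g))
  else oadd (op_at g pl i) acc (wt i r)) else acc.
have -> : message D k nv pl wt s i = iteri rows G None.
  rewrite /message /G; case: (free i).
    by rewrite iteri_if has_filter -/(matching D k nv pl wt i s); case: (matching _ _ _ _ _ _ _).
  by rewrite iteri_big Monoid.mul1m /matching big_filter.
apply: (@for_ind _ _ aR2 aROWS body m0 rows
  (fun t (m' : memory) => m' aMSG [::] = vann (iteri t G None)) hn).
  by rewrite /set_reg /m0 den_wr; mem; mem; rewrite eval_rdE (dmem_bot dm).
move=> r m1 rn ir kp acc1; have dm1 : dmem m1 by apply: (dmem_keeps _ kp dm0).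
have fr a : a \notin [:: aMSG; aR2; aFL; aV] -> m1 a = m a.
  move=> na; rewrite (kp a) //; last first.
    apply: contra na; rewrite !inE; by do ![case/orP => //] => ->; rewrite ?orbT.
  by rewrite /m0 den_frame //; move: na; rewrite !inE !negb_or => /and4P[].
have [hrow hwt] := htab _ rn.
have hi1 m' : keeps [:: aV; aFL] m1 m' -> eval m' (rd aI) = Num i.
  by move=> kp'; rewrite eval_rdE (kp' aI isT) fr.
rewrite /body; seqs; set m2 := den (agree_cmd _ _) m1.
have dm2 : dmem m2 by apply: dmem_den dm1.
have fl2 : m2 aFL [::] = Num (agree_on nv (lower i) (row i r) s).
  rewrite /m2 (@agree_spec _ _ D nu k nv pl _ _ false i r s) // 1?ltnW //.
  - by move=> v vn sv; rewrite fr // hrow.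
  - by move=> v vn; rewrite fr // hs.
have hi2 : eval m2 (rd aI) = Num i by rewrite eval_rdE /m2 den_frame //; apply: hi1.
have hr2 : eval m2 (rd aR2) = Num r by rewrite eval_rdE /m2 den_frame.
have hw2 : eval m2 (ELoad aWT [:: rd aI; rd aR2]) = vann (wt i r).
  by rewrite (eval_load2 _ hi2 hr2) /m2 den_frame // fr.
have e2 : m2 aMSG [::] = vann (iteri r G None) by rewrite /m2 den_frame.
rewrite /set_reg; mem; rewrite /when den_if beval_and beval_not (beval_bot dm2 hw2).
rewrite (beval_eq (eval_rd fl2) (erefl (eval m2 (ENum 1)))).
rewrite (_ : _ && _ = match_row r); last first.
  by rewrite /match_row; case: (wt i r); case: (agree_on _ _ _ _).
rewrite [iteri r.+1 _ _]/= {1}/G.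
case mr : (match_row r); last by rewrite den_skip.
rewrite den_if (beval_free dm2 hi2 im); case: ifP => fi; first by rewrite den_wr; mem.
have [x ex] : exists x, wt i r = Some x.
  by move: mr; rewrite /match_row; case: (wt i r) => // x _; exists x.
rewrite den_if (beval_bot dm2 (eval_rd e2)); case: (iteri r G None) e2 => [y|] e2.
  have hl : eval m2 (level_e (rd aI)) = Num (level g (var_at pl i)).
    by apply: eval_level hi2 im; case: dm2.
  rewrite den_wr; mem; rewrite /= -[load _ _ _]/(eval m2 (level_e (rd aI))) hl.
  rewrite -[load _ _ _]/(eval m2 (rd aMSG)) eval_rdE e2.
  rewrite -[load _ _ _]/(eval m2 (ELoad aWT [:: rd aI; rd aR2])) hw2 ex /=.
  have := level_le g (var_at pl i); rewrite leq_eqVlt -/(free i) fi /= size_map => ln.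
  rewrite /op_at; have := onthTE [seq p.2 | p <- projections g] (level g (var_at pl i)).
  rewrite size_map ln; case eo : (onth _ _) => [p|] // _.
  by rewrite (@onth_nth _ (times g) p _ _ eo).
by rewrite den_wr; mem; rewrite hw2 ex.
Qed.

Lemma notin_sub (s s' : seq nat) a : all (mem s) s' -> a \notin s -> a \notin s'.
Proof. by move/allP => h; apply: contra => /h. Qed.

Lemma weight_spec m j s : dmem m -> m aJ [::] = Num j -> j <= nv -> has_assignment m s ->
  (forall i, i < nv -> parent i = j -> has_table m i) ->
  den weight_cmd m aACC [::] = vann (weight D nu k nv pl wt j s).
Proof.
move=> dm hj jn hs htab; rewrite /weight_cmd; seqs; set m0 := den (wr aACC _) m.
set b1 := when (BEq (host_e _) _) _; set b2 := when _ _; set m1 := den (For aA 2 b1) m0.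
have dm0 : dmem m0 by apply: dmem_den dm.
have dm1 : dmem m1 by apply: dmem_den dm0.
have fr0 a : a \notin writes weight_cmd -> m0 a = m a.
  by move=> na; rewrite /m0 den_frame //; apply: notin_sub na.
have fr1 a : a \notin writes weight_cmd -> m1 a = m a.
  by move=> na; rewrite /m1 den_frame ?fr0 //; apply: notin_sub na.
have h0 : m0 2 [::] = Num (size (body g)) by case: dm0 => bm0 _ _; rewrite (base_input bm0).
have hn : m1 aVARS [::] = Num nv := dmem_vars dm1.
pose w1 := \big[omul (times g)/Some (munit (times g))]_(a <- iota 0 (size (body g)) | host a == j)
  atom_value D nu pl s a.
have acc1 : m1 aACC [::] = vann w1.
  rewrite /w1 -[X in vann X](omul1 (times g)) -iteri_big.
  apply: (@for_ind _ _ aA 2 b1 m0 _ (fun t (m' : memory) => m' aACC [::] =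
    vann (iteri t (fun t acc => if host t == j then omul (times g) acc (atom_value D nu pl s t)
      else acc) (Some (munit (times g))))) h0); first by rewrite /set_reg /m0 den_wr; mem; mem.
  move=> a m2 an ia kp acc2; have dm2 : dmem m2 by apply: (dmem_keeps _ kp dm0).
  have hj2 : eval m2 (rd aJ) = Num j by rewrite eval_rdE (kp aJ isT) fr0.
  rewrite /set_reg; mem; rewrite /b1 /when den_if [iteri a.+1 _ _]/=.
  have [bm2 _ _] := dm2.
  rewrite (beval_eq (eval_host bm2 (eval_rd ia) an) hj2) -[veq _ _]/(host a == j).
  case: (host a == j) => //; seqs; set m3 := den atom_cmd m2.
  rewrite den_wr; mem; apply: eval_times; first by rewrite eval_rdE /m3 den_frame.
  rewrite eval_rdE /m3 (@atom_spec _ _ D nu k nv pl plan_ok _ a s) //.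
  by move=> v vn; rewrite (kp aSG isT) fr0 // hs.
rewrite /weight -/w1 -iteri_big.
apply: (@for_ind _ _ aI aVARS b2 m1 _ (fun t (m' : memory) => m' aACC [::] =
    vann (iteri t (fun t acc => if parent t == j then omul (times g) acc
      (message D k nv pl wt s t) else acc) w1)) hn); first by rewrite /set_reg; mem.
move=> i m2 im ii kp acc2; have dm2 : dmem m2 by apply: (dmem_keeps _ kp dm1).
have hj2 : eval m2 (rd aJ) = Num j by rewrite eval_rdE (kp aJ isT) fr1.
rewrite /set_reg; mem; rewrite /b2 /when den_if [iteri i.+1 _ _]/=.
have [bm2 _ _] := dm2.
rewrite (beval_eq (eval_parent bm2 (eval_rd ii) (ltnW im)) hj2) -[veq _ _]/(parent i == j).
case: eqP => // pi; seqs; set m3 := den message_cmd m2.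
rewrite den_wr; mem; apply: eval_times; first by rewrite eval_rdE /m3 den_frame.
rewrite eval_rdE /m3 (@message_spec _ i s) //.
  by move=> v vn; rewrite (kp aSG isT) fr1 // hs.
move=> r rn; have [h1 h2] := htab i im pi r rn; split.
  by move=> v vn sv; rewrite (kp aROW isT) fr1 // h1.
by rewrite (kp aWT isT) fr1.
Qed.

Lemma has_table_keeps W m m' j : all [predC W] [:: aROW; aWT] -> keeps W m m' ->
  has_table m j -> has_table m' j.
Proof.
move=> /and3P[h1 h2 _] kp h r rn; have [hr hw] := h r rn.
by split=> [v vn sv|]; rewrite kp //; apply: hr.
Qed.

Lemma has_table_den c m j : all [predC writes c] [:: aROW; aWT] ->
  has_table m j -> has_table (den c m) j.
Proof. by move=> h; apply: (has_table_keeps h) => a ha; apply: den_frame. Qed.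

(** Children have smaller numbers, so their tables are complete when row [r] of table [j] is
    computed. That [aSG] holds some assignment is recorded for the root, whose weight is computed
    from whatever assignment is left there. *)
Lemma table_row_spec m j r : dmem m -> m aJ [::] = Num j -> m aR [::] = Num r ->
  j < nv -> r < rows -> (forall i, i < j -> has_table m i) ->
  (forall r', r' < r -> has_row m j r' /\ m aWT (num2 j r') = vann (wt j r')) ->
  let m' := den (digits_cmd;; read_row_cmd;; duplicate_cmd;; weight_cmd;;
        otherwise (BAnd (BNot (bot_b (ELoad aSG [:: rd aJ]))) (BEq (rd aDUP) (ENum 0)))
          (wr aACC (rd aBOT));;
        Store aWT [:: rd aJ; rd aR] (rd aACC)) m in
  [/\ exists s, has_assignment m' s, forall i, i < j -> has_table m' i &
      forall r', r' < r.+1 -> has_row m' j r' /\ m' aWT (num2 j r') = vann (wt j r')].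
Proof.
move=> dm hj hr jn rn htab hrow; seqs; set m1 := den digits_cmd m.
set m2 := den read_row_cmd m1; set m3 := den duplicate_cmd m2.
set m4 := den weight_cmd m3; set m5 := den (otherwise _ _) m4.
have dm1 : dmem m1 by apply: dmem_den dm.
have dm2 : dmem m2 by apply: dmem_den dm1.
have dm3 : dmem m3 by apply: dmem_den dm2.
have dm4 : dmem m4 by apply: dmem_den dm3.
have hj1 : m1 aJ [::] = Num j by rewrite /m1 den_frame.
have hr1 : m1 aR [::] = Num r by rewrite /m1 den_frame.
have idx1 i : i < k -> m1 aIDX (num1 i) = Num (digit D r i).
  exact: (digits_spec (D := D) dm hr rn).
have [sg2 row2 fr2] := read_row_spec plan_ok dm1 hj1 hr1 jn idx1.
rewrite -/m2 in sg2 row2 fr2.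
have hj2 : m2 aJ [::] = Num j by rewrite /m2 den_frame.
have hr2 : m2 aR [::] = Num r by rewrite /m2 den_frame.
have tab2 i : i < j -> has_table m2 i.
  move=> ij r' rn'; have [h1 h2] := htab i ij r' rn'; split.
    move=> v vn sv; rewrite fr2; last by case=> e; rewrite e ltnn in ij.
    by rewrite /m1 den_frame // h1.
  by rewrite /m2 den_frame // /m1 den_frame.
have rows2 r' : r' < r -> has_row m2 j r' /\ m2 aWT (num2 j r') = vann (wt j r').
  move=> rr; have [h1 h2] := hrow r' rr; split.
    move=> v vn sv; rewrite fr2; last by case=> e; rewrite e ltnn in rr.
    by rewrite /m1 den_frame // h1.
  by rewrite /m2 den_frame // /m1 den_frame.
have sg3 : has_assignment m3 (cut j r) by move=> v vn; rewrite /m3 den_frame // sg2.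
have hj3 : m3 aJ [::] = Num j by rewrite /m3 den_frame.
have dup3 : m3 aDUP [::] = Num (duplicate D k nv pl j r).
  by apply: (@duplicate_spec _ _ D nu) => // r' /rows2[].
have acc4 : m4 aACC [::] = vann (weight D nu k nv pl wt j (row j r)).
  rewrite (_ : weight _ _ _ _ _ _ _ _ = weight D nu k nv pl wt j (cut j r)); last first.
    by apply: (weight_dep _ _ _ plan_ok); apply/agree_onP => v _ sv; rewrite /cut sv.
  apply: weight_spec => //; first by rewrite ltnW.
  move=> i im pi; apply: has_table_den => //; apply: tab2.
  by rewrite -pi; apply: (parent_gt plan_ok im).
have hj4 : m4 aJ [::] = Num j by rewrite /m4 den_frame.
have acc5 : m5 aACC [::] = vann (wt j r).
  have [jj _ _ _] := valid_tableP plan_ok jn.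
  have hs4 : eval m4 (ELoad aSG [:: rd aJ]) = vcst (row j r j).
    by rewrite (eval_load1 _ (eval_rd hj4)) /m4 den_frame // sg3 // /cut jj.
  have dup4 : eval m4 (rd aDUP) = Num (duplicate D k nv pl j r).
    by rewrite eval_rdE /m4 den_frame.
  rewrite (wtE _ _ plan_ok _ jn) /m5 /otherwise den_if beval_and beval_not (beval_bot dm4 hs4).
  rewrite (beval_eq dup4 (erefl (eval m4 (ENum 0)))).
  rewrite (_ : _ && _ = ~~ (duplicate D k nv pl j r || (row j r j == None))); last first.
    by case: (duplicate _ _ _ _ _ _); case: (row j r j).
  case: (_ || _); last by rewrite den_skip.
  by rewrite den_wr; mem; rewrite eval_rdE (dmem_bot dm4).
have hj5 : m5 aJ [::] = Num j by rewrite /m5 den_frame.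
have hr5 : m5 aR [::] = Num r by rewrite /m5 /m4 /m3 !den_frame.
rewrite (den_store2 _ _ (eval_rd hj5) (eval_rd hr5)) eval_rdE acc5.
have fr a : a \notin [:: aSG; aWT] ++ writes duplicate_cmd ++ writes weight_cmd -> m5 a = m2 a.
  move=> na; rewrite /m5 den_frame; last by apply: notin_sub na.
  rewrite /m4 den_frame; last by apply: notin_sub na.
  by rewrite /m3 den_frame //; apply: notin_sub na.
have w5 : m5 aWT = m2 aWT by rewrite /m5 den_frame // /m4 den_frame // /m3 den_frame.
split.
- by exists (cut j r) => v vn; mem; rewrite /m5 den_frame // /m4 den_frame // sg3.
- move=> i ij r' rn'; have [h1 h2] := tab2 i ij r' rn'; split.
    by move=> v vn sv; mem; rewrite fr // h1.
  by mem; rewrite eq_num2 (ltn_eqF ij) /= w5.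
- move=> r'; rewrite ltnS leq_eqVlt; case: eqVneq => [-> _|ne /= rr].
    split; last by mem; rewrite eqxx.
    by move=> v vn sv; mem; rewrite fr // row2.
  have [h1 h2] := rows2 r' rr; split; last by mem; rewrite eq_num2 (negbTE ne) andbF w5.
  by move=> v vn sv; mem; rewrite fr // h1.
Qed.

Lemma tables_spec m : dmem m -> has_assignment m (fun=> None) ->
  let m' := den tables_cmd m in
  (forall j, j < nv -> has_table m' j) /\ m' aWT (num2 nv 0) = vann (wt nv 0).
Proof.
move=> dm hs; rewrite /tables_cmd; set body := digits_cmd;; _; set inner := For aR _ _; seqs.
pose outer_inv j (m' : memory) := (exists s, has_assignment m' s) /\
  forall i, i < j -> has_table m' i.
set m1 := den (For aJ aVARS inner) m.
have dm1 : dmem m1 by apply: dmem_den dm.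
have [[s sg1] tab1] : outer_inv nv m1.
  apply: (@for_ind _ _ aJ aVARS inner m nv outer_inv (dmem_vars dm)).
    by split=> //; exists (fun=> None).
  move=> j m2 jn hj kp [[s hs2] tab2]; have dm2 : dmem m2 by apply: (dmem_keeps _ kp dm).
  have hn : m2 aROWS [::] = Num rows by case: dm2.
  pose inner_inv r (m' : memory) := outer_inv j m' /\
    forall r', r' < r -> has_row m' j r' /\ m' aWT (num2 j r') = vann (wt j r').
  have [[ex tab3] tabj] : inner_inv rows (den inner m2).
    apply: (@for_ind _ _ aR aROWS body m2 rows inner_inv hn).
      by split=> //; split=> //; exists s.
    move=> r m3 rn hr kp3 [[_ tab3] row3]; have dm3 : dmem m3 by apply: (dmem_keeps _ kp3 dm2).
    have hj3 : m3 aJ [::] = Num j by rewrite (kp3 aJ isT).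
    have [[s4 h1] h2 h3] := table_row_spec dm3 hj3 hr jn rn tab3 row3.
    by split=> //; split=> //; exists s4.
  split=> // i; rewrite ltnS leq_eqVlt => /orP[/eqP-> //|]; exact: tab3.
set m2 := den (wr aJ _) m1; have dm2 : dmem m2 by apply: dmem_den dm1.
have tab2 j : j < nv -> has_table m2 j by move=> jn; apply: has_table_den => //; apply: tab1.
have hj2 : m2 aJ [::] = Num nv by rewrite /m2 den_wr; mem; rewrite eval_rdE (dmem_vars dm1).
have acc : den weight_cmd m2 aACC [::] = vann (wt nv 0).
  rewrite wt_root // (@weight_spec _ nv s) //; last by move=> i im _; apply: tab2.
  by congr vann; apply: (weight_root _ _ _ plan_ok).
have hv : eval (den weight_cmd m2) (rd aVARS) = Num nv.
  by rewrite eval_rdE den_frame // (dmem_vars dm2).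
rewrite (den_store2 _ _ hv (erefl (eval _ (ENum 0)))) eval_rdE acc; split; last by mem; rewrite eqxx.
move=> j jn r rn; have [h1 h2] := tab2 j jn r rn; split.
  by move=> v vn sv; mem; rewrite den_frame // h1.
by mem; rewrite eq_num2 (ltn_eqF jn) den_frame.
Qed.

Lemma iteri_ohead n (Q : pred nat) :
  iteri n (fun r acc => if Q r && ~~ isSome acc then Some r else acc) None
  = ohead [seq r <- iota 0 n | Q r].
Proof.
elim: n => // n IH; rewrite [iteri _ _ _]/= IH -[n.+1]addn1 iotaD filter_cat /= add0n.
by case: [seq _ <- _ | _] => [|x l]; case: (Q n).
Qed.

Lemma find_spec m b j s (p : pred nat) : dmem m -> m aJ [::] = Num j -> j < nv ->
  has_assignment m s -> has_table m j ->
  (forall m' r, keeps [:: aV; aFL; aR2; aHIT] m m' -> m' aR2 [::] = Num r ->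
     beval m' b = p r) ->
  den (find_cmd b) m aHIT [::] = vnum (ohead [seq r <- matching D k nv pl wt j s | p r]).
Proof.
move=> dm hj jn hs htab hb; rewrite /find_cmd; seqs; set m0 := den (wr aHIT _) m.
set body := Seq _ _; have dm0 : dmem m0 by apply: dmem_den dm.
have hn : m0 aROWS [::] = Num rows by case: dm0.
rewrite /matching -filter_predI -iteri_ohead.
set G := fun r acc => _.
apply: (@for_ind _ _ aR2 aROWS body m0 rows
  (fun t (m' : memory) => m' aHIT [::] = vnum (iteri t G None)) hn).
  by rewrite /set_reg /m0 den_wr; mem; mem; rewrite eval_rdE (dmem_bot dm).
move=> r m1 rn ir kp hit1; have dm1 : dmem m1 by apply: (dmem_keeps _ kp dm0).
have fr a : a \notin [:: aV; aFL; aR2; aHIT] -> m1 a = m a.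
  move=> na; rewrite (kp a) //; first by rewrite /m0 den_frame //; apply: notin_sub na.
  by apply: notin_sub na.
have [hrow hwt] := htab _ rn.
rewrite /body; seqs; set m2 := den (agree_cmd _ _) m1.
have dm2 : dmem m2 by apply: dmem_den dm1.
have fl2 : m2 aFL [::] = Num (agree_on nv (lower j) (row j r) s).
  rewrite /m2 (@agree_spec _ _ D nu k nv pl _ _ false j r s) // 1?ltnW //.
  - by move=> m' kp'; rewrite eval_rdE (kp' aJ isT) fr.
  - by move=> v vn sv; rewrite fr // hrow.
  - by move=> v vn; rewrite fr // hs.
have hj2 : eval m2 (rd aJ) = Num j by rewrite eval_rdE /m2 den_frame // fr.
have hr2 : m2 aR2 [::] = Num r by rewrite /m2 den_frame.
have hw2 : eval m2 (ELoad aWT [:: rd aJ; rd aR2]) = vann (wt j r).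
  by rewrite (eval_load2 _ hj2 (eval_rd hr2)) /m2 den_frame // fr.
have hit2 : m2 aHIT [::] = vnum (iteri r G None) by rewrite /m2 den_frame.
have hb2 : beval m2 b = p r.
  apply: hb => // a na; rewrite /m2 den_frame; first exact: fr.
  by apply: notin_sub na.
rewrite /set_reg; mem; rewrite /when den_if !beval_and beval_not hb2.
rewrite (beval_bot dm2 hw2) (beval_bot dm2 (eval_rd hit2)).
rewrite (beval_eq (eval_rd fl2) (erefl (eval m2 (ENum 1)))).
have -> : iteri r.+1 G None = if [&& p r, isSome (wt j r) & agree_on nv (lower j) (row j r) s]
   && ~~ isSome (iteri r G None) then Some r else iteri r G None by [].
rewrite (_ : (_ && _) && _ = [&& p r, isSome (wt j r) & agree_on nv (lower j) (row j r) s]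
   && ~~ isSome (iteri r G None)); last first.
  by case: (wt j r); case: (agree_on _ _ _ _); case: (p r); case: (iteri r G None).
by case: ifP => _; [rewrite den_wr; mem; rewrite eval_rdE hr2 | rewrite den_skip].
Qed.

Definition has_links m j : Prop := forall r, r < rows ->
  m aFIRST (num2 j r) = vnum (first_row D k nv pl wt j r) /\
  m aNEXT (num2 j r) = vnum (next_row D k nv pl wt j r).

Lemma links_row_spec m j r : dmem m -> m aJ [::] = Num j -> m aR [::] = Num r ->
  j < nv -> r < rows -> (forall i, i < nv -> has_table m i) ->
  let m' := den (load_row_cmd (parent_e (rd aJ)) (rd aR);; find_cmd true_b;;
        Store aFIRST [:: rd aJ; rd aR] (rd aHIT);;
        load_row_cmd (rd aJ) (rd aR);; find_cmd (BLt (rd aR) (rd aR2));;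
        Store aNEXT [:: rd aJ; rd aR] (rd aHIT)) m in
  (m' aFIRST = update m aFIRST (num2 j r) (vnum (first_row D k nv pl wt j r)) aFIRST) /\
  (m' aNEXT = update m aNEXT (num2 j r) (vnum (next_row D k nv pl wt j r)) aNEXT).
Proof.
move=> dm hj hr jn rn htab; seqs.
set m1 := den (load_row_cmd _ _) m; set m2 := den (find_cmd true_b) m1.
set m3 := den (Store aFIRST _ _) m2; set m4 := den (load_row_cmd _ _) m3.
set m5 := den (find_cmd _) m4.
have dm1 : dmem m1 by apply: dmem_den dm.
have dm2 : dmem m2 by apply: dmem_den dm1.
have dm3 : dmem m3 by apply: dmem_den dm2.
have dm4 : dmem m4 by apply: dmem_den dm3.
have hj1 : m1 aJ [::] = Num j by rewrite /m1 den_frame.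
have hj2 : m2 aJ [::] = Num j by rewrite /m2 den_frame.
have hr2 : m2 aR [::] = Num r by rewrite /m2 den_frame // /m1 den_frame.
have hj3 : m3 aJ [::] = Num j by rewrite /m3 den_frame.
have hr3 : m3 aR [::] = Num r by rewrite /m3 den_frame.
have hj5 : m5 aJ [::] = Num j by rewrite /m5 den_frame // /m4 den_frame.
have hr5 : m5 aR [::] = Num r by rewrite /m5 den_frame // /m4 den_frame.
have tab1 i : i < nv -> has_table m1 i by move=> im; apply: has_table_den => //; apply: htab.
have tab4 i : i < nv -> has_table m4 i.
  by move=> im; do 3!apply: has_table_den => //; apply: tab1.
have tab3 i : i < nv -> has_table m3 i by move=> im; do 2!apply: has_table_den => //; apply: tab1.
have [_ /andP[jp pn] _ _] := valid_tableP plan_ok jn.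
have sg1 : has_assignment m1 (cut (parent j) r).
  apply: (@load_row_spec _ _ D nu k) => //.
    move=> m' kp; have [bm' _ _] : dmem m' by apply: (dmem_keeps _ kp dm).
    rewrite eval_rdE (kp aR isT) hr; split=> //; apply: (eval_parent bm' _ (ltnW jn)).
    by rewrite eval_rdE (kp aJ isT).
  move=> v vn sv; have pm : parent j < nv.
    move: pn; rewrite leq_eqVlt => /orP[/eqP ep|//].
    by have [_ _ /negbTE] := valid_tableP plan_ok vn; rewrite -ep sv.
  by have [h _] := htab _ pm r rn; apply: h.
have hit2 : m2 aHIT [::] = vnum (first_row D k nv pl wt j r).
  rewrite /m2 (@find_spec _ _ j (cut (parent j) r) predT) // ?filter_predT; last exact: tab1.
  rewrite /first_row; congr (vnum (ohead _)); apply: matching_dep.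
  by apply/agree_onP => v vn lv; rewrite /cut (lower_parent plan_ok jn vn lv).
have sg4 : has_assignment m4 (cut j r).
  apply: (@load_row_spec _ _ D nu k) => //; first exact: ltnW.
    by move=> m' kp; rewrite !eval_rdE (kp aR isT) (kp aJ isT).
  by have [h _] := tab3 _ jn r rn.
have hit5 : m5 aHIT [::] = vnum (next_row D k nv pl wt j r).
  rewrite /m5 (@find_spec _ _ j (cut j r) (fun r' => r < r')) //; last 2 first.
  - exact: tab4.
  - move=> m' r' kp hr'; apply: beval_lt; last exact: hr'.
    by rewrite eval_rdE (kp aR isT) /m4 den_frame.
  - rewrite /next_row; congr (vnum (ohead _)); congr filter; apply: matching_dep.
    by apply/agree_onP => v vn /andP[sv _]; rewrite /cut sv.
  - by rewrite /m4 den_frame.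
rewrite (den_store2 _ _ (eval_rd hj5) (eval_rd hr5)) eval_rdE hit5.
have e3 : m3 = update m2 aFIRST (num2 j r) (vnum (first_row D k nv pl wt j r)).
  by rewrite /m3 (den_store2 _ _ (eval_rd hj2) (eval_rd hr2)) eval_rdE hit2.
have f5 : m5 aFIRST = m3 aFIRST by rewrite /m5 den_frame // /m4 den_frame.
have f2 : m2 aFIRST = m aFIRST by rewrite /m2 den_frame // /m1 den_frame.
have n5 : m5 aNEXT = m aNEXT.
  by rewrite /m5 den_frame // /m4 den_frame // /m3 den_frame // /m2 den_frame // /m1 den_frame.
split; mem; first by rewrite f5 e3; mem; rewrite f2.
by rewrite n5.
Qed.

Lemma links_spec m : dmem m -> (forall i, i < nv -> has_table m i) ->
  forall j, j < nv -> has_links (den links_cmd m) j.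
Proof.
move=> dm htab; rewrite /links_cmd; set body := load_row_cmd _ _;; _; set inner := For aR _ _.
apply: (@for_ind _ _ aJ aVARS inner m nv
  (fun t (m' : memory) => forall j, j < t -> has_links m' j) (dmem_vars dm)) => //.
move=> j m1 jn hj kp links1; have dm1 : dmem m1 by apply: (dmem_keeps _ kp dm).
have hn : m1 aROWS [::] = Num rows by case: dm1.
have tab1 i : i < nv -> has_table m1 i by move=> im; apply: (has_table_keeps _ kp) => //; apply: htab.
pose inv t (m' : memory) := (forall i, i < j -> has_links m' i) /\ forall r, r < t ->
  m' aFIRST (num2 j r) = vnum (first_row D k nv pl wt j r) /\
  m' aNEXT (num2 j r) = vnum (next_row D k nv pl wt j r).
have [h1 h2] : inv rows (den inner m1).
  apply: (@for_ind _ _ aR aROWS body m1 rows inv hn); first by split.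
  move=> r m2 rn hr kp2 [l2 r2]; have dm2 : dmem m2 by apply: (dmem_keeps _ kp2 dm1).
  have hj2 : m2 aJ [::] = Num j by rewrite (kp2 aJ isT).
  have tab2 i : i < nv -> has_table m2 i.
    by move=> im; apply: (has_table_keeps _ kp2) => //; apply: tab1.
  have [e1 e2] := links_row_spec dm2 hj2 hr jn rn tab2.
  rewrite -/body in e1 e2; rewrite /set_reg; split.
    move=> i ij r' rn'; have [f1 f2] := l2 i ij r' rn'.
    by mem; rewrite e1 e2; mem; rewrite eq_num2 (ltn_eqF ij).
  move=> r'; mem; rewrite e1 e2; mem; rewrite ltnS leq_eqVlt eq_num2 eqxx.
  by case: (eqVneq r' r) => [->|_ /=] //; apply: r2.
move=> i; rewrite ltnS leq_eqVlt => /orP[/eqP->//|]; exact: h1.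
Qed.
End Tables.

(** * The program moves the odometer *)

Section Enumeration.
Variables (Const : eqType) (g : query Const).
Variables (D : seq (fact Const)) (nu : fact Const -> carrier g) (k nv : nat).
Variable pl : nat -> nat -> nat -> nat.
Local Notation K := (carrier g).
Local Notation memory := (memory Const K).
Local Notation value := (value Const K).
Local Notation vcst := (@vcst Const g).
Local Notation vann := (@vann Const g).
Local Notation vnum := (@vnum Const g).
Local Notation scope := (scope pl).
Local Notation parent := (parent pl).
Local Notation host := (host pl).
Local Notation row := (row D pl).
Local Notation rows := (row_number D k).
Local Notation num1 := (@num1 Const).
Local Notation num2 := (@num2 Const).
Let bound := nv + size (body g) + max_arity g + k + 8.
Implicit Types (m : memory) (s : nat -> option Const).

Hypothesis query_ok : semiring_query g.
Hypothesis database_ok : database_over (qschema g) D.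
Hypothesis plan_ok : valid_plan g k nv pl.

Local Notation wt := (@wt Const g D nu k nv pl).
Local Notation dmem := (@dmem Const g D nu k nv pl).
Local Notation cut := (cut D pl).
Local Notation lower := (lower pl).
Local Notation free := (free g pl).
Local Notation has_table := (@has_table Const g D nu k nv pl).
Local Notation has_links := (@has_links Const g D nu k nv pl).
Local Notation ff := (first_free g nv pl).
Local Notation state_ok := (@state_ok Const g D k nv pl wt).
Local Notation matching := (@matching Const g D k nv pl wt).
Local Notation next_row := (@next_row Const g D k nv pl wt).
Local Notation first_row := (@first_row Const g D k nv pl wt).
Local Notation chain := (@chain Const g D k nv pl wt).
Local Notation restart := (@restart Const g D k nv pl wt).

Definition emem m : Prop := [/\ dmem m, forall j, j < nv -> has_table m j,
  forall j, j < nv -> has_links m j & m aWT (num2 nv 0) = vann (wt nv 0)].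

Lemma emem_keeps W m m' : all [predC W] (data_arrays ++ [:: aROW; aWT; aFIRST; aNEXT]) ->
  keeps W m m' -> emem m -> emem m'.
Proof.
rewrite all_cat => /andP[hW /= /and5P[h1 h2 h3 h4 _]] kp [dm tm lm wm].
split; [exact: dmem_keeps hW kp dm | | | by rewrite kp].
- by move=> j jn; apply: (has_table_keeps _ kp); [rewrite /= h1 h2 | apply: tm].
- by move=> j jn r rn; rewrite !kp //; apply: lm.
Qed.

Lemma emem_den c m : all [predC writes c] (data_arrays ++ [:: aROW; aWT; aFIRST; aNEXT]) ->
  emem m -> emem (den c m).
Proof. by move=> h; apply: (emem_keeps h) => a ha; apply: den_frame. Qed.

Definition holds_state c m st : Prop :=
  forall i, c <= i <= nv -> m aCURROW (num1 i) = Num (row_of c st i).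

(** The common form of the initial state and of the state after a carry. *)
Fixpoint refilled p st n : seq nat :=
  if n is n.+1 then restart (p - n.+1) (refilled p st n) else st.

Lemma start_stateE t : start_state D k nv pl wt t = refilled nv [::] t.
Proof. by elim: t => //= t ->. Qed.

(** Unfolds the recursive carry into what [advance_cmd] does: find the first table whose row has a
    successor, move it on and refill all the tables below. *)
Lemma next_stateE t st : t <= nv -> size st = t -> let c := nv - t in
  next_state D k nv pl wt t st =
  if ohead [seq j <- iota c t | isSome (next_row j (row_of c st j))] is Some j then
    Some (refilled j (odflt 0 (next_row j (row_of c st j)) :: drop (j - c).+1 st) (j - c))
  else None.
Proof.
elim: t st => [|t IH] [|r st] // tm [sz]; rewrite [let c := _ in _]/=.
have eS : (nv - t.+1).+1 = nv - t by move: tm; clear; lia.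
rewrite [iota _ _]/= [filter _ _]/= row_of_head [next_state _ _ _ _ _ _ _]/=.
case e : (next_row (nv - t.+1) r) => [r'|] /=; first by rewrite row_of_head e subnn drop0.
rewrite IH ?(ltnW tm) //= eS.
rewrite [in RHS](@eq_in_filter _ _ (fun j => isSome (next_row j (row_of (nv - t) st j)))); last first.
  by move=> j; rewrite mem_iota => /andP[h _] /=; rewrite row_of_cons eS.
case e' : (ohead _) => [j|] //=.
have cj : nv - t <= j.
  have : j \in [seq j <- iota (nv - t) t | isSome (next_row j (row_of (nv - t) st j))].
    by move: e'; case: [seq _ <- _ | _] => //= x l [->]; rewrite mem_head.
  by rewrite mem_filter mem_iota => /and3P[].
rewrite row_of_cons ?eS //.
have -> : j - (nv - t.+1) = (j - (nv - t)).+1 by move: tm cj; clear; lia.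
rewrite /= (_ : j - (j - (nv - t)).+1 = nv - t.+1) //.
by move: tm cj; clear; lia.
Qed.

Hypothesis root_ok : isSome (wt nv 0).

Let tab_ok : is_table D nu k nv pl wt := wt_is_table D nu plan_ok.

Lemma ff_le : ff <= nv.
Proof. exact: first_at_le. Qed.

(** The existence of a row also shows [0 < rows], so that row 0 of the root is a valid index into
    the tabulated links. *)
Lemma restart_ok j st : ff <= j < nv -> state_ok j.+1 st ->
  [/\ state_ok j (restart j st),
      exists r, first_row j (row_of j.+1 st (parent j)) = Some r & 0 < rows].
Proof.
move=> fj ok; have := chain_neq_nil plan_ok tab_ok root_ok fj ok.
have /andP[_ jn] := fj; rewrite /chain /restart /first_row.
case e : (matching _ _) => [//|r l] _; split; last 2 first.
- by exists r.
- have : r \in matching j (row (parent j) (row_of j.+1 st (parent j))).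
    by rewrite e mem_head.
  by rewrite mem_filter mem_iota => /and3P[_ _]; apply: leq_trans.
by apply/(state_okS D wt plan_ok _ _ jn); split=> //; rewrite /chain e mem_head.
Qed.

Lemma refilled_ok p st n : ff <= p <= nv -> state_ok p st -> n <= p - ff ->
  state_ok (p - n) (refilled p st n).
Proof.
move=> /andP[fp pn] ok; elim: n => [|n IH] lt_n; first by rewrite subn0.
have eS : (p - n.+1).+1 = p - n by move: lt_n; clear; lia.
have [//||h _ _] := @restart_ok (p - n.+1) (refilled p st n) _ _ => //.
  by move: lt_n fp pn; clear; lia.
by rewrite eS; apply: IH; apply: ltnW.
Qed.

Lemma state_row_lt c st i : state_ok c st -> c <= i <= nv -> 0 < rows -> row_of c st i < rows.
Proof.
move=> [sz h] /andP[ci]; rewrite leq_eqVlt => /orP[/eqP->|im] rn; first by rewrite row_of_last.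
by have := h i; rewrite ci im mem_filter mem_iota => /(_ isT)/and3P[].
Qed.

Lemma refill_spec m p st : emem m -> m aPOS [::] = Num p -> ff <= p <= nv ->
  state_ok p st -> holds_state p m st ->
  holds_state ff (den refill_cmd m) (refilled p st (p - ff)).
Proof.
move=> em hp /andP[fp pn] ok hst; rewrite /refill_cmd; set body := _;; _.
have fpn : ff <= p <= nv by rewrite fp.
have hn : m aVARS [::] = Num nv by case: em => /dmem_vars.
(* After [t] rounds the tables from [nv - t] on have been visited; [steps t] counts those among them
   that lie between [ff] and [p] and were refilled. Truncated subtraction gives 0 until the loop
   gets below [p]. *)
pose steps t := minn (p - ff) (p - (nv - t)).
have steps_le t : steps t <= p - ff by apply: geq_minl.
pose inv t (m' : memory) := holds_state (p - steps t) m' (refilled p st (steps t)).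
suff : inv nv (den (For aT aVARS body) m).
  by rewrite /inv /steps subnn subn0 (minn_idPl _) ?leq_subr // subKn.
apply: (@for_ind _ _ aT aVARS body m nv inv hn).
  by rewrite /inv /steps subn0 (_ : p - nv = 0) ?minn0 ?subn0 //; apply/eqP; rewrite subn_eq0.
move=> t m1 tn it kp inv1; have em1 : emem m1 by apply: (emem_keeps _ kp em).
have [dm1 _ lm1 _] := em1; rewrite /body; seqs; set m2 := den (wr aI _) m1.
have em2 : emem m2 by apply: emem_den em1.
have [dm2 _ lm2 _] := em2.
set i := nv - t.+1; have im : i < nv by move: tn; rewrite /i; clear; lia.
have hi2 : eval m2 (rd aI) = Num i.
  rewrite eval_rdE /m2 den_wr; mem; rewrite /= -[load m1 16 _]/(eval m1 (rd 16)).
  rewrite -[load m1 30 _]/(eval m1 (rd 30)) !eval_rdE (dmem_vars dm1) it /=.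
  by congr Num; rewrite /i; move: tn; clear; lia.
have hp2 : eval m2 (rd aPOS) = Num p by rewrite eval_rdE /m2 den_frame // (kp aPOS isT).
rewrite /when den_if beval_and (beval_free dm2 hi2 im) (beval_lt hi2 hp2) (freeE plan_ok) //.
have c2 : m2 aCURROW = m1 aCURROW by rewrite /m2 den_frame.
case: ifP => [/andP[fi ip]|ni]; last first.
  have -> : inv t.+1 = inv t.
    rewrite /inv (_ : steps t.+1 = steps t) //.
    by move: ni tn fp pn; rewrite /steps /i; clear; lia.
  by move=> l hl; rewrite /set_reg; mem; rewrite den_skip c2 inv1.
have eS : steps t.+1 = (steps t).+1 by move: fi ip tn fp pn; rewrite /steps /i; clear; lia.
have ei : p - (steps t).+1 = i by move: fi ip tn fp pn; rewrite /steps /i; clear; lia.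
have ei' : p - steps t = i.+1 by move: fi ip tn fp pn; rewrite /steps /i; clear; lia.
have okt : state_ok i.+1 (refilled p st (steps t)).
  by rewrite -ei'; apply: refilled_ok.
have fim : ff <= i < nv by rewrite fi.
have [_ [r er] rn] := restart_ok fim okt.
have [_ /andP[ip' pn'] _ _] := valid_tableP plan_ok im.
have hpar : eval m2 (parent_e (rd aI)) = Num (parent i).
  by have [bm2 _ _] := dm2; apply: (eval_parent bm2 hi2 (ltnW im)).
have hcur : eval m2 (currow_e (parent_e (rd aI)))
    = Num (row_of i.+1 (refilled p st (steps t)) (parent i)).
  by rewrite /currow_e (eval_load1 _ hpar) c2 inv1 ei' // ip'.
have rp : row_of i.+1 (refilled p st (steps t)) (parent i) < rows.
  by apply: state_row_lt => //; rewrite ip'.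
have [hf _] := lm2 i im _ rp.
rewrite (den_store1 _ _ hi2) (eval_load2 _ hi2 hcur) hf er /inv eS ei => l hl.
rewrite /set_reg; mem; rewrite eq_num1 [refilled _ _ _]/= ei /restart er /=.
case: eqVneq => [->|nl]; first by rewrite row_of_head.
have il : i < l by rewrite ltn_neqAle eq_sym nl; case/andP: hl.
by rewrite row_of_cons // c2 inv1 ei' // il; case/andP: hl.
Qed.

Lemma output_spec m st : emem m -> state_ok ff st -> holds_state ff m st ->
  let m' := den output_cmd m in
  (forall j, ff <= j < nv -> m' 12 (num1 (var_at pl j)) = vcst (row j (row_of ff st j) j)) /\
  m' 12 [::] = vann (state_annotation nv pl wt st).
Proof.
move=> em ok hst; rewrite /output_cmd; set body := when _ _; seqs.
set m0 := den (wr aACC _) m.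
have em0 : emem m0 by apply: emem_den em.
have [dm0 _ _ _] := em0; have [dm _ _ wm] := em.
pose W t := iteri t (fun j acc => if ff <= j then omul (times g) acc (wt j (row_of ff st j)) else acc)
  (wt nv 0).
pose inv t (m' : memory) := (forall j, ff <= j < t -> j < nv ->
    m' 12 (num1 (var_at pl j)) = vcst (row j (row_of ff st j) j)) /\
  m' aACC [::] = vann (W t).
have [h1 h2] : inv nv (den (For aJ aVARS body) m0).
  apply: (@for_ind _ _ aJ aVARS body m0 nv inv (dmem_vars dm0)).
    split=> [j|]; first by rewrite ltn0 andbF.
    rewrite /set_reg; mem; rewrite /m0 den_wr; mem.
    by rewrite (eval_load2 _ (eval_rd (dmem_vars dm)) (erefl (eval m (ENum 0)))).
  move=> j m1 jn hj kp [o1 a1]; have em1 : emem m1 by apply: (emem_keeps _ kp em0).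
  have [dm1 tm1 _ _] := em1; have [bm1 _ _] := dm1.
  rewrite /body /when den_if (beval_free dm1 (eval_rd hj) jn) (freeE plan_ok) // /inv [W j.+1]/=.
  case: ifP => fj; last first.
    split=> [i /andP[fi]|]; rewrite /set_reg; mem; rewrite den_skip //.
    rewrite ltnS leq_eqVlt => /orP[/eqP ei|ij] im; last by apply: o1; rewrite ?fi.
    by rewrite ei fj in fi.
  have hst1 : m1 aCURROW (num1 j) = Num (row_of ff st j).
    by rewrite (kp aCURROW isT) /m0 den_frame // hst // fj ltnW.
  have wj : isSome (wt j (row_of ff st j)).
    by apply: (state_row root_ok ok); rewrite fj ltnW.
  have rj : row_of ff st j < rows.
    by have := ok.2 j; rewrite fj jn mem_filter mem_iota => /(_ isT)/and3P[].
  have [hrow hwt] := tm1 j jn _ rj; have [jj _ _ _] := valid_tableP plan_ok jn.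
  have hc1 : eval m1 (currow_e (rd aJ)) = Num (row_of ff st j).
    by rewrite /currow_e (eval_load1 _ (eval_rd hj)).
  have hx1 := eval_var bm1 (eval_rd hj) (ltnW jn).
  seqs; rewrite (den_store1 _ _ hx1) (eval_load3 _ (eval_rd hj) hc1 (eval_rd hj)) hrow //.
  set m2 := update m1 12 _ _.
  have fr a : a != 12 -> m2 a = m1 a by move=> na; rewrite /m2 update_neq.
  have hc2 : eval m2 (currow_e (rd aJ)) = Num (row_of ff st j).
    by rewrite /currow_e (eval_load1 _ (eval_rd (_ : m2 aJ [::] = Num j))) ?fr.
  split=> [i /andP[fi]|]; rewrite /set_reg; mem; rewrite den_wr; mem.
    rewrite ltnS leq_eqVlt => /orP[/eqP ei|ij] im; first by rewrite /m2 ei; mem; rewrite eqxx.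
    rewrite /m2; mem; rewrite eq_num1; case: eqP => [e|_]; last by apply: o1; rewrite ?fi.
    by have e' := var_at_inj plan_ok im jn e; rewrite e' ltnn in ij.
  apply: eval_times; first by rewrite eval_rdE fr.
  by rewrite (eval_load2 _ (eval_rd (_ : m2 aJ [::] = Num j)) hc2) ?fr.
split=> [j /andP[fj jn]|]; rewrite den_wr; mem.
  by rewrite -[num1 _ == [::]]/false; apply: h1; rewrite ?fj.
rewrite eqxx eval_rdE h2 /W iteri_big /state_annotation; congr (vann (omul _ _ _)).
rewrite -{1}(subnKC ff_le) iotaD big_cat /= big_seq_cond big_pred0 ?Monoid.mul1m; last first.
  by move=> j; rewrite mem_iota add0n; case: (leqP ff j); rewrite ?andbF.
rewrite big_seq_cond [RHS]big_seq; apply: eq_bigl => j; rewrite mem_iota.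
by case: (leqP ff j); rewrite ?andbT ?andbF.
Qed.

(** The memory when an answer is due: [output_cmd] has just been run, which determines the output
    cells. *)
Definition arrived m st : Prop := exists m', [/\ m = den output_cmd m',
  emem m', state_ok ff st, holds_state ff m' st & m' aDONE [::] = Bot].

Lemma arrived_shows m st : arrived m st -> forall a, a.1 = state_assignment g D nv pl st ->
  Some a.2 = state_annotation nv pl wt st -> shows (0, m) a.
Proof.
move=> [m' [-> em ok hst _]] [f n] /= -> en; have [h1 h2] := output_spec em ok hst.
split; last by rewrite -[LHS]/(den output_cmd m' 12 [::]) h2 -en.
  exact: (state_free_vars query_ok plan_ok tab_ok ok).
move=> x /(free_varsP query_ok plan_ok) [j fj <-]; have /andP[fj' jn] := fj.
have := state_assignmentE D plan_ok st jn; rewrite fj' /values => ->.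
exact: h1.
Qed.

Lemma arrive m p st : emem m -> m aPOS [::] = Num p -> ff <= p <= nv -> state_ok p st ->
  holds_state p m st -> m aDONE [::] = Bot ->
  [/\ emem (den refill_cmd m), state_ok ff (refilled p st (p - ff)),
      holds_state ff (den refill_cmd m) (refilled p st (p - ff)) &
      den refill_cmd m aDONE [::] = Bot].
Proof.
move=> em hp pn ok hst hd; split; [exact: emem_den em | | exact: refill_spec | by rewrite den_frame].
by have := @refilled_ok p st (p - ff) pn ok (leqnn _); rewrite subKn //; case/andP: pn.
Qed.

Lemma state_ok_drop c j st : state_ok c st -> c <= j <= nv -> state_ok j (drop (j - c) st).
Proof.
move=> [sz h] /andP[cj jn]; split=> [|i /andP[ji im]].
  by rewrite size_drop sz; move: cj jn; clear; lia.
have e i' : j <= i' -> row_of j (drop (j - c) st) i' = row_of c st i'.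
  by move=> ji'; rewrite /row_of nth_drop; congr nth; move: cj ji'; clear; lia.
have [_ /andP[ip _] _ _] := valid_tableP plan_ok im.
by rewrite !e ?(leq_trans ji (ltnW ip)) //; apply: h; rewrite im (leq_trans cj).
Qed.

Lemma advance_spec m st : arrived m st ->
  match next_state D k nv pl wt (nv - ff) st with
  | Some st' => arrived (den advance_cmd m) st'
  | None => den advance_cmd m aDONE [::] = Num 1
  end.
Proof.
move=> [m' [em0 em' ok hst hd']].
have em : emem m by rewrite em0; apply: emem_den em'.
have {}hst : holds_state ff m st by move=> i hi; rewrite em0 den_frame // hst.
have hd : m aDONE [::] = Bot by rewrite em0 den_frame.
move: em hst hd; rewrite {m' em0 em' hd'} => em hst hd.
have sz : size st = nv - ff by case: ok.
rewrite next_stateE ?leq_subr // subKn ?ff_le //.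
rewrite /advance_cmd; set body := when _ _; seqs; set m0 := den (wr aHIT _) m.
have [dm _ _ _] := em; have em0 : emem m0 by apply: emem_den em.
have [dm0 _ _ _] := em0.
set Q := fun j => isSome (next_row j (row_of ff st j)).
(* [hit t] is the first table below [t] that can move on, and [cur t] gives the current rows once it
   has moved. *)
pose hit t := ohead [seq j <- iota 0 t | (ff <= j) && Q j].
pose cur t i := if hit t == Some i then odflt 0 (next_row i (row_of ff st i)) else row_of ff st i.
pose inv t (m' : memory) := m' aHIT [::] = vnum (hit t) /\
  forall i, ff <= i <= nv -> m' aCURROW (num1 i) = Num (cur t i).
set m1 := den (For aJ aVARS body) m0; have em1 : emem m1 by apply: emem_den em0.
have [hit1 cur1] : inv nv m1.
  apply: (@for_ind _ _ aJ aVARS body m0 nv inv (dmem_vars dm0)).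
    rewrite /inv /set_reg; split=> [|i hi]; mem; rewrite /m0 den_wr; mem.
      by rewrite eval_rdE (dmem_bot dm).
    by rewrite hst.
  move=> j m2 jn hj kp [h2 c2]; have em2 : emem m2 by apply: (emem_keeps _ kp em0).
  have [dm2 _ lm2 _] := em2.
  have hitS : hit j.+1 = if (ff <= j) && Q j && ~~ isSome (hit j) then Some j else hit j.
    by rewrite /hit -!iteri_ohead.
  have hit_lt i : hit j = Some i -> i < j.
    rewrite /hit => h; have : i \in [seq j <- iota 0 j | (ff <= j) && Q j].
      by move: h; case: [seq _ <- _ | _] => //= x l [->]; rewrite mem_head.
    by rewrite mem_filter mem_iota => /and3P[].
  rewrite /body /when den_if !beval_and beval_not (beval_free dm2 (eval_rd hj) jn) (freeE plan_ok) //.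
  rewrite (beval_bot dm2 (eval_rd h2)).
  rewrite /inv /cur hitS; case fj : (ff <= j); last first.
    by rewrite !andFb den_skip /set_reg; split=> [|i hi]; mem; rewrite ?c2.
  rewrite !andTb.
  have hc : m2 aCURROW (num1 j) = Num (row_of ff st j).
    rewrite c2; last by rewrite fj (ltnW jn).
    by rewrite /cur; case: eqP => // /hit_lt; rewrite ltnn.
  have hce : eval m2 (currow_e (rd aJ)) = Num (row_of ff st j).
    by rewrite /currow_e (eval_load1 _ (eval_rd hj)).
  have rj : row_of ff st j < rows.
    by have := ok.2 j; rewrite fj jn mem_filter mem_iota => /(_ isT)/and3P[].
  have [_ hnx] := lm2 j jn _ rj.
  have hne : eval m2 (ELoad aNEXT [:: rd aJ; currow_e (rd aJ)]) = vnum (next_row j (row_of ff st j)).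
    by rewrite (eval_load2 _ (eval_rd hj) hce).
  rewrite (beval_bot dm2 hne) {1}/Q.
  rewrite (_ : _ && _ = Q j && ~~ isSome (hit j)); last first.
    by rewrite /Q; case: (hit j); case: (next_row _ _).
  case: ifP => [/andP[Qj nh]|_]; last by rewrite /set_reg; split=> [|i hi]; mem; rewrite ?den_skip ?c2.
  seqs; rewrite (den_store1 _ _ (eval_rd hj)) hne den_wr /set_reg; split=> [|i hi]; mem.
    by rewrite eval_rdE; mem; rewrite hj.
  rewrite eq_num1 (inj_eq Some_inj) [j == i]eq_sym; case: eqVneq => [->|ni].
    by move: Qj; rewrite /Q; case: (next_row _ _).
  by rewrite c2 // /cur; case: (hit j) nh.
have [dm1 _ _ _] := em1.
have hitE : hit nv = ohead [seq j <- iota ff (nv - ff) | Q j].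
  rewrite /hit -[X in iota 0 X](subnKC ff_le) iotaD filter_cat (_ : [seq j <- iota 0 ff | _] = [::]) /=.
    by congr ohead; apply: eq_in_filter => j; rewrite mem_iota => /andP[->].
  apply/eqP; rewrite -[_ == _]negbK -has_filter; apply/hasPn => j; rewrite mem_iota add0n => /= h.
  by rewrite leqNgt h.
rewrite -/Q -hitE; have hd1 : m1 aDONE [::] = Bot.
  by rewrite /m1 den_frame // /m0 den_frame.
rewrite den_if (beval_bot dm1 (eval_rd hit1)).
case eh : (hit nv) hit1 => [j|] hit1; last by rewrite den_frame // den_wr; mem.
have : j \in [seq j <- iota ff (nv - ff) | Q j].
  by move: eh; rewrite hitE; case: [seq _ <- _ | _] => //= x l [->]; rewrite mem_head.
rewrite mem_filter mem_iota subnKC ?ff_le // => /and3P[Qj fj jn].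
seqs; set m2 := den (wr aPOS _) m1.
have em2 : emem m2 by apply: emem_den em1.
have hp2 : m2 aPOS [::] = Num j by rewrite /m2 den_wr; mem.
set st' := odflt 0 _ :: drop _ _.
have okd := @state_ok_drop ff j st ok; rewrite fj (ltnW jn) in okd.
have ok' : state_ok j st'.
  have ed : drop (j - ff) st = row_of ff st j :: drop (j - ff).+1 st.
    by rewrite (drop_nth 0) // sz; move: fj jn; clear; lia.
  have := okd isT; rewrite ed => /(state_okS D wt plan_ok _ _ jn)[ok1 hr].
  apply/(state_okS D wt plan_ok _ _ jn); split=> //.
  have := next_row_chain jn hr; move: Qj; rewrite /Q; case: (next_row _ _) => //= r' _.
  case e : [seq _ <- _ | _] => [//|x l] [->].
  have : x \in [seq r' <- chain j (drop (j - ff).+1 st) | row_of ff st j < r'] by rewrite e mem_head.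
  by rewrite mem_filter => /andP[].
have hst' : holds_state j m2 st'.
  move=> i /andP[ji im]; rewrite /m2 den_frame // cur1 ?(leq_trans fj) // /cur eh.
  rewrite (inj_eq Some_inj); move: ji; rewrite leq_eqVlt => /orP[/eqP <-|ji].
    by rewrite eqxx row_of_head.
  rewrite (ltn_eqF ji) row_of_cons // /row_of nth_drop; congr (Num (nth _ _ _)).
  by move: fj ji; clear; lia.
have jn' : ff <= j <= nv by rewrite fj ltnW.
have hd2 : m2 aDONE [::] = Bot by rewrite /m2 den_frame.
have [h1 h2 h3 h4] := arrive em2 hp2 jn' ok' hst' hd2.
by exists (den refill_cmd m2).
Qed.

Lemma start_spec m : emem m -> m aDONE [::] = Bot ->
  arrived (den start_cmd m) (start_state D k nv pl wt (nv - ff)).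
Proof.
move=> em hd; rewrite /start_cmd; seqs; set m1 := den (Store aCURROW _ _) m.
set m2 := den (wr aPOS _) m1; have em1 : emem m1 by apply: emem_den em.
have em2 : emem m2 by apply: emem_den em1.
have [dm _ _ _] := em; have [dm1 _ _ _] := em1.
have hp2 : m2 aPOS [::] = Num nv.
  by rewrite /m2 den_wr; mem; rewrite eval_rdE (dmem_vars dm1).
have ok2 : state_ok nv [::].
  by split; rewrite ?subnn // => i; rewrite ltnNge; case: leqP.
have hst2 : holds_state nv m2 [::].
  move=> i; rewrite -eqn_leq => /eqP <-; rewrite /m2 den_frame // /m1.
  by rewrite (den_store1 _ _ (eval_rd (dmem_vars dm))); mem; rewrite eqxx row_of_last ?subnn.
have hd2 : m2 aDONE [::] = Bot by rewrite /m2 den_frame // /m1 den_frame.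
have [|h1 h2 h3 h4] := arrive em2 hp2 _ ok2 hst2 hd2; first by rewrite ff_le leqnn.
rewrite start_stateE; set m3 := den refill_cmd m2 in h1 h3 h4 *.
exists m3; split=> //; have [dm3 _ _ w3] := h1.
have hw : eval m3 (ELoad aWT [:: rd aVARS; ENum 0]) = vann (wt nv 0).
  by rewrite (eval_load2 _ (eval_rd (dmem_vars dm3)) (erefl (eval m3 (ENum 0)))).
by rewrite /when den_if (beval_bot dm3 hw); case: (wt nv 0) root_ok.
Qed.
End Enumeration.

(** * Searching for a plan *)

Section Search.
Variables (Const : eqType) (g : query Const) (k : nat).
Local Notation K := (carrier g).
Local Notation memory := (memory Const K).
Let nu0 : fact Const -> K := fun=> munit (times g).

(** A memory built by hand that satisfies [base] for two plans at once if they agree on the decoded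
    part; running [check_cmd] on it shows that they are both valid or both invalid. *)
Definition plan_memory nv pl : memory := fun a i =>
  if a < 12 then @input_memory Const g [::] nu0 a i else
  match a, i with
  | aVARS, [::] => Num nv
  | aARITY, [::] => Num (max_arity g)
  | aK, [::] => Num k
  | aPLAN, [:: inl f; inl j; inl l] => Num (pl f j l)
  | aLEVEL, [:: inl j] => Num (level g (var_at pl j))
  | _, _ => Bot
  end.

(* The program that checks plans reads only the bounded part, so that the check
   depends on nothing else. *)
Lemma valid_plan_ext nv pl pl' :
  let b := nv + size (body g) + max_arity g + k + 8 in
  (forall f j i, f < 8 -> j < b -> i < b -> pl f j i = pl' f j i) ->
  valid_plan g k nv pl = valid_plan g k nv pl'.
Proof.
move=> b e; set m := plan_memory nv pl.
have in_b j : j <= nv -> j < b by rewrite /b; clear; lia.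
have bm pl0 : (forall f j i, f < 8 -> j < b -> i < b -> pl f j i = pl0 f j i) ->
    base [::] nu0 k nv pl0 m.
  move=> e0; split=> //; first by move=> a ha; rewrite /m /plan_memory; case: a ha; do 12?case=> //.
  by split=> // f j i hf hj hi; rewrite -e0.
have lm : has_levels nv pl m by move=> j.
have lm' : has_levels nv pl' m.
  move=> j jn; have -> : m aLEVEL (num1 Const j) = Num (level g (var_at pl j)) by [].
  by rewrite /var_at e // in_b // ltnW.
have c := check_spec (bm pl (fun _ _ _ _ _ _ => erefl)) lm.
have c' := check_spec (bm pl' e) lm'.
by move: c; rewrite c'; case: (valid_plan g k nv pl); case: (valid_plan g k nv pl').
Qed.

Definition code_ok n := valid_plan g k (unpair n).1 (decode3 (unpair n).2).

(** A code prescribes the plan on a finite part only, which is all that validity depends on. *)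
Lemma code_exists : pghw_at_most g k -> exists n, code_ok n.
Proof.
case/valid_plan_exists => nv [pl ok]; set b := nv + size (body g) + max_arity g + k + 8.
have [n hn] := decode3_surj pl b; have [n' e] := unpair_surj nv n.
exists n'; rewrite /code_ok e /= -(@valid_plan_ext nv pl) // => f j i hf hj hi.
by rewrite hn //; move: hf; rewrite /b; clear; lia.
Qed.

Section Iterations.
Variables (D : seq (fact Const)) (nu : fact Const -> K).

Definition search_memory n : memory :=
  iter n (den search_cmd) (den (init_cmd k) (@input_memory Const g D nu)).

Lemma search_memory_ready n : ready D nu k n (search_memory n).
Proof.
elim: n => [|n IH]; first by have [] := @init_spec Const g D nu k.
by have [] := search_spec IH.
Qed.

Lemma search_memory_found n : search_memory n aFOUND [::] =
  if has code_ok (iota 0 n) then Num 1 else Bot.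
Proof.
elim: n => [|n IH]; first by have [] := @init_spec Const g D nu k.
have [_ _ _ e] := search_spec (search_memory_ready n).
rewrite -[LHS]/(den search_cmd (search_memory n) aFOUND [::]) e IH.
rewrite -[in iota 0 n.+1]addn1 iotaD has_cat add0n -/(code_ok n) /=.
by case: (code_ok n); case: (has _ _).
Qed.

Lemma search_memory_frame n a : a \notin writes (init_cmd k) ++ writes search_cmd ->
  search_memory n a = @input_memory Const g D nu a.
Proof.
rewrite mem_cat negb_or => /andP[h1 h2].
elim: n => [|n IH]; first exact: (@den_frame _ _ (init_cmd k)).
by rewrite -[search_memory n.+1]/(den search_cmd (search_memory n)) den_frame.
Qed.
End Iterations.

Definition search_time D nu n :=
  cost (init_cmd k) (@input_memory Const g D nu)
  + \sum_(0 <= i < n) (cost search_cmd (search_memory D nu i) + 2).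

(** The database is stored in the arrays 8 to 11, and neither [init_cmd] nor [search_cmd] uses
    them. *)
Lemma search_time_const D nu n : search_time D nu n = search_time [::] nu0 n.
Proof.
pose A := [pred a | a \notin [:: 8; 9; 10; 11]].
have a0 : agree A (@input_memory Const g D nu) (@input_memory Const g [::] nu0).
  by move=> a Aa i; move: a Aa i; do 12![case=> //].
have [a1 e1] := den_agree (c := init_cmd k) a0 isT.
have ms i : agree A (search_memory D nu i) (search_memory [::] nu0 i).
  elim: i => [|i IH]; first exact: a1.
  by have [h _] := den_agree (c := search_cmd) IH isT; apply: h.
rewrite /search_time; apply: f_equal2; first exact: e1.
apply: eq_bigr => i _; apply: (f_equal (addn^~ 2)).
by have [_ ->] := den_agree (c := search_cmd) (ms i) isT.
Qed.
End Search.

(** ** Running times *)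

Definition data_degree k b := if b == 8 then 1 else if b == aROWS then k else 0.

Definition data_bound k M N b := if b == 8 then N else if b == aROWS then N ^ k else M.

Lemma data_cost_poly k M c : poly_bounded (loop_degree (data_degree k) c)
  (fun N => max_cost (data_bound k M N) c).
Proof.
apply: max_cost_poly => b _; rewrite /data_bound /data_degree.
case: ifP => _; first by exists 1 => N; rewrite mul1n expn1.
case: ifP => _; last exact: poly_bounded_const.
by exists 1 => N; rewrite mul1n; case: k => // k; rewrite leq_exp2r.
Qed.

Lemma poly_bounded_shift d f s : poly_bounded d f ->
  exists B, forall N, f (N + s) <= B * (N ^ d).+1.
Proof.
(* For [N >= 1] one has [N + s + 1 <= 2 * (s + 1) * N]; for [N = 0] the constant alone is enough. *)
move=> [B hB]; exists (B * (2 * s.+1) ^ d) => N; apply: leq_trans (hB _) _.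
rewrite -mulnA leq_mul2l; apply/orP; right.
case: N => [|N].
  apply: leq_trans (_ : (2 * s.+1) ^ d <= _); last exact: leq_pmulr.
  by case: d {hB} => // d; rewrite leq_exp2r // add0n leq_pmull.
apply: leq_trans (_ : (2 * s.+1 * N.+1) ^ d <= _); last by rewrite expnMn leq_mul2l leqnSn orbT.
by case: d {hB} => // d; rewrite leq_exp2r //; clear; nia.
Qed.

(** A fact of arity 0 adds nothing to [db_size], but there is at most one such fact for each
    relation name. *)
Lemma size_db (Const : eqType) (sg : schema) (D : seq (fact Const)) :
  database_over sg D -> size D <= db_size D + size sg.
Proof.
case/andP => uD /allP fD.
rewrite -(count_predC (fun phi : fact Const => phi.2 != [::]) D); apply: leq_add.
  rewrite /db_size; elim: D {uD fD} => [|phi D IH]; first by rewrite big_nil.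
  by rewrite big_cons /=; apply: leq_add IH; case: (phi.2).
rewrite -size_filter; set l := filter _ D.
have -> : size l = size (map fst l) by rewrite size_map.
rewrite -[size sg](size_iota 0); apply: uniq_leq_size.
  rewrite map_inj_in_uniq ?filter_uniq // => -[r a] [r' a'].
  by rewrite !mem_filter /= !negbK => /andP[/eqP-> _] /andP[/eqP-> _] ->.
move=> r /mapP[phi]; rewrite mem_filter => /andP[_ /fD/eqP h] ->.
by rewrite mem_iota add0n /=; move: (onthTE sg phi.1); rewrite h.
Qed.

Lemma data_cost_mono k M N N' c : N <= N' ->
  max_cost (data_bound k M N) c <= max_cost (data_bound k M N') c.
Proof.
move=> le_N; elim: c => //= [c1 h1 c2 h2|b c1 h1 c2 h2|i b c h].
- exact: leq_add.
- by rewrite -!addnA !leq_add2l leq_add.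
rewrite leq_add2l; apply: leq_mul; last by rewrite leq_add2r.
rewrite /data_bound; case: ifP => // _; case: ifP => // _.
by case: k {h} => // k; rewrite leq_exp2r.
Qed.

Lemma enumerates_leq (Const : eqType) (g : query Const) P D (nu : fact Const -> carrier g)
    pre pre' delay : pre <= pre' -> enumerates P D nu pre delay -> enumerates P D nu pre' delay.
Proof.
move=> le_pre [t0 [ts [tend [out [h1 h2 h3 h4 h5]]]]].
by exists t0, ts, tend, out; split=> //; apply: leq_trans le_pre.
Qed.

Lemma successive_nth (T : eqType) (next : T -> option T) l o x0 i : successive next l o -> i < size l ->
  next (nth x0 l i) = if i.+1 < size l then Some (nth x0 l i.+1) else o.
Proof.
elim: l i => // x l IH [|i] /= /andP[/eqP h ol]; last exact: IH.
by rewrite h; case: l {IH h ol}.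
Qed.

Lemma den_seq (Const : eqType) (g : query Const) c1 c2 (m : memory Const (carrier g)) :
  den (c1;; c2) m = den c2 (den c1 m).
Proof. by []. Qed.

(** * Correctness and cost of the data phase *)

Section DataBounds.
Variables (Const : eqType) (g : query Const).
Variables (D : seq (fact Const)) (nu : fact Const -> carrier g) (k nv : nat).
Variable pl : nat -> nat -> nat -> nat.
Local Notation wt := (@wt Const g D nu k nv pl).
Local Notation dmem := (@dmem Const g D nu k nv pl).
Local Notation arrived := (@arrived Const g D nu k nv pl).
Local Notation ff := (first_free g nv pl).
Local Notation states := (@states Const g D k nv pl wt (nv - ff)).
Hypothesis query_ok : semiring_query g.
Hypothesis database_ok : database_over (qschema g) D.
Hypothesis plan_ok : valid_plan g k nv pl.

Lemma tables_phase_spec m : dmem m -> @has_assignment Const g nv m (fun=> None) ->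
  m aDONE [::] = Bot ->
  if isSome (wt nv 0) then arrived (den tables_phase m) (start_state D k nv pl wt (nv - ff))
  else den tables_phase m aDONE [::] = Num 1.
Proof.
move=> dm hs hd; rewrite /tables_phase (den_seq tables_cmd) (den_seq links_cmd).
have [tab1 wt1] := tables_spec plan_ok dm hs; set m1 := den tables_cmd m in tab1 wt1 *.
have dm1 : dmem m1 by apply: dmem_den dm.
have links2 := links_spec plan_ok dm1 tab1; set m2 := den links_cmd m1 in links2 *.
have em2 : emem D nu k nv pl m2.
  split=> //; first by apply: dmem_den dm1.
    by move=> j jn; apply: has_table_den => //; apply: tab1.
  by rewrite /m2 den_frame.
have hd2 : m2 aDONE [::] = Bot by rewrite /m2 den_frame // /m1 den_frame.
case: ifP => [root_ok|]; first exact: (start_spec plan_ok root_ok em2 hd2).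
case e : (wt nv 0) => // _.
rewrite /start_cmd (den_seq (Store _ _ _)) (den_seq (wr _ _)) (den_seq refill_cmd) (den_seq (when _ _)).
set m3 := den (Store aCURROW _ _) m2.
set m4 := den (wr aPOS _) m3; set m5 := den refill_cmd m4.
have em3 : emem D nu k nv pl m3 by apply: emem_den em2.
have em4 : emem D nu k nv pl m4 by apply: emem_den em3.
have em5 : emem D nu k nv pl m5 by apply: emem_den em4.
have [dm5 _ _ w5] := em5; rewrite den_frame // /when den_if.
rewrite (beval_bot dm5 (eval_load2 _ (eval_rd (dmem_vars dm5)) (erefl (eval m5 (ENum 0))))).
by rewrite w5 e den_wr; mem.
Qed.

Lemma states_reached m : isSome (wt nv 0) ->
  arrived m (start_state D k nv pl wt (nv - ff)) ->
  (forall i, i < size states -> arrived (iter i (den advance_cmd) m) (nth [::] states i)) /\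
  iter (size states) (den advance_cmd) m aDONE [::] = Num 1.
Proof.
move=> root_ok am; have tab_ok := wt_is_table D nu plan_ok.
have [hd orb] := states_successive plan_ok tab_ok root_ok (leqnn _).
have step i : arrived (iter i (den advance_cmd) m) (nth [::] states i) -> i < size states ->
    if i.+1 < size states then arrived (iter i.+1 (den advance_cmd) m) (nth [::] states i.+1)
    else iter i.+1 (den advance_cmd) m aDONE [::] = Num 1.
  move=> ai lt_i; have := advance_spec plan_ok root_ok ai.
  by rewrite (successive_nth [::] orb lt_i); case: ifP.
have reach i : i < size states -> arrived (iter i (den advance_cmd) m) (nth [::] states i).
  elim: i => [|i IH] lt_i; first by move: hd; case: states lt_i => //= st l _ [->].
  by have := step i (IH (ltnW lt_i)) (ltnW lt_i); rewrite lt_i.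
split=> //; have : 0 < size states by case: states hd.
case e : (size states) => [//|n] _.
by have := step n; rewrite e ltnn => h; apply: h => //; apply: reach; rewrite e.
Qed.

Lemma rows_cost m M : base D nu k nv pl m -> k <= M ->
  cost rows_cmd m <= max_cost (data_bound k M (size D)) rows_cmd.
Proof.
move=> bm kM; apply: (@cost_le _ _ (writes rows_cmd)) => // b; rewrite !inE.
case: (bm) => _ _ _ hk _; case/orP => /eqP->; rewrite /get; first by rewrite hk.
by rewrite (base_input bm).
Qed.

Lemma tables_cost m M : dmem m -> size (body g) + nv + max_arity g + k <= M ->
  cost tables_phase m <= max_cost (data_bound k M (size D)) tables_phase.
Proof.
move=> [bm _ hr] leM; apply: (@cost_le _ _ (writes tables_phase)) => //.
move=> b hb; have : b \in [:: 2; 8; 16; 18; 19; aROWS].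
  have /allP : all (mem [:: 2; 8; 16; 18; 19; aROWS]) (bounds tables_phase) by [].
  exact.
case: (bm) => _ hv ha hk _; rewrite !inE /get.
case/or4P => [||| /or3P[||]] /eqP->.
- by rewrite (base_input bm) //= (leq_trans _ leM) // -!addnA leq_addr.
- by rewrite (base_input bm).
- by rewrite hv /= (leq_trans _ leM) // -!addnA addnCA leq_addr.
- by rewrite ha /= (leq_trans _ leM) // addnAC leq_addl.
- by rewrite hk /= (leq_trans _ leM) // leq_addl.
- by rewrite hr.
Qed.

Lemma arrived_vars m st : arrived m st -> m aVARS [::] = Num nv.
Proof. by case=> m' [-> em _ _ _]; rewrite den_frame //; have [/dmem_vars] := em. Qed.

Lemma advance_cost m st : arrived m st -> cost advance_cmd m <= max_cost (fun=> nv) advance_cmd.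
Proof.
move=> am; apply: (@cost_le _ _ (writes advance_cmd)) => // b hb.
have /allP/(_ b hb)/eqP -> : all (pred1 aVARS) (bounds advance_cmd) by [].
by rewrite /get (arrived_vars am).
Qed.
End DataBounds.

Definition enumerator k : program :=
  assemble (init_cmd k) search_cmd data_cmd advance_cmd aFOUND aDONE.

Definition exponent k :=
  maxn (loop_degree (data_degree k) rows_cmd) (loop_degree (data_degree k) tables_phase).

Section Enumerator.
Variables (Const : eqType) (g : query Const) (k : nat).
Hypothesis query_ok : semiring_query g.
Variable n0 : nat.
Hypothesis code_n0 : code_ok g k n0.
Hypothesis code_min : forall n, n < n0 -> ~~ code_ok g k n.
Let nv := (unpair n0).1.
Let pl := decode3 (unpair n0).2.
Let M := size (body g) + nv + max_arity g + k.

Lemma enumerator_enumerates D (nu : fact Const -> carrier g) :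
  database_over (qschema g) D ->
  enumerates (enumerator k) D nu
    (search_time k (g := g) [::] (fun=> munit (times g)) n0.+1
     + (max_cost (data_bound k M (size D)) rows_cmd
        + max_cost (data_bound k M (size D)) tables_phase))
    (max_cost (fun=> nv) advance_cmd + 3).
Proof.
move=> database_ok; set ms := search_memory k D nu.
have [_ bm lm _] := search_spec (search_memory_ready k D nu n0).
rewrite -/pl -/nv -[den search_cmd _]/(ms n0.+1) in bm lm.
have fr a : a \notin writes (init_cmd k) ++ writes search_cmd ->
    ms n0.+1 a = @input_memory Const g D nu a by apply: search_memory_frame.
set m := ms n0.+1 in bm lm fr *; set m1 := den rows_cmd m.
have plan_ok : valid_plan g k nv pl := code_n0.
have dm1 : dmem D nu k nv pl m1.
  split; [exact: base_den bm | by move=> j jn; rewrite /m1 den_frame // lm | exact: rows_spec bm].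
have hs1 : @has_assignment Const g nv m1 (fun=> None).
  by move=> v vn; rewrite /m1 den_frame // fr.
have hd1 : m1 aDONE [::] = Bot by rewrite /m1 den_frame // fr.
have spec := tables_phase_spec plan_ok dm1 hs1 hd1.
have data_m : den data_cmd m = den tables_phase m1 by rewrite /data_cmd den_seq.
rewrite -data_m in spec.
set all_states := states D k nv pl (wt D nu k nv pl) (nv - first_free g nv pl).
set out := outputs D k nv pl (wt D nu k nv pl).
have tab_ok := wt_is_table D nu plan_ok.
(* The case of an empty result, in which no state is ever [arrived]. *)
have no_output : isSome (wt D nu k nv pl nv 0) = false -> out = [::].
  move=> e; rewrite /out /outputs; elim: (states _ _ _ _ _ _) => //= st sts ->.
  by rewrite /state_annotation; case: (wt _ _ _ _ _ _ _) e.
pose es i := iter i (den advance_cmd) (den data_cmd m).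
have mE : iter n0.+1 (den search_cmd) (den (init_cmd k) (@input_memory Const g D nu)) = m by [].
have reached : (forall i, i < size out -> exists2 st,
      onth all_states i = Some st & arrived D nu k nv pl (es i) st) /\ es (size out) aDONE [::] = Num 1.
  case e : (isSome (wt D nu k nv pl nv 0)) spec => spec.
    have [h1 h2] := states_reached plan_ok e spec.
    rewrite /out size_outputs //; split=> // i lt_i; exists (nth [::] all_states i); last exact: h1.
    move: (onthTE all_states i); rewrite lt_i.
    by case eo : (onth _ _) => [x|] // _; rewrite (@onth_nth _ [::] x _ _ eo).
  by rewrite no_output.
have [reach last_ok] := reached.
have arr i : i < size out -> exists st, arrived D nu k nv pl (es i) st.
  by move=> lt_i; have [st _ h] := reach i lt_i; exists st.
apply: (@enumerates_leq _ _ _ _ _ (search_time k D nu n0.+1 + cost data_cmd m)).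
  rewrite search_time_const leq_add2l; apply: leq_add.
    by apply: rows_cost bm _; rewrite /M leq_addl.
  exact: tables_cost dm1 _.
rewrite /search_time; apply: (@assemble_enumerates _ _ _ _ _ _ _ _ _ _ n0 out) => //.
- move=> n lt_n; rewrite /get -[iter _ _ _]/(search_memory k D nu n.+1) search_memory_found.
  rewrite (_ : has _ _ = false) //; apply/negbTE/hasPn => i; rewrite mem_iota add0n => /= hi.
  by apply: code_min; apply: leq_trans lt_n.
- rewrite /get -[iter _ _ _]/(search_memory k D nu n0.+1) search_memory_found.
  rewrite (_ : has _ _ = true) //; apply/hasP; exists n0; last exact: code_n0.
  by rewrite mem_iota add0n ltnS leqnn.
- by move=> i /arr[st [m' [e _ _ _ hd]]]; rewrite /get mE -/(es i) e den_frame // hd.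
- by rewrite /get mE -/(es (size out)) last_ok.
- move=> i a ea; have lt_i : i < size out by rewrite -onthTE ea.
  have root_ok : isSome (wt D nu k nv pl nv 0).
    by case e : (isSome _) => //; rewrite (no_output e) in lt_i.
  have [st' [e' _ e1 e2]] := onth_outputs plan_ok root_ok ea.
  have [st e h] := reach i lt_i; rewrite e' in e; case: e => e; rewrite -e in h.
  by rewrite mE; apply: (arrived_shows query_ok plan_ok root_ok h).
- by move=> i /arr[st h]; rewrite mE; apply: advance_cost h.
- exact: NoDup_outputs plan_ok tab_ok.
- by move=> f n; apply: outputs_answers.
Qed.
End Enumerator.

Theorem theorem6p3 (Const : eqType) (C : query Const -> Prop)
    (C_semiring : forall g, C g -> semiring_query g)
    (C_bounded : exists k : nat, forall g, C g -> pghw_at_most g k) :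
  constant_delay_after_poly_preprocessing C.
Proof.
have [k hk] := C_bounded; exists (enumerator k), (exponent k) => g Cg.
have query_ok := C_semiring g Cg.
(* The search stops at the least valid code. It depends on [g] only, and so do the constants derived
   from it. *)
have [n0 code_n0 code_least] := ex_minnP (code_exists (hk g Cg)).
set M := size (body g) + (unpair n0).1 + max_arity g + k.
have code_min n : n < n0 -> ~~ code_ok g k n.
  by move=> lt_n; apply/negP => /code_least; rewrite leqNgt lt_n.
have poly : poly_bounded (exponent k) (fun N => search_time k (g := g) [::] (fun=> munit (times g)) n0.+1
     + (max_cost (data_bound k M N) rows_cmd + max_cost (data_bound k M N) tables_phase)).
  apply: poly_boundedD; first by apply: poly_bounded_weaken (poly_bounded_const _).
  apply: poly_boundedD.
    by apply: poly_bounded_weaken (data_cost_poly _ _ _); apply: leq_maxl.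
  by apply: poly_bounded_weaken (data_cost_poly _ _ _); apply: leq_maxr.
have [B hB] := poly_bounded_shift (size (qschema g)) poly.
exists B, (max_cost (fun=> (unpair n0).1) advance_cmd + 3) => D nu database_ok.
apply: enumerates_leq (enumerator_enumerates query_ok code_n0 code_min nu database_ok).
apply: leq_trans (hB _); rewrite leq_add2l.
by apply: leq_add; apply: data_cost_mono; apply: size_db.
Qed.
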